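(* Let $K$ be a non-trivial compact metrizable group and let $\Gamma$ be a group of automorphisms of $K$. Then the following are equivalent: (1) $\Gamma$ is distal on $K$; (2) for each $\Gamma$-invariant non-trivial closed subgroup $L$ of $K$, the action of $\Gamma$ on $L$ is not ergodic; (3) for each $\Gamma$-invariant non-trivial closed subgroup $L$ of $K$, there exists a non-trivial continuous irreducible unitary representation $\pi$ of $L$ such that the orbit $\Gamma[\pi]=\{\alpha[\pi]\mid\alpha\in\Gamma\}$ is finite in $\hat L$.
   Context: Automorphism means continuous (topological group) automorphism. A subgroup $L$ is $\Gamma$-invariant if $\alpha(L)=L$ for all $\alpha\in\Gamma$. The action of $\Gamma$ on $K$ is distal if for every $x\in K\setminus\{e\}$, the identity $e$ is not in the closure of the orbit $\Gamma(x)=\{\alpha(x)\mid\alpha\in\Gamma\}$. The action of $\Gamma$ on a compact group $L$ is ergodic if every $\Gamma$-invariant Borel set $A\subset L$ satisfies $\omega_L(A)=0$ or $\omega_L(A)=1$, where $\omega_L$ is the normalized Haar measure of $L$. $\hat L$ denotes the set of unitary equivalence classes $[\pi]$ of continuous irreducible unitary representations $\pi$ of $L$. The dual action of $\Gamma$ on $\hat L$ is $\alpha[\pi]=[\alpha(\pi)]$, where $\alpha(\pi)(x)=\pi(\alpha^{-1}(x))$ for $x\in L$. *)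

(* Defs.v *)
From HB Require Import structures.
From mathcomp Require Import all_boot all_order all_algebra.
From mathcomp Require Import complex.
From mathcomp Require Import all_classical all_reals all_analysis.
Import Order.TTheory GRing.Theory Num.Theory.
Import numFieldNormedType.Exports.

Set Implicit Arguments.
Unset Strict Implicit.
Unset Printing Implicit Defensive.

Local Open Scope classical_set_scope.
Local Open Scope ring_scope.
Local Open Scope complex_scope.

HB.mixin Record isTopologicalGroup G of Group G & Topological G := {
  mulg_continuous : continuous (fun z : G * G => (z.1 * z.2)%g) ;
  invg_continuous : continuous (fun x : G => (x^-1)%g)
}.

#[short(type="topGroupType")]
HB.structure Definition TopologicalGroup :=
  {G of Group G & Topological G & isTopologicalGroup G}.

Definition metrizable (R : realType) (T : topologicalType) : Prop :=
  exists d : T -> T -> R,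
    [/\ forall x, d x x = 0,
        forall x y, d x y = 0 -> x = y,
        forall x y, d x y = d y x,
        forall y x z, d x z <= d x y + d y z &
        forall x (A : set T),
          nbhs x A <-> exists2 e : R, 0 < e & [set y | d x y < e] `<=` A].

Record subgroup (G : groupType) := Subgroup {
  subgroup_set :> set G ;
  subgroup1 : subgroup_set 1%g ;
  subgroupM : forall x y, subgroup_set x -> subgroup_set y ->
    subgroup_set (x * y)%g ;
  subgroupV : forall x, subgroup_set x -> subgroup_set (x^-1)%g
}.

(* A subgroup regarded as a topological group, with the subspace topology. *)
Definition subgroup_type (G : groupType) (L : subgroup G) : Type :=
  set_type (subgroup_set L).

Section SubgroupGroup.
Variables (G : groupType) (L : subgroup G).
Local Notation H := (subgroup_type L).

Definition subgroup_val (x : H) : G := set_val x.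

Definition subgroup_elt (x : G) (Lx : subgroup_set L x) : H := SigSub (mem_set Lx).

Lemma subgroup_valP (x : H) : subgroup_set L (subgroup_val x).
Proof. exact: set_valP. Qed.

Lemma subgroup_val_inj : injective subgroup_val.
Proof. exact: val_inj. Qed.

HB.instance Definition _ := Choice.copy H (set_type (subgroup_set L)).

Let one : H := subgroup_elt (subgroup1 L).
Let mul (x y : H) : H :=
  subgroup_elt (subgroupM (subgroup_valP x) (subgroup_valP y)).
Let inv (x : H) : H := subgroup_elt (subgroupV (subgroup_valP x)).

Let mulA : associative mul.
Proof. by move=> x y z; apply: subgroup_val_inj; exact: mulgA. Qed.

Let mul1 : left_id one mul.
Proof. by move=> x; apply: subgroup_val_inj; exact: mul1g. Qed.

Let mulr1 : right_id one mul.
Proof. by move=> x; apply: subgroup_val_inj; exact: mulg1. Qed.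

Let mulV : left_inverse one inv mul.
Proof. by move=> x; apply: subgroup_val_inj; exact: mulVg. Qed.

Let mulrV : right_inverse one inv mul.
Proof. by move=> x; apply: subgroup_val_inj; exact: mulgV. Qed.

HB.instance Definition _ := isGroup.Build H mulA mul1 mulr1 mulV mulrV.

Lemma subgroup_val1 : subgroup_val 1%g = 1%g. Proof. by []. Qed.

Lemma subgroup_valM : {morph subgroup_val : x y / (x * y)%g}.
Proof. by []. Qed.

Lemma subgroup_valV : {morph subgroup_val : x / (x^-1)%g}.
Proof. by []. Qed.

End SubgroupGroup.

Section SubgroupTopology.
Variables (G : topGroupType) (L : subgroup G).
Local Notation H := (subgroup_type L).
Local Notation val := (@subgroup_val G L).

HB.instance Definition _ :=
  Topological.copy H (initial_topology val).

Lemma subgroup_val_continuous : continuous val.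
Proof. exact: initial_continuous. Qed.

Lemma continuous_subgroup (T : topologicalType) (f : T -> H) :
  continuous (val \o f) -> continuous f.
Proof. exact: continuous_comp_initial. Qed.

Fact subgroup_mulg_continuous : continuous (fun z : H * H => (z.1 * z.2)%g).
Proof.
apply: continuous_subgroup.
have -> : val \o (fun z : H * H => (z.1 * z.2)%g) =
          (fun z : G * G => (z.1 * z.2)%g) \o
          (fun z : H * H => (val z.1, val z.2)).
  by apply/funext => z /=; rewrite subgroup_valM.
move=> z; apply: continuous_comp; last exact: mulg_continuous.
by apply: cvg_pair; apply: continuous_comp;
  [exact: cvg_fst|exact: subgroup_val_continuous
  |exact: cvg_snd|exact: subgroup_val_continuous].
Qed.

Fact subgroup_invg_continuous : continuous (fun x : H => (x^-1)%g).
Proof.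
apply: continuous_subgroup.
have -> : val \o (fun x : H => (x^-1)%g) = (fun x : G => (x^-1)%g) \o val.
  by apply/funext => x /=; rewrite subgroup_valV.
move=> x; apply: continuous_comp; first exact: subgroup_val_continuous.
exact: invg_continuous.
Qed.

HB.instance Definition _ := isTopologicalGroup.Build H
  subgroup_mulg_continuous subgroup_invg_continuous.

End SubgroupTopology.

Record topAut (G : topGroupType) := TopAut {
  aut_fun :> G -> G ;
  aut_inv : G -> G ;
  aut_funK : cancel aut_fun aut_inv ;
  aut_invK : cancel aut_inv aut_fun ;
  aut_funM : {morph aut_fun : x y / (x * y)%g} ;
  aut_fun_continuous : continuous aut_fun ;
  aut_inv_continuous : continuous aut_inv
}.

Section AutGroup.
Variable G : topGroupType.
Implicit Types a b : topAut G.

Lemma aut1 a : a 1%g = 1%g.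
Proof. by apply: (mulgI (a 1%g)); rewrite -aut_funM !mulg1. Qed.

HB.instance Definition _ := gen_eqMixin (topAut G).
HB.instance Definition _ := gen_choiceMixin (topAut G).

Lemma topAutP a b : a =1 b -> a = b.
Proof.
case: a b => [f f' fK f'K fM fc f'c] [g g' gK g'K gM gc g'c] /= fg.
have {}fg : f = g by exact/funext.
have f'g' : f' = g' by apply/funext => x; rewrite -[in LHS](g'K x) -fg fK.
subst g g'; congr TopAut; exact: Prop_irrelevance.
Qed.

Definition aut_one : topAut G :=
  @TopAut G id id (fun=> erefl) (fun=> erefl) (fun _ _ => erefl)
    (fun x => @cvg_id _ (nbhs x)) (fun x => @cvg_id _ (nbhs x)).

Definition aut_mul a b : topAut G.
Proof.
refine (@TopAut G (a \o b) (aut_inv b \o aut_inv a)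
  (can_comp (aut_funK a) (aut_funK b)) (can_comp (aut_invK b) (aut_invK a))
  _ _ _).
- by move=> x y /=; rewrite !aut_funM.
- by move=> x; apply: continuous_comp; exact: aut_fun_continuous.
- by move=> x; apply: continuous_comp; exact: aut_inv_continuous.
Defined.

Definition aut_V a : topAut G.
Proof.
refine (@TopAut G (aut_inv a) a (aut_invK a) (aut_funK a) _
  (@aut_inv_continuous _ a) (@aut_fun_continuous _ a)).
by move=> x y; apply: (can_inj (aut_funK a)); rewrite aut_funM !aut_invK.
Defined.

Fact aut_mulA : associative aut_mul.
Proof. by move=> a b c; exact: topAutP. Qed.

Fact aut_mul1 : left_id aut_one aut_mul.
Proof. by move=> a; exact: topAutP. Qed.

Fact aut_mulr1 : right_id aut_one aut_mul.
Proof. by move=> a; exact: topAutP. Qed.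

Fact aut_mulV : left_inverse aut_one aut_V aut_mul.
Proof. by move=> a; apply: topAutP => x /=; exact: aut_funK. Qed.

Fact aut_mulrV : right_inverse aut_one aut_V aut_mul.
Proof. by move=> a; apply: topAutP => x /=; exact: aut_invK. Qed.

HB.instance Definition _ := isGroup.Build (topAut G)
  aut_mulA aut_mul1 aut_mulr1 aut_mulV aut_mulrV.

End AutGroup.

Section Actions.
Variable G : topGroupType.
Implicit Types (Gamma : set (topAut G)) (L : subgroup G).

Definition aut_orbit Gamma (x : G) : set G := [set a x | a in Gamma].

Definition distal Gamma : Prop :=
  forall x : G, x != 1%g -> ~ closure (aut_orbit Gamma x) 1%g.

Definition invariant_set Gamma (A : set G) : Prop :=
  forall a, Gamma a -> a @` A = A.

(* The action of Gamma on an invariant subgroup L, as the set of the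
   automorphisms of L induced by the elements of Gamma. *)
Definition restr_action Gamma L : set (topAut (subgroup_type L)) :=
  [set b | exists2 a, Gamma a &
     forall x, subgroup_val (b x) = a (subgroup_val x)].

Arguments restr_action : clear implicits.

(* No element of Gamma is lost by restr_action: each one does induce an automorphism of L. *)
Lemma restr_actionP Gamma L a : Gamma a -> a @` subgroup_set L = L ->
  exists2 b, restr_action Gamma L b &
    forall x, subgroup_val (b x) = a (subgroup_val x).
Proof.
move=> Ga aL.
have fP (x : subgroup_type L) : subgroup_set L (a (subgroup_val x)).
  by rewrite -aL; exists (subgroup_val x) => //; exact: subgroup_valP.
have gP (x : subgroup_type L) : subgroup_set L (aut_inv a (subgroup_val x)).
  by have := subgroup_valP x; rewrite -[X in X _ -> _]aL => -[y Ly <-];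
    rewrite aut_funK.
have fK : cancel (fun x => subgroup_elt (fP x)) (fun x => subgroup_elt (gP x)).
  by move=> x; apply: subgroup_val_inj; exact: aut_funK.
have gK : cancel (fun x => subgroup_elt (gP x)) (fun x => subgroup_elt (fP x)).
  by move=> x; apply: subgroup_val_inj; exact: aut_invK.
have fM : {morph (fun x => subgroup_elt (fP x)) : x y / (x * y)%g}.
  by move=> x y; apply: subgroup_val_inj; exact: aut_funM.
have fc : continuous (fun x => subgroup_elt (fP x)).
  apply: continuous_subgroup => x.
  apply: (@continuous_comp _ _ _ (@subgroup_val G L) a).
    exact: subgroup_val_continuous.
  exact: aut_fun_continuous.
have gc : continuous (fun x => subgroup_elt (gP x)).
  apply: continuous_subgroup => x.
  apply: (@continuous_comp _ _ _ (@subgroup_val G L) (aut_inv a)).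
    exact: subgroup_val_continuous.
  exact: aut_inv_continuous.
by exists (TopAut fK gK fM fc gc) => //; exists a.
Qed.

End Actions.
Arguments restr_action {G} Gamma L.

Section Haar.
Variables (R : realType) (G : topGroupType).

(* Measurable types are pointed: the Borel space of G is pointed by 1. *)
Definition pointed_group : Type := G.
HB.instance Definition _ := Choice.copy pointed_group G.
HB.instance Definition _ := isPointed.Build pointed_group (1%g : G).

Definition borel := g_sigma_algebraType (@open G : set (set pointed_group)).

(* On a compact metrizable group there is exactly one such probability:
   left invariance implies right invariance, and regularity is automatic. *)
Definition normalized_haar (mu : probability borel R) : Prop :=
  forall (g : G) (A : set G), measurable (A : set borel) ->
    mu [set (g * x)%g | x in A] = mu A.

Definition ergodic (Gamma : set (topAut G)) : Prop :=
  forall mu : probability borel R, normalized_haar mu ->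
  forall A : set G, measurable (A : set borel) -> invariant_set Gamma A ->
    mu A = 0%E \/ mu A = 1%E.

End Haar.

Definition finite_pred (T : Type) (P : T -> Prop) : Prop :=
  exists n (F : 'I_n -> T), forall x, P x -> exists i, F i = x.

Record hilbertSpace (R : realType) := HilbertSpace {
  hilbert_sort :> completeNormedModType R[i] ;
  hdot : {dot hilbert_sort for @Num.Def.conjC R[i]} ;
  hdot_norm : forall v, hdot v v = `|v| ^+ 2
}.

Section UnitaryReps.
Variables (R : realType) (G : topGroupType).

(* The representation space may be infinite-dimensional; continuity is with
   respect to the strong operator topology. Surjectivity of the isometries
   follows from rep_op1 and rep_opM. *)
Record unitaryRep := UnitaryRep {
  rep_space : hilbertSpace R ;
  rep_op :> G -> {linear rep_space -> rep_space} ;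
  rep_op1 : forall v, rep_op 1%g v = v ;
  rep_opM : forall g h v, rep_op (g * h)%g v = rep_op g (rep_op h v) ;
  rep_op_unitary : forall g u v,
    hdot rep_space (rep_op g u) (rep_op g v) = hdot rep_space u v ;
  rep_op_continuous : forall v, continuous (fun g => rep_op g v)
}.

Definition irreducible_rep (pi : unitaryRep) : Prop :=
  (exists v : rep_space pi, v != 0) /\
  forall W : set (rep_space pi),
    closed W -> submod_closed (mem W) ->
    (forall g v, W v -> W (pi g v)) ->
    W = [set 0] \/ W = setT.

Definition nontrivial_rep (pi : unitaryRep) : Prop :=
  exists g v, pi g v != v.

Definition rep_equiv (pi rho : unitaryRep) : Prop :=
  exists U : {linear rep_space pi -> rep_space rho},
    [/\ forall w, exists v, U v = w,
        forall u v, hdot (rep_space rho) (U u) (U v) = hdot (rep_space pi) u v &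
        forall g v, U (pi g v) = rho g (U v)].

(* [pi], as the predicate of being unitarily equivalent to pi. The type
   unitaryRep is too large for set, hence the bare predicates here and below. *)
Definition rep_class (pi : unitaryRep) : unitaryRep -> Prop := rep_equiv pi.

Definition rep_twist (a : topAut G) (pi : unitaryRep) : unitaryRep.
Proof.
refine (@UnitaryRep (rep_space pi) (fun x => pi ((a^-1)%g x)) _ _ _ _).
- by move=> v; rewrite aut1 rep_op1.
- by move=> g h v; rewrite aut_funM rep_opM.
- by move=> g u v; exact: rep_op_unitary.
- move=> v x; apply: (continuous_comp (f := (a^-1)%g) (g := pi ^~ v)).
    exact: aut_fun_continuous.
  exact: rep_op_continuous.
Defined.

(* The orbit of [pi] under the dual action a[pi] = [pi \o a^-1]. *)
Definition dual_orbit (Gamma : set (topAut G)) (pi : unitaryRep) :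
    (unitaryRep -> Prop) -> Prop :=
  fun c => exists2 a, Gamma a & c = rep_class (rep_twist a pi).

End UnitaryReps.

(* Main.v *)
(* Haar integration is obtained from averages of finitely many translates of a
   continuous function, which can be made arbitrarily close to a constant; the
   Haar measure of an open set is the supremum of the integrals of the functions
   subordinate to it.

   (1) => (2): if the action on L is ergodic, then for each ball around 1 the union
   of its preimages under Gamma has full measure, so some x <> 1 lies in all these
   unions, and 1 is in the closure of its orbit.

   (2) => (3): an invariant set A with 0 < mu A < 1 gives the continuous, symmetric
   and Gamma-invariant function psi(g) = mu(gA & A), which is not constant. The
   largest eigenvalue of T o T, for T the convolution by psi minus its mean, has a
   finite-dimensional eigenspace that is invariant under translations and under
   Gamma and contains no non-zero constant. Gamma permutes the finitely many classes of
   irreducible subrepresentations of the complexified eigenspace, and none of these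
   is trivial.

   (3) => (1): if 1 is in the closure of the orbit of x <> 1, let pi be given by (3)
   for the closed invariant subgroup L generated by x. As an irreducible
   representation of a compact group, pi is norm continuous; equivalent
   representations have the same displacement |pi(y) - 1|, so all the twists of pi,
   which form finitely many classes, are simultaneously close to 1 at the points of
   the orbit of x that are close to 1. Their values at such a point are their values
   at x in another order, so all of them are trivial at x. The points of L where all
   twists are trivial form a closed invariant subgroup, hence L, and pi is trivial. *)

Require Import Defs.
From HB Require Import structures.
From mathcomp Require Import all_boot all_order all_algebra.
From mathcomp Require Import complex.
From mathcomp Require Import all_classical all_reals all_analysis.
From mathcomp Require Import measurable_realfun sesquilinear spectral.
From mathcomp Require Import ring lra.
Import Order.TTheory GRing.Theory Num.Theory.
Import numFieldNormedType.Exports.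

Set Implicit Arguments.
Unset Strict Implicit.
Unset Printing Implicit Defensive.

Local Open Scope classical_set_scope.
Local Open Scope ring_scope.

(** * Invariant means on compact groups *)

Section Average.
Variables (R : realType).
Implicit Types T U : Type.

(** Two features of the statement shape the proof. Ergodicity quantifies over all normalized Haar
    measures, so its failure only yields some [mu]; what is needed of it (outer regularity,
    invariance under automorphisms, the fact that a set invariant up to null sets is null or full)
    comes from uniqueness. Uniqueness compares integrals with means of continuous functions, which
    are therefore built without any measure. Representations act on arbitrary Hilbert spaces and are
    only strongly continuous, so (3) => (1) cannot count on finite dimension. Its substitute is the
    mean over g of |<u, pi(g) v>|^2, a bounded invariant quadratic form in u. Its maximum on the
    unit ball is attained; the maximizing directions together with 0 form a closed invariant
    subspace, so irreducibility makes the form a multiple of |u|^2; and the form is visibly small on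
    pi(y) u - u for y near 1. This argument and the one for T o T are both extremal, with
    compactness supplied by equicontinuity, in place of a spectral theorem or an L2 completion. T o
    T replaces T because the extreme eigenvalue of T may have either sign. *)

Definition avg T (s : seq T) (F : T -> R) : R :=
  (\sum_(g <- s) F g) / (size s)%:R.

Lemma eq_avg T (s : seq T) (F H : T -> R) : F =1 H -> avg s F = avg s H.
Proof. by move=> FH; congr (_ / _); apply: eq_bigr => i _; rewrite FH. Qed.

Lemma avg_cst T (s : seq T) (c : R) : size s != 0 -> avg s (fun=> c) = c.
Proof.
move=> s0; rewrite /avg big_const_seq count_predT iter_addr_0 -[c *+ _]mulr_natr mulfK//.
by rewrite pnatr_eq0.
Qed.

Lemma avgD T (s : seq T) (F H : T -> R) :
  avg s (fun x => F x + H x) = avg s F + avg s H.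
Proof. by rewrite /avg big_split/= mulrDl. Qed.

Lemma avgZ T (s : seq T) (c : R) (F : T -> R) :
  avg s (fun x => c * F x) = c * avg s F.
Proof. by rewrite /avg -mulr_sumr mulrA. Qed.

Lemma avgB T (s : seq T) (F H : T -> R) :
  avg s (fun x => F x - H x) = avg s F - avg s H.
Proof. by rewrite /avg sumrB/= mulrBl. Qed.

Lemma le_avg T (s : seq T) (F H : T -> R) :
  (forall x, F x <= H x) -> avg s F <= avg s H.
Proof. by move=> FH; rewrite ler_wpM2r ?invr_ge0//; apply: ler_sum. Qed.

Lemma avg_le T (s : seq T) (F : T -> R) c : size s != 0 ->
  (forall x, F x <= c) -> avg s F <= c.
Proof. by move=> s0 Fc; rewrite -[leRHS](avg_cst c s0); exact: le_avg. Qed.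

Lemma avg_ge T (s : seq T) (F : T -> R) c : size s != 0 ->
  (forall x, c <= F x) -> c <= avg s F.
Proof. by move=> s0 Fc; rewrite -[leLHS](avg_cst c s0); exact: le_avg. Qed.

Lemma avg_dist T (s : seq T) (F : T -> R) c e : size s != 0 ->
  (forall x, `|F x - c| <= e) -> `|avg s F - c| <= e.
Proof.
move=> s0 Fc; rewrite ler_distl; apply/andP; split.
- by apply: avg_ge => // x; have := Fc x; rewrite ler_distl => /andP[].
- by apply: avg_le => // x; have := Fc x; rewrite ler_distl => /andP[].
Qed.

Lemma avg_exchange T U (s : seq T) (t : seq U) (F : T -> U -> R) :
  avg s (fun x => avg t (F x)) = avg t (fun y => avg s (F ^~ y)).
Proof.
rewrite /avg -!mulr_suml -!mulrA [X in X * _ = _]exchange_big/=.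
by congr (_ * _); rewrite mulrC.
Qed.

Lemma avg_map T U (h : T -> U) (s : seq T) (F : U -> R) :
  avg (map h s) F = avg s (F \o h).
Proof. by rewrite /avg big_map size_map. Qed.

Lemma avg_allpairs T U V (h : T -> U -> V) (s : seq T) (t : seq U) (F : V -> R) :
  avg [seq h x y | x <- s, y <- t] F = avg s (fun x => avg t (fun y => F (h x y))).
Proof.
rewrite /avg big_allpairs_dep/= size_allpairs natrM invfM.
rewrite -mulr_suml; ring.
Qed.

Lemma avg_improve (T : eqType) (s : seq T) (F : T -> R) x M e : x \in s ->
  (forall y, F y <= M) -> F x <= M - e -> avg s F <= M - e / (size s)%:R.
Proof.
move=> xs FM Fx; have s0 : 0 < (size s)%:R :> R.
  by rewrite ltr0n; case: s xs.
rewrite /avg ler_pdivrMr// mulrBl divfK ?gt_eqF//.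
rewrite (big_rem x xs)/=.
have : \sum_(y <- rem x s) F y <= \sum_(y <- rem x s) M by apply: ler_sum.
rewrite big_const_seq count_predT iter_addr_0 -[_ *+ _]mulr_natr size_rem//.
have -> : (size s)%:R = (size s).-1%:R + 1 :> R.
  by rewrite natr1 prednK // -(ltr0n R).
move: Fx; set a := (size s).-1%:R; move: (\sum_(_ <- _) _) => b; nra.
Qed.

End Average.

(** * Compactness: finite covers and uniform estimates *)

Section CompactTools.
Variable R : realType.

(** The tube lemma: it turns an estimate that holds locally in y into one that is uniform over the
    compact factor. *)
Lemma near_compact_all (X Y : topologicalType) (P : X -> Y -> Prop) (x0 : X) :
  compact [set: Y] ->
  (forall y : Y, \forall y' \near y & x \near x0, P x y') ->
  \forall x \near x0, forall y, P x y.
Proof.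
move=> /compact_near_coveringP cY HP.
have cYP := cY X (nbhs x0) P (nbhs_filter x0) (fun y _ => HP y).
by apply: (@filterS _ _ (nbhs_filter x0) _ _ _ cYP) => x H y; exact: H.
Qed.

(** Finite subcovers from the filter form of compactness. The filter is that of finite sequences
    directed by inclusion: a point of [N x] is covered as soon as the sequence contains x. *)
Lemma compact_nbhs_cover (X : topologicalType) (N : X -> set X) :
  compact [set: X] -> (forall x, nbhs x (N x)) ->
  exists s : seq X, forall y, exists2 x, x \in s & N x y.
Proof.
move=> /compact_near_coveringP cX NN.
pose F := filter_from setT (fun s0 : seq X => [set s : seq X | {subset s0 <= s}]).
have FF : Filter F.
  apply: filter_fromT_filter; first by exists [::].
  by move=> s t; exists (s ++ t) => u stu; split=> x xs; apply: stu;
    rewrite mem_cat xs ?orbT.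
have [|s _ cov] := cX _ F (fun s y => exists2 x, x \in s & N x y) FF.
  move=> x _; exists (N x, [set s : seq X | x \in s]) => /=.
    by split; [exact: NN|exists [:: x] => // s; apply; rewrite inE].
  by move=> [y s] /= [Nxy xs]; exists x.
by exists s => y; exact: (cov s (fun=> id) y).
Qed.

Lemma compact_unif_fst (X Y : topologicalType) (F : X * Y -> R) (x0 : X) (e : R) :
  compact [set: Y] -> continuous F -> 0 < e ->
  \forall x \near x0, forall y, `|F (x, y) - F (x0, y)| < e.
Proof.
move=> cY cF e0; apply: near_compact_all => // y.
have e20 : 0 < e / 2 by rewrite divr_gt0.
have /cvgr_dist_lt/(_ _ e20) [[A B]/= [xA yB] AB] := cF (x0, y).
exists (B, A) => //= -[y' x] /= [By Ax].
rewrite -(subrKA (F (x0, y))) (splitr e).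
apply: (le_lt_trans (ler_normD _ _)); rewrite ltrD//.
- by rewrite distrC; exact: (AB (x, y')).
- by apply: (AB (x0, y')); split => //; exact: nbhs_singleton.
Qed.

End CompactTools.

Section RealContinuity.
Variables (R : realType) (T : topologicalType).
Implicit Types f h : T -> R.

Lemma continuous_add f h : continuous f -> continuous h ->
  continuous (fun x => f x + h x).
Proof. by move=> cf ch x; apply: cvgD; [exact: cf|exact: ch]. Qed.

Lemma continuous_opp f : continuous f -> continuous (fun x => - f x).
Proof. by move=> cf x; apply: cvgN; exact: cf. Qed.

Lemma continuous_sub f h : continuous f -> continuous h ->
  continuous (fun x => f x - h x).
Proof. by move=> cf ch; apply: continuous_add => //; exact: continuous_opp. Qed.

Lemma continuous_prod f h : continuous f -> continuous h ->
  continuous (fun x => f x * h x).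
Proof. by move=> cf ch x; apply: cvgM; [exact: cf|exact: ch]. Qed.

Lemma continuous_scale (c : R) f : continuous f -> continuous (fun x => c * f x).
Proof. by apply: continuous_prod => x; exact: cvg_cst. Qed.

Lemma continuous_sum (I : Type) (r : seq I) (F : I -> T -> R) :
  (forall i, continuous (F i)) -> continuous (fun x => \sum_(i <- r) F i x).
Proof. by move=> cF; apply: continuous_big => //; exact: add_continuous. Qed.

Lemma continuous_avg (I : Type) (r : seq I) (F : I -> T -> R) :
  (forall i, continuous (F i)) -> continuous (fun x => avg r (fun i => F i x)).
Proof.
move=> cF; apply: continuous_prod; first exact: continuous_sum.
by move=> x; exact: cvg_cst.
Qed.

End RealContinuity.

(** * The invariant mean of continuous functions *)

Section HaarMean.
Variables (R : realType) (G : topGroupType).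
Hypothesis cG : compact [set: G].
Implicit Types f : G -> R.

(** Von Neumann's approach: the integral of f is the constant that averages of translates of f
    approach uniformly. *)
Definition left_mean f (c : R) := forall e : R, 0 < e ->
  exists2 s : seq G, size s != 0%N & forall x, `|avg s (fun g => f (g * x)%g) - c| <= e.

Definition right_mean f (c : R) := forall e : R, 0 < e ->
  exists2 s : seq G, size s != 0%N & forall x, `|avg s (fun g => f (x * g)%g) - c| <= e.

Lemma continuous_mul (T : topologicalType) (a b : T -> G) :
  continuous a -> continuous b -> continuous (fun x => (a x * b x)%g).
Proof.
move=> ca cb x; apply: (@continuous_comp _ _ _ (fun x => (a x, b x)) (fun z => (z.1 * z.2)%g)).
  by apply: cvg_pair; [exact: ca|exact: cb].
exact: mulg_continuous.
Qed.

Lemma continuous_inv (T : topologicalType) (a : T -> G) :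
  continuous a -> continuous (fun x => (a x)^-1%g).
Proof.
move=> ca x; apply: (@continuous_comp _ _ _ a (fun z => z^-1%g)).
  exact: ca.
exact: invg_continuous.
Qed.

Lemma continuous_compose (T U V : topologicalType) (a : T -> U) (b : U -> V) :
  continuous a -> continuous b -> continuous (fun x => b (a x)).
Proof. by move=> ca cb x; apply: continuous_comp; [exact: ca|exact: cb]. Qed.

Lemma continuous_idfun (T : topologicalType) : continuous (fun x : T => x).
Proof. by move=> x; exact: cvg_id. Qed.

Lemma continuous_const (T U : topologicalType) (a : U) : continuous (fun x : T => a).
Proof. by move=> x; exact: cvg_cst. Qed.

Lemma continuous_lmul (a : G) : continuous (fun x => (a * x)%g).
Proof.
by apply: continuous_mul; [exact: continuous_const|exact: continuous_idfun].
Qed.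

Lemma unif_right f (e : R) : continuous f -> 0 < e ->
  \forall w \near (1%g : G), forall x, `|f (x * w)%g - f x| < e.
Proof.
move=> cf e0.
have := @compact_unif_fst R G G (fun z => f (z.2 * z.1)%g) 1%g e cG _ e0.
have cF : continuous (fun z : G * G => f (z.2 * z.1)%g).
  apply: continuous_compose cf; apply: continuous_mul.
  - by move=> z; exact: cvg_snd.
  - by move=> z; exact: cvg_fst.
move=> /(_ cF); apply: (@filterS _ _ (nbhs_filter _)) => w wP x.
by have := wP x; rewrite /= mulg1.
Qed.

Lemma compact_bounded f : continuous f -> exists M : R, forall x, `|f x| <= M.
Proof.
move=> cf.
have [|s sP] := @compact_nbhs_cover G
  (fun x => [set y | `|f y| < `|f x| + 1]) cG; last first.
- exists (\sum_(x <- s) (`|f x| + 1)) => y.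
  have [x xs /= /ltW fy] := sP y; apply: (le_trans fy).
  by rewrite (big_rem x xs)/= lerDl sumr_ge0// => i _; rewrite addr_ge0.
- move=> x; have /cvgr_dist_lt/(_ _ ltr01) := cf x.
  apply: filterS => y /= fxy.
  have := ler_normD (f x) (f y - f x); rewrite addrCA subrr addr0 distrC => H.
  by rewrite (le_lt_trans H)// ltrD2l.
Qed.

(* Let M be nearly the least possible maximum of an average of left translates
   of f. If such an average dips by e somewhere, it dips by e/2 on a translate of
   a fixed neighbourhood W of 1, and averaging it over the N translates needed to
   cover G with copies of W lowers the maximum by e/(2N), a contradiction. *)
Lemma small_oscillation f (e : R) : continuous f -> 0 < e ->
  exists2 s : seq G, size s != 0%N & forall x y,
    avg s (fun g => f (g * x)%g) <= avg s (fun g => f (g * y)%g) + e.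
Proof.
move=> cf e0; have e20 : 0 < e / 2 by rewrite divr_gt0.
have [W0 W0P] : exists2 W, nbhs (1%g : G) W &
    forall w x, W w -> `|f (x * w)%g - f x| < e / 2.
  exists [set w | forall x, `|f (x * w)%g - f x| < e / 2].
    exact: unif_right.
  by move=> w x; exact.
move=> W0f.
have [|t tP] := @compact_nbhs_cover G (fun g => [set y | W0 (g^-1 * y)%g]) cG.
  move=> x; have := @continuous_lmul x^-1%g x; rewrite /continuous_at mulVg.
  by apply.
have t0 : size t != 0%N by have [g] := tP 1%g; case: t {tP}.
have tgt : 0 < (size t)%:R :> R by rewrite ltr0n lt0n.
have [B fB] := compact_bounded cf.
pose E := [set M | exists2 s : seq G, size s != 0%N &
  forall x, avg s (fun g => f (g * x)%g) <= M].
have infE : has_inf E.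
  split.
    exists B, [:: 1%g] => // x; apply: avg_le => // g.
    by apply: le_trans (fB _); exact: ler_norm.
  exists (- B) => M [s s0 sM]; apply: (le_trans _ (sM 1%g)).
  by apply: avg_ge => // g; have := fB (g * 1)%g; rewrite ler_norml => /andP[].
have eta0 : 0 < (e / 2) / (size t)%:R by rewrite divr_gt0.
have [M [s s0 sM] Mlt] := inf_adherent eta0 infE.
exists s => // x y; rewrite leNgt; apply/negP => xy.
suff : E (M - (e / 2) / (size t)%:R).
  move=> /(ge_inf infE.2); rewrite leNgt => /negP; apply.
  by rewrite ltrBlDr.
(* For z in k [W0] the point y k^-1 z lies in y [W0], where the average over s is at most M - e /
   2. *)
exists [seq (g * h)%g | h <- [seq (y * k^-1)%g | k <- t], g <- s].
  by rewrite size_allpairs size_map muln_eq0 negb_or t0.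
move=> z; rewrite avg_allpairs avg_map/=.
have [k kt Wk] := tP z.
have := @avg_improve R G t
  (fun k => avg s (fun g => f (g * (y * k^-1) * z)%g)) k M (e / 2) kt.
apply.
- move=> h; apply: le_trans (sM (y * h^-1 * z)%g).
  by apply: le_avg => g; rewrite !mulgA.
- apply: (@le_trans _ _ (avg s (fun g => f (g * y)%g) + e / 2)).
    rewrite -(avg_cst (e / 2) s0) -avgD; apply: le_avg => g.
    rewrite -lerBlDl; have := W0f _ (g * y)%g Wk.
    by rewrite !mulgA => H; apply: ltW; apply: le_lt_trans H; exact: ler_norm.
  by have := sM x; lra.
Qed.

Lemma small_oscillation_right f (e : R) : continuous f -> 0 < e ->
  exists2 s : seq G, size s != 0%N & forall x y,
    avg s (fun g => f (x * g)%g) <= avg s (fun g => f (y * g)%g) + e.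
Proof.
move=> cf e0.
have [s s0 sP] := @small_oscillation (fun x => f x^-1%g) e
  (continuous_compose (@invg_continuous G) cf) e0.
exists [seq g^-1%g | g <- s]; first by rewrite size_map.
move=> x y; rewrite !avg_map/=; have := sP x^-1%g y^-1%g.
have E z : avg s (fun g => f (g / z)^-1%g) = avg s (fun g => f (z / g)%g).
  by apply: eq_avg => g; rewrite invgF.
by rewrite !E.
Qed.

(** Averaging over left and right translates at once gives a number close to both constants. Hence
    both kinds of mean are unique as soon as one of each exists. *)
Lemma left_right_mean f c d : left_mean f c -> right_mean f d -> c = d.
Proof.
move=> fc fd; apply/eqP; rewrite -subr_eq0 -normr_le0; apply/ler_addgt0Pr => e e0.
rewrite add0r.
have e20 : 0 < e / 2 by rewrite divr_gt0.
have [s s0 sP] := fc _ e20; have [t t0 tP] := fd _ e20.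
pose A := avg s (fun g => avg t (fun h => f (g * 1 * h)%g)).
have Ad : `|A - d| <= e / 2 by apply: avg_dist => // g; exact: tP.
have Ac : `|A - c| <= e / 2.
  rewrite /A avg_exchange; apply: avg_dist => // h.
  by under eq_avg do rewrite -mulgA; exact: sP.
by have := ler_distD A c d; rewrite (distrC c A); lra.
Qed.

(** The constant is the supremum of the lower bounds of left averages. Two left averages are
    compared through a right average of small oscillation, with which each can be exchanged; so no
    left average lies much above the chosen one. *)
Lemma left_mean_ex f : continuous f -> exists c, left_mean f c.
Proof.
move=> cf.
have [B fB] := compact_bounded cf.
pose E := [set m | exists2 s : seq G, size s != 0%N &
  forall x, m <= avg s (fun g => f (g * x)%g)].
have supE : has_sup E.
  split.
    exists (- B), [:: 1%g] => // x; apply: avg_ge => // g.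
    by have := fB (g * x)%g; rewrite ler_norml => /andP[].
  exists B => M [s s0 sM]; apply: (le_trans (sM 1%g)).
  by apply: avg_le => // g; apply: le_trans (fB _); exact: ler_norm.
exists (sup E) => e e0.
have e30 : 0 < e / 3 by rewrite divr_gt0.
have [s s0 sP] := small_oscillation cf e30.
have [t t0 tP] := small_oscillation_right cf e30.
exists s => // x; rewrite ler_distl; apply/andP; split.
- apply: (@le_trans _ _ (avg s (fun g => f (g * x)%g) + e - e)); last by rewrite addrK.
  rewrite lerD2r; apply: ge_sup supE.1 _ => m [u u0 um].
  pose b := avg t (fun h => f (1 * h)%g).
  have mb : m <= b + e / 3.
    apply: (@le_trans _ _ (avg t (fun h => avg u (fun g => f (g * h)%g)))).
      by apply: avg_ge => // h; exact: um.
    rewrite -avg_exchange; apply: avg_le => // g; exact: tP.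
  have bs : b - e / 3 <= avg s (fun g => f (g * x)%g) + e / 3.
    apply: (@le_trans _ _ (avg t (fun h => avg s (fun g => f (g * h)%g)))).
      rewrite -avg_exchange; apply: avg_ge => // g.
      by rewrite lerBlDr; exact: tP.
    by apply: avg_le => // h; exact: sP.
  lra.
- suff : avg s (fun g => f (g * x)%g) - e <= sup E by lra.
  apply: (ub_le_sup supE.2); exists s => // y.
  by have := sP x y; lra.
Qed.

Lemma left_mean_inv f c : left_mean f c <-> right_mean (fun x => f x^-1%g) c.
Proof.
split=> H e /H[s s0 sP]; exists [seq g^-1%g | g <- s]; rewrite ?size_map// => x.
- rewrite avg_map (@eq_avg _ _ _ _ (fun g => f (g * x^-1)%g)) => [|g]; first exact: sP.
  by rewrite /= invgM !invgK.
- rewrite avg_map (@eq_avg _ _ _ _ (fun g => f (x^-1 * g)^-1%g)) => [|g]; first exact: sP.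
  by rewrite /= invgM !invgK.
Qed.

Lemma right_mean_ex f : continuous f -> exists d, right_mean f d.
Proof.
move=> cf; have [c fc] := @left_mean_ex (fun x => f x^-1%g)
  (continuous_compose (@invg_continuous G) cf).
exists c; move: fc => /left_mean_inv.
by under eq_fun do rewrite invgK.
Qed.

(** The default 0 is taken only when f has no left mean, which never happens for continuous f. *)
Definition haar_mean f : R := xget 0 [set c | left_mean f c].

Lemma haar_left_mean f : continuous f -> left_mean f (haar_mean f).
Proof.
by move=> cf; rewrite /haar_mean; case: xgetP => //; have [c fc] := left_mean_ex cf => /(_ c).
Qed.

Lemma haar_right_mean f : continuous f -> right_mean f (haar_mean f).
Proof.
move=> cf; have [d fd] := right_mean_ex cf.
by rewrite (left_right_mean (haar_left_mean cf) fd).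
Qed.

Lemma haar_meanE f c : continuous f -> left_mean f c -> haar_mean f = c.
Proof.
by move=> cf fc; rewrite (left_right_mean fc (haar_right_mean cf)).
Qed.

Lemma haar_meanEr f c : continuous f -> right_mean f c -> haar_mean f = c.
Proof. by move=> cf fc; rewrite (left_right_mean (haar_left_mean cf) fc). Qed.

Lemma haar_mean_cst (c : R) : haar_mean (fun=> c) = c.
Proof.
apply: haar_meanE; first exact: continuous_const.
by move=> e e0; exists [:: 1%g] => // x; rewrite avg_cst// subrr normr0 ltW.
Qed.

(** Left translation commutes with right averages, so invariance on the left is read off the right
    mean. *)
Lemma haar_meanMl f a : continuous f -> haar_mean (fun x => f (a * x)%g) = haar_mean f.
Proof.
move=> cf; apply: haar_meanEr.
  exact: continuous_compose (@continuous_lmul a) cf.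
move=> e /(haar_right_mean cf)[s s0 sP]; exists s => // x.
by under eq_avg do rewrite mulgA.
Qed.

Lemma haar_mean_aut f (b : topAut G) : continuous f ->
  haar_mean (fun x => f (b x)) = haar_mean f.
Proof.
move=> cf; apply: haar_meanE.
  exact: continuous_compose (@aut_fun_continuous _ b) cf.
move=> e /(haar_left_mean cf)[s s0 sP].
exists [seq aut_inv b g | g <- s]; rewrite ?size_map// => x.
rewrite avg_map (@eq_avg _ _ _ _ (fun g => f (g * b x)%g)) => [|g]; first exact: sP.
by rewrite /= aut_funM aut_invK.
Qed.

(** A good average stays good under further averaging, so the functions can be treated one at a
    time: t is chosen for the average of f over s, whose mean is that of f since right averages
    commute with left translations. *)
Lemma left_mean_all (fs : seq (G -> R)) (e : R) :
  {in fs, forall f, continuous f} -> 0 < e ->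
  exists2 s : seq G, size s != 0%N & {in fs, forall f, forall x,
    `|avg s (fun g => f (g * x)%g) - haar_mean f| <= e}.
Proof.
move=> cfs e0; elim: fs cfs => [|f fs IH] cfs.
  by exists [:: 1%g].
have [|s s0 sP] := IH; first by move=> h hf; apply: cfs; rewrite inE hf orbT.
have cf : continuous f by apply: cfs; rewrite inE eqxx.
have cA : continuous (fun x => avg s (fun g => f (g * x)%g)).
  by apply: continuous_avg => g; exact: continuous_compose (@continuous_lmul g) cf.
have [t t0 tP] := haar_left_mean cA e0.
have ff : haar_mean (fun x => avg s (fun g => f (g * x)%g)) = haar_mean f.
  apply: haar_meanEr cA _ => d d0.
  have [u u0 uP] := haar_right_mean cf d0.
  exists u => // x; rewrite avg_exchange; apply: avg_dist => // g.
  by under eq_avg do rewrite mulgA; exact: uP.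
exists [seq (g * h)%g | h <- t, g <- s].
  by rewrite size_allpairs muln_eq0 negb_or t0.
move=> h; rewrite inE => /orP[/eqP ->|hfs] x; rewrite avg_allpairs.
- rewrite -ff; have := tP x.
  by under [in X in _ -> X]eq_avg do under eq_avg do rewrite -mulgA.
- apply: avg_dist => // y; have := sP _ hfs (y * x)%g.
  by under [in X in _ -> X]eq_avg do rewrite -mulgA.
Qed.

Lemma left_mean2 f (h : G -> R) (e : R) : continuous f -> continuous h -> 0 < e ->
  exists s : seq G, [/\ size s != 0%N,
    forall x, `|avg s (fun g => f (g * x)%g) - haar_mean f| <= e &
    forall x, `|avg s (fun g => h (g * x)%g) - haar_mean h| <= e].
Proof.
move=> cf ch e0; have [|s s0 sP] := @left_mean_all [:: f; h] e _ e0.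
  by move=> k; rewrite !inE => /orP[]/eqP ->.
by exists s; split=> //; apply: sP; rewrite !inE eqxx ?orbT.
Qed.

Lemma haar_meanD f (h : G -> R) : continuous f -> continuous h ->
  haar_mean (fun x => f x + h x) = haar_mean f + haar_mean h.
Proof.
move=> cf ch; apply: haar_meanE.
  exact: continuous_add.
move=> e e0; have e20 : 0 < e / 2 by rewrite divr_gt0.
have [s [s0 sf sh]] := left_mean2 cf ch e20.
exists s => // x; rewrite avgD opprD addrACA (splitr e).
by rewrite (le_trans (ler_normD _ _))// lerD.
Qed.

Lemma haar_meanZ f c : continuous f ->
  haar_mean (fun x => c * f x) = c * haar_mean f.
Proof.
move=> cf; apply: haar_meanE; first exact: continuous_scale.
move=> e e0; have [->|c0] := eqVneq c 0.
  exists [:: 1%g] => // x; under eq_avg do rewrite mul0r.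
  by rewrite avg_cst// mul0r subrr normr0 ltW.
have ec0 : 0 < e / `|c| by rewrite divr_gt0// normr_gt0.
have [s s0 sP] := haar_left_mean cf ec0; exists s => // x.
by rewrite avgZ -mulrBr normrM mulrC -ler_pdivlMr ?normr_gt0.
Qed.

Lemma haar_meanN f : continuous f -> haar_mean (fun x => - f x) = - haar_mean f.
Proof.
move=> cf; rewrite -mulN1r -haar_meanZ//.
by congr haar_mean; apply/funext => x; rewrite mulN1r.
Qed.

Lemma haar_meanB f (h : G -> R) : continuous f -> continuous h ->
  haar_mean (fun x => f x - h x) = haar_mean f - haar_mean h.
Proof.
move=> cf ch; rewrite haar_meanD ?haar_meanN//.
exact: continuous_opp.
Qed.

Lemma haar_mean_sum (I : Type) (r : seq I) (F : I -> G -> R) :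
  (forall i, continuous (F i)) ->
  haar_mean (fun x => \sum_(i <- r) F i x) = \sum_(i <- r) haar_mean (F i).
Proof.
move=> cF; elim: r => [|i r IH].
  by under eq_fun do rewrite big_nil; rewrite big_nil haar_mean_cst.
under eq_fun do rewrite big_cons; rewrite big_cons haar_meanD ?IH//.
exact: continuous_sum.
Qed.

Lemma haar_mean_ge0 f : continuous f -> (forall x, 0 <= f x) -> 0 <= haar_mean f.
Proof.
move=> cf f0; apply/ler_addgt0Pr => e e0.
have [s s0 sP] := haar_left_mean cf e0.
have : 0 <= avg s (fun g => f (g * 1)%g) by exact: avg_ge.
by have := sP 1%g; rewrite ler_distl => /andP[]; lra.
Qed.

Lemma le_haar_mean f (h : G -> R) : continuous f -> continuous h -> (forall x, f x <= h x) ->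
  haar_mean f <= haar_mean h.
Proof.
move=> cf ch fh; rewrite -subr_ge0 -haar_meanB//.
apply: haar_mean_ge0; last by move=> x; rewrite subr_ge0.
exact: continuous_sub.
Qed.

Lemma haar_mean_le f c : continuous f -> (forall x, f x <= c) -> haar_mean f <= c.
Proof.
move=> cf fc; rewrite -[leRHS]haar_mean_cst; apply: le_haar_mean => //.
exact: continuous_const.
Qed.

Lemma haar_mean_dist f (h : G -> R) (e : R) : continuous f -> continuous h ->
  (forall x, `|f x - h x| <= e) -> `|haar_mean f - haar_mean h| <= e.
Proof.
move=> cf ch fh; rewrite -haar_meanB//.
have cfh : continuous (fun x => f x - h x) by exact: continuous_sub.
rewrite ler_norml; apply/andP; split.
- rewrite -[leLHS]haar_mean_cst; apply: le_haar_mean => //.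
    exact: continuous_const.
  by move=> x; have := fh x; rewrite ler_norml => /andP[].
- by apply: haar_mean_le => // x; apply: le_trans (fh x); exact: ler_norm.
Qed.

(** Finitely many translates of the set where f is at least f(x0) / 2 cover G. The sum of the
    corresponding translates of f is bounded below by f(x0) / 2, and its mean is a multiple of that
    of f. *)
Lemma haar_mean_gt0 f x0 : continuous f -> (forall x, 0 <= f x) -> 0 < f x0 ->
  0 < haar_mean f.
Proof.
move=> cf f0 fx0.
have [|t tP] := @compact_nbhs_cover G
  (fun g => [set y | f x0 / 2 <= f (x0 * (g^-1 * y))%g]) cG.
  move=> g; have c1 : continuous (fun y => f (x0 * (g^-1 * y))%g).
    apply: continuous_compose cf.
    exact: continuous_compose (@continuous_lmul g^-1%g) (@continuous_lmul x0).
  have h0 : 0 < f x0 / 2 by rewrite divr_gt0.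
  have /cvgr_dist_lt/(_ _ h0) := c1 g; rewrite mulVg mulg1.
  by apply: filterS => y /=; rewrite ltr_distl => /andP[]; lra.
have cS : forall g : G, continuous (fun y => f (x0 * g^-1 * y)%g).
  by move=> g; exact: continuous_compose (@continuous_lmul _) cf.
have : f x0 / 2 <= haar_mean (fun y => \sum_(g <- t) f (x0 * g^-1 * y)%g).
  rewrite -[leLHS]haar_mean_cst; apply: le_haar_mean.
  - exact: continuous_const.
  - exact: continuous_sum.
  - move=> y; have [g gt /= fg] := tP y; rewrite (big_rem g gt)/= -mulgA.
    by apply: (le_trans fg); rewrite lerDl sumr_ge0.
rewrite haar_mean_sum// (eq_bigr (fun=> haar_mean f)); last first.
  by move=> g _; rewrite haar_meanMl.
have := haar_mean_ge0 cf f0; rewrite le0r => /orP[/eqP ->|//].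
by rewrite big1// pmulr_lle0// leNgt fx0.
Qed.

Lemma haar_mean_param (X : topologicalType) (F : X * G -> R) : continuous F ->
  continuous (fun x => haar_mean (fun y => F (x, y))).
Proof.
move=> cF x; apply/cvgrPdist_le => e e0.
have c1 z : continuous (fun y => F (z, y)).
  apply: (continuous_compose _ cF) => y.
  by apply: cvg_pair; [exact: cvg_cst|exact: cvg_id].
apply: filterS (compact_unif_fst x cG cF e0) => x' H.
by apply: haar_mean_dist => // y; rewrite distrC ltW.
Qed.

(** The inner mean over y is replaced by one finite average, chosen to be good for the partial
    functions at the points of a finite net in x and also for the mean over x. Finite averages
    commute with the mean. *)
Lemma haar_mean_Fubini (F : G * G -> R) : continuous F ->
  haar_mean (fun x => haar_mean (fun y => F (x, y))) =
  haar_mean (fun y => haar_mean (fun x => F (x, y))).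
Proof.
move=> cF; have cFs : continuous (fun z : G * G => F (z.2, z.1)).
  apply: (continuous_compose _ cF) => z.
  by apply: cvg_pair; [exact: cvg_snd|exact: cvg_fst].
have c1 x : continuous (fun y => F (x, y)).
  apply: (continuous_compose _ cF) => y.
  by apply: cvg_pair; [exact: cvg_cst|exact: cvg_id].
have c2 y : continuous (fun x => F (x, y)).
  apply: (continuous_compose _ cF) => x.
  by apply: cvg_pair; [exact: cvg_id|exact: cvg_cst].
have cI1 := haar_mean_param cF; have cI2 := haar_mean_param cFs.
apply/eqP; rewrite -subr_eq0 -normr_le0; apply/ler_addgt0Pr => e e0; rewrite add0r.
have d0 : 0 < e / 4 by rewrite divr_gt0.
have [t tP] := @compact_nbhs_cover G
  (fun x => [set x' | forall y, `|F (x', y) - F (x, y)| < e / 4]) cG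
  (fun x => compact_unif_fst x cG cF d0).
have [|s s0 sP] := @left_mean_all ((fun y => haar_mean (fun x => F (x, y))) ::
    [seq (fun y => F (x, y)) | x <- t]) (e / 4) _ d0.
  by move=> f; rewrite inE => /orP[/eqP -> //|/mapP[x _ -> //]].
have H1 : `|avg s (fun g => haar_mean (fun x => F (x, (g * 1)%g))) -
            haar_mean (fun y => haar_mean (fun x => F (x, y)))| <= e / 4.
  by apply: sP; rewrite inE eqxx.
have H2 x : `|avg s (fun g => F (x, (g * 1)%g)) - haar_mean (fun y => F (x, y))| <= e * 3 / 4.
  have [x' x't /= xx'] := tP x.
  have A1 : `|avg s (fun g => F (x', (g * 1)%g)) - haar_mean (fun y => F (x', y))| <= e / 4.
    by apply: (sP (fun y => F (x', y))); rewrite inE map_f ?orbT.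
  have A2 : `|haar_mean (fun y => F (x, y)) - haar_mean (fun y => F (x', y))| <= e / 4.
    by apply: haar_mean_dist => // y; exact: ltW.
  have A3 : `|avg s (fun g => F (x, (g * 1)%g)) - avg s (fun g => F (x', (g * 1)%g))| <= e / 4.
    rewrite -avgB -[X in `|X|]subr0; apply: avg_dist => // g.
    by rewrite subr0 ltW.
  move: A1 A2 A3; rewrite !ler_distl => /andP[? ?] /andP[? ?] /andP[? ?].
  by apply/andP; split; lra.
have cavg : continuous (fun x => avg s (fun g => F (x, (g * 1)%g))).
  by apply: continuous_avg => g; exact: c2.
have H3 : haar_mean (fun x => avg s (fun g => F (x, (g * 1)%g))) =
          avg s (fun g => haar_mean (fun x => F (x, (g * 1)%g))).
  rewrite /avg mulrC -haar_mean_sum// -haar_meanZ//.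
    by congr haar_mean; apply/funext => x; rewrite mulrC.
  by apply: continuous_sum => g; exact: c2.
have := haar_mean_dist cavg cI1 H2; rewrite H3.
move: H1; rewrite !ler_distl => /andP[? ?] /andP[? ?].
by apply/andP; split; lra.
Qed.

End HaarMean.

(** * Haar measure *)

Section ProbabilityOfMeasure.
Context (R : realType) d (T : measurableType d) (mu : {measure set T -> \bar R}).
Hypothesis muT : mu setT = 1%E.

Let P : set T -> \bar R := mu.

HB.instance Definition _ := Measure.on P.
HB.instance Definition _ := Measure_isProbability.Build _ _ _ P muT.

Lemma measure_probability : exists P : probability T R, forall A, P A = mu A.
Proof. by exists P. Qed.

End ProbabilityOfMeasure.

Section LevelSets.
Variables (R : realType) (T : topologicalType).
Implicit Types f : T -> R.

Lemma open_sublevel f c : continuous f -> open [set x | f x < c].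
Proof.
move=> cf; apply: (@open_comp _ _ f [set r | r < c]); last exact: open_lt.
by move=> x _; exact: cf.
Qed.

Lemma open_superlevel f c : continuous f -> open [set x | c < f x].
Proof.
move=> cf; apply: (@open_comp _ _ f [set r | c < r]); last exact: open_gt.
by move=> x _; exact: cf.
Qed.

Lemma near_sublevel f c x : continuous f -> f x < c -> \forall y \near x, f y < c.
Proof. by move=> cf fx; apply: open_nbhs_nbhs; split=> //; exact: open_sublevel. Qed.

Lemma near_superlevel f c x : continuous f -> c < f x -> \forall y \near x, c < f y.
Proof. by move=> cf fx; apply: open_nbhs_nbhs; split=> //; exact: open_superlevel. Qed.

End LevelSets.

(** * Caratheodory construction of a Haar measure from the mean *)

Section HaarMeasure.
Variables (R : realType) (G : topGroupType).
Hypothesis cG : compact [set: G].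
(* All that is used of metrizability. *)
Hypothesis zeroG : forall C : set G, closed C ->
  exists delta : G -> R, [/\ continuous delta, forall x, 0 <= delta x &
    forall x, delta x = 0 <-> C x].

Definition subordinate (U : set G) (f : G -> R) : Prop :=
  [/\ continuous f, forall x, 0 <= f x, forall x, f x <= 1 &
      forall x, ~ U x -> f x = 0].

Definition haar_open (U : set G) : R :=
  sup [set r | exists2 f, subordinate U f & r = haar_mean f].

Lemma subordinate0 U : subordinate U (fun=> 0).
Proof. by split=> //; exact: continuous_const. Qed.

Lemma haar_open_has_sup U :
  has_sup [set r | exists2 f, subordinate U f & r = haar_mean f].
Proof.
split; first by exists (haar_mean (fun _ : G => 0 : R)), (fun=> 0); [exact: subordinate0|].
by exists 1 => _ [f [cf f0 f1 _] ->]; exact: (haar_mean_le cG).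
Qed.

Lemma haar_open_ub U f : subordinate U f -> haar_mean f <= haar_open U.
Proof. by move=> fU; apply: (ub_le_sup (haar_open_has_sup U).2); exists f. Qed.

Lemma haar_open_ge0 U : 0 <= haar_open U.
Proof.
by have := haar_open_ub (subordinate0 U); rewrite (haar_mean_cst cG).
Qed.

Lemma haar_open_adherent U (e : R) : 0 < e ->
  exists2 f, subordinate U f & haar_open U < haar_mean f + e.
Proof.
move=> e0; have [_ [f fU ->] lt] := sup_adherent e0 (haar_open_has_sup U).
by exists f => //; rewrite -ltrBlDr.
Qed.

Lemma haar_open_le U c : (forall f, subordinate U f -> haar_mean f <= c) ->
  haar_open U <= c.
Proof. by move=> H; apply: ge_sup (haar_open_has_sup U).1 _ => _ [f fU ->]; exact: H. Qed.

Lemma le_haar_open U V : U `<=` V -> haar_open U <= haar_open V.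
Proof.
move=> UV; apply: haar_open_le => f [cf f0 f1 fU]; apply: haar_open_ub.
by split=> // x Vx; apply: fU => /UV.
Qed.

Lemma haar_open_set0 : haar_open set0 = 0.
Proof.
apply/eqP; rewrite eq_le haar_open_ge0 andbT; apply: haar_open_le => f [_ _ _ f0].
by rewrite (_ : f = fun=> 0) ?(haar_mean_cst cG)//; apply/funext => x; exact: f0.
Qed.

Lemma haar_open_setT : haar_open setT = 1.
Proof.
apply/eqP; rewrite eq_le; apply/andP; split.
  by apply: haar_open_le => f [cf _ f1 _]; exact: (haar_mean_le cG).
rewrite -[leLHS](haar_mean_cst cG); apply: haar_open_ub.
by split=> // [|x /(_ I)//]; exact: continuous_const.
Qed.

Definition haar_inf (A : set G) : R :=
  inf [set haar_open U | U in [set U | open U /\ A `<=` U]].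

Lemma haar_inf_has_inf A : has_inf [set haar_open U | U in [set U | open U /\ A `<=` U]].
Proof.
split; first by exists (haar_open setT), setT => //; split=> //; exact: openT.
by exists 0 => _ [U _ <-]; exact: haar_open_ge0.
Qed.

Lemma haar_inf_lb A U : open U -> A `<=` U -> haar_inf A <= haar_open U.
Proof. by move=> oU AU; apply: (ge_inf (haar_inf_has_inf A).2); exists U. Qed.

Lemma haar_inf_adherent A (e : R) : 0 < e ->
  exists U, [/\ open U, A `<=` U & haar_open U < haar_inf A + e].
Proof.
by move=> e0; have [_ [U [oU AU] <-] lt] := inf_adherent e0 (haar_inf_has_inf A); exists U.
Qed.

Lemma haar_inf_ge A c : (forall U, open U -> A `<=` U -> c <= haar_open U) ->
  c <= haar_inf A.
Proof.
by move=> H; apply: (lb_le_inf (haar_inf_has_inf A).1) => _ [U [oU AU] <-]; exact: H.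
Qed.

Lemma haar_inf_ge0 A : 0 <= haar_inf A.
Proof. by apply: haar_inf_ge => U _ _; exact: haar_open_ge0. Qed.

Lemma le_haar_inf A B : A `<=` B -> haar_inf A <= haar_inf B.
Proof.
by move=> AB; apply: haar_inf_ge => U oU BU; apply: haar_inf_lb => //; exact: subset_trans BU.
Qed.

Lemma haar_inf_open U : open U -> haar_inf U = haar_open U.
Proof.
move=> oU; apply/eqP; rewrite eq_le haar_inf_lb//=.
by apply: haar_inf_ge => V _; exact: le_haar_open.
Qed.

Lemma continuous_min1 (T : topologicalType) (f : T -> R) : continuous f ->
  continuous (fun x => Num.min 1 (f x)).
Proof.
by move=> cf x; apply: continuous_min; [exact: cvg_cst|exact: cf].
Qed.

Lemma continuous_max0 (T : topologicalType) (f : T -> R) : continuous f ->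
  continuous (fun x => Num.max 0 (f x)).
Proof.
by move=> cf x; apply: continuous_max; [exact: cvg_cst|exact: cf].
Qed.

(* By compactness f is at most e plus finitely many of the functions
   min (1, k delta_i), which increase to the indicator of U_i. *)
Lemma haar_open_subadditive (U : nat -> set G) f (e : R) :
  (forall i, open (U i)) -> subordinate (\bigcup_i U i) f -> 0 < e ->
  exists n, haar_mean f <= e + \sum_(0 <= i < n) haar_open (U i).
Proof.
move=> oU [cf f0 f1 fU] e0.
have /choice[delta dP] i : exists delta : G -> R, [/\ continuous delta,
    forall x, 0 <= delta x & forall x, delta x = 0 <-> (~` U i) x].
  by apply: zeroG; exact: open_closedC.
pose h (k i : nat) x := Num.min 1 (k%:R * delta i x).
have hU k i : subordinate (U i) (h k i).
  have [dc d0 dU] := dP i; split.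
  - by apply: continuous_min1; exact: continuous_scale.
  - by move=> x; rewrite le_min ler01 mulr_ge0.
  - by move=> x; rewrite ge_min lexx.
  - by move=> x /dU Ux; rewrite /h Ux mulr0 min_r.
have [k kP] : exists k : nat, forall x, f x <= e + \sum_(0 <= i < k) h k i x.
  have [] := @compact_near_coveringP G setT => /(_ cG) + _.
  move=> /(_ nat \oo (fun k x => f x <= e + \sum_(0 <= i < k) h k i x)) H.
  suff : \forall k \near \oo, forall x, f x <= e + \sum_(0 <= i < k) h k i x.
    by move=> [k _ kP]; exists k; exact: (kP k (leqnn k)).
  have sum0 k y : 0 <= \sum_(0 <= i < k) h k i y.
    by apply: sumr_ge0 => i _; have [_ + _ _] := hU k i; exact.
  suff H2 : forall x : G, \forall x' \near x & k \near \oo,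
      f x' <= e + \sum_(0 <= i < k) h k i x'.
    by apply: filterS (H _ (fun x _ => H2 x)) => k kP x; exact: kP.
  move=> x; have [fx|fx] := ltP (f x) e.
    exists ([set y | f y < e], setT) => /=; last first.
      by move=> [y k] /= [fy _]; rewrite (le_trans (ltW fy))// lerDl.
    split; last exact: filterT.
    exact: near_sublevel.
  have [i _ Uix] : (\bigcup_i U i) x.
    by apply: contrapT => /fU fx0; move: fx; rewrite fx0 leNgt e0.
  have [dc d0 dU] := dP i.
  have dx : 0 < delta i x by rewrite lt_neqAle d0 andbT eq_sym; apply/eqP => /dU.
  (* Near x, delta_i exceeds half its value at x, so the second condition on k gives k delta_i >= 1
     there; the first makes i occur in the sum. *)
  exists ([set y | delta i x / 2 < delta i y],
          [set k | (i < k)%N /\ 2 / delta i x < k%:R]) => /=; last first.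
    move=> [y k] /= [dy [ik kd]]; apply: (le_trans (f1 y)).
    have -> : 1 = h k i y.
      rewrite /h min_l//; rewrite ltr_pdivrMr// in kd.
      by move: dy; rewrite ltr_pdivrMr// => dy; nra.
    rewrite (bigD1_seq i)/= ?iota_uniq ?mem_index_iota//.
    have : 0 <= \sum_(0 <= j < k | j != i) h k j y.
      by apply: sumr_ge0 => j _; have [_ + _ _] := hU k j; exact.
    by lra.
  split; first by apply: near_superlevel => //; lra.
  near=> k; split; near: k; first exact: nbhs_infty_gt.
  exact: nbhs_infty_gtr.
exists k; have ch i : continuous (h k i) by have [] := hU k i.
apply: (@le_trans _ _ (haar_mean (fun x => e + \sum_(0 <= i < k) h k i x))).
  apply: (le_haar_mean cG) => //; apply: continuous_add; first exact: continuous_const.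
  exact: continuous_sum.
rewrite (haar_meanD cG)//; last 2 first.
- exact: continuous_const.
- exact: continuous_sum.
rewrite (haar_mean_cst cG)// (haar_mean_sum cG)// lerD2l.
by apply: ler_sum => i _; exact: haar_open_ub.
Unshelve. all: by end_near. Qed.

Definition haar_outer (A : set (pointed_group G)) : \bar R := (haar_inf A)%:E.

Lemma haar_outer0 : haar_outer set0 = 0%E.
Proof. by rewrite /haar_outer haar_inf_open ?haar_open_set0//; exact: open0. Qed.

Lemma haar_outer_ge0 A : (0 <= haar_outer A)%E.
Proof. by rewrite lee_fin haar_inf_ge0. Qed.

Lemma le_haar_outer : {homo haar_outer : A B / A `<=` B >-> (A <= B)%E}.
Proof. by move=> A B AB; rewrite lee_fin; exact: le_haar_inf. Qed.

Lemma haar_outer_subadditive : sigma_subadditive haar_outer.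
Proof.
move=> F; apply/lee_addgt0Pr => e e0.
have e20 : 0 < e / 2 by rewrite divr_gt0.
have /choice[U UP] i : exists U : set G, [/\ open U, F i `<=` U &
    haar_open U < haar_inf (F i) + (e / 2) / (2 ^ i.+1)%:R].
  by apply: haar_inf_adherent; rewrite divr_gt0// ltr0n expn_gt0.
have oU : open (\bigcup_i U i) by apply: bigcup_open => i _; have [] := UP i.
apply: (@le_trans _ _ (haar_open (\bigcup_i U i))%:E).
  rewrite lee_fin; apply: haar_inf_lb => // x [i _ Fx]; exists i => //.
  by have [_ + _] := UP i; exact.
apply: (@le_trans _ _ (\sum_(i <oo) (haar_open (U i))%:E + (e / 2)%:E)%E); last first.
  rewrite {2}(splitr e) EFinD addeA leeD2r//.
  apply: le_trans (epsilon_trick xpredT (fun n => haar_outer_ge0 (F n)) (ltW e20)).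
  apply: lee_nneseries => // i _; first by rewrite lee_fin haar_open_ge0.
  by rewrite -EFinD lee_fin ltW//; have [] := UP i.
(* The remaining e / 2 is shared equally between the choice of a nearly optimal f and the finite
   truncation of the union. *)
have [f fU If] := haar_open_adherent (\bigcup_i U i) (divr_gt0 e20 (@ltr0Sn R 1)).
have [|n nP] := haar_open_subadditive _ fU (divr_gt0 e20 (@ltr0Sn R 1)).
  by move=> i; have [] := UP i.
apply: (@le_trans _ _ ((\sum_(0 <= i < n) haar_open (U i))%:E + (e / 2)%:E)%E).
  by rewrite -EFinD lee_fin; lra.
rewrite leeD2r// -sumEFin.
by apply: nneseries_lim_ge => i _ _; rewrite lee_fin haar_open_ge0.
Qed.

(** [W] contains the part of X outside U because f vanishes off U. The cut function max 0 (f - e /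
    4) vanishes on [W], where g lives, so the sum of the two is subordinate to V. The four quarters
    of e pay for V, f, g and the cut. *)
Lemma haar_inf_caratheodory U X : open U ->
  haar_inf (X `&` U) + haar_inf (X `&` ~` U) <= haar_inf X.
Proof.
move=> oU; apply/ler_addgt0Pr => e e0.
have e40 : 0 < e / 4 by rewrite divr_gt0.
have [V [oV XV Vlt]] := haar_inf_adherent X e40.
have [f fVU flt] := haar_open_adherent (V `&` U) e40.
have [cf f0 f1 fv] := fVU.
pose W := V `&` [set x | f x < e / 4].
have oW : open W.
  by apply: openI => //; exact: open_sublevel.
have [g gW glt] := haar_open_adherent W e40.
have [cg g0 g1 gv] := gW.
have H1 : haar_inf (X `&` U) <= haar_open (V `&` U).
  by apply: haar_inf_lb; [exact: openI|exact: setSI].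
have H2 : haar_inf (X `&` ~` U) <= haar_open W.
  apply: haar_inf_lb => // x [Xx Ux]; split; first exact: XV.
  by rewrite /= fv// => -[].
have cm : continuous (fun x => Num.max 0 (f x - e / 4)).
  by apply: continuous_max0; apply: continuous_sub => //; exact: continuous_const.
have H3 : haar_mean (fun x => Num.max 0 (f x - e / 4) + g x) <= haar_open V.
  apply: haar_open_ub; split.
  - exact: continuous_add.
  - by move=> x; rewrite addr_ge0// le_max lexx.
  - move=> x; have [fx|fx] := ltP (f x) (e / 4).
      by rewrite max_l ?add0r//; lra.
    rewrite gv; last by move=> -[_ /=]; rewrite ltNge fx.
    by rewrite addr0 ge_max ler01/=; have := f1 x; lra.
  - move=> x Vx; rewrite gv; last by move=> [].
    by rewrite fv; [rewrite max_l ?addr0//; lra|move=> []].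
have H4 : haar_mean f - e / 4 <= haar_mean (fun x => Num.max 0 (f x - e / 4)).
  rewrite -[X in _ - X](haar_mean_cst cG) -(haar_meanB cG)//; last exact: continuous_const.
  apply: (le_haar_mean cG) => //; first by apply: continuous_sub => //; exact: continuous_const.
  by move=> x; rewrite le_max lexx orbT.
by rewrite (haar_meanD cG)// in H3; lra.
Qed.

Lemma haar_infMl A (g : G) : haar_inf [set (g * x)%g | x in A] = haar_inf A.
Proof.
have le h B : haar_inf [set (h * x)%g | x in B] <= haar_inf B.
  apply: haar_inf_ge => V oV BV.
  apply: (@le_trans _ _ (haar_open [set x | V (h^-1 * x)%g])).
    apply: haar_inf_lb.
      by apply: (@open_comp _ _ (fun x => (h^-1 * x)%g) V) => // x _; exact: continuous_lmul.
    by move=> _ [x Bx <-]/=; rewrite mulKg; exact: BV.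
  apply: haar_open_le => f [cf f0 f1 fV]; rewrite -(haar_meanMl cG h cf).
  apply: haar_open_ub; split=> //.
    exact: continuous_compose (@continuous_lmul G h) cf.
  by move=> x Vx; rewrite fV//= mulKg.
apply/eqP; rewrite eq_le le/=; apply: le_trans (le g^-1%g _).
by apply: le_haar_inf => x Ax; exists (g * x)%g; [exists x|rewrite mulKg].
Qed.

Lemma haar_measure_ex : exists mu : probability (borel G) R,
  normalized_haar mu /\ forall A, mu A = (haar_inf A)%:E.
Proof.
pose mu0 : {outer_measure set (pointed_group G) -> \bar R} :=
  HB.pack haar_outer (isOuterMeasure.Build R (pointed_group G) haar_outer
    haar_outer0 haar_outer_ge0 le_haar_outer haar_outer_subadditive).
have mcara (A : set (borel G)) : measurable A -> mu0.-caratheodory A.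
  move=> mA.
  suff : (@open G : set (set (pointed_group G))).-sigma.-measurable `<=`
      (mu0.-cara.-measurable : set (set (caratheodory_type mu0))) by apply.
  apply: smallest_sub; first exact: sigma_algebra_measurable.
  move=> U oU; apply: le_caratheodory_measurable => X.
  by rewrite -EFinD lee_fin; exact: haar_inf_caratheodory.
have sadd : semi_sigma_additive (haar_outer : set (borel G) -> \bar R).
  move=> F mF tF mUF.
  apply: (@caratheodory_measure_sigma_additive R (pointed_group G) mu0) => //.
  - by move=> i; exact: mcara.
  - exact: mcara.
pose mu1 : {measure set (borel G) -> \bar R} :=
  HB.pack (haar_outer : set (borel G) -> \bar R) (isMeasure.Build _ (borel G) R
    (haar_outer : set (borel G) -> \bar R) haar_outer0 haar_outer_ge0 sadd).
have mu1T : mu1 setT = 1%E.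
  by rewrite /mu1/= /haar_outer haar_inf_open ?haar_open_setT//; exact: openT.
have [mu muE] := measure_probability mu1T.
exists mu; split=> [g A mA|A]; last exact: muE.
rewrite !muE; congr EFin; exact: haar_infMl.
Qed.

End HaarMeasure.

Section Metrizable.
Variables (R : realType).

Lemma metrizable_zero_set (T : topologicalType) (C : set T) :
  metrizable R T -> closed C -> exists delta : T -> R,
    [/\ continuous delta, forall x, 0 <= delta x & forall x, delta x = 0 <-> C x].
Proof.
move=> [d [dxx d0 dC dT nbhsE]] clC.
have dge0 x y : 0 <= d x y by have := dT y x x; rewrite dxx (dC y x); lra.
(* The extra value 1 keeps the set of distances non-empty when C is empty. *)
pose D x : set R := [set r | r = 1 \/ exists2 y, C y & r = d x y].
have D_inf x : has_inf (D x).
  split; first by exists 1; left.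
  by exists 0 => _ [->|[y _ ->]].
pose delta x := inf (D x).
have delta0 x : 0 <= delta x.
  by apply: (lb_le_inf (D_inf x).1) => _ [->|[y _ ->]].
have deltaL x y : delta x <= delta y + d x y.
  rewrite -lerBlDr; apply: (lb_le_inf (D_inf y).1) => r Dr; rewrite lerBlDr.
  case: Dr => [->|[z Cz ->]].
    by apply: (@le_trans _ _ 1); [apply: (ge_inf (D_inf x).2); left|rewrite lerDl].
  apply: (@le_trans _ _ (d x z)); first by apply: (ge_inf (D_inf x).2); right; exists z.
  by rewrite addrC; exact: dT.
exists delta; split=> //.
- move=> x; apply/cvgrPdist_lt => e e0.
  apply/nbhsE; exists e => // y /= dxy; rewrite ltr_norml.
  have := deltaL x y; have := deltaL y x; rewrite (dC y x) => ? ?.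
  by apply/andP; split; lra.
- move=> x; split=> [dx0|Cx].
    apply: contrapT => nCx.
    have /nbhsE[e e0 eC] : nbhs x (~` C) by apply: open_nbhs_nbhs; split=> //; exact: closed_openC.
    have : Num.min 1 e <= delta x.
      apply: (lb_le_inf (D_inf x).1) => _ [->|[y Cy ->]]; first by rewrite ge_min lexx.
      rewrite ge_min; apply/orP; right; rewrite leNgt; apply/negP => dxy.
      by have := eC y dxy; apply.
    by rewrite dx0 leNgt lt_min ltr01 e0.
  apply/eqP; rewrite eq_le delta0 andbT -(dxx x).
  by apply: (ge_inf (D_inf x).2); right; exists x.
Qed.

Lemma metrizable_subgroup (G : topGroupType) (L : subgroup G) :
  metrizable R G -> metrizable R (subgroup_type L).
Proof.
move=> [d [dxx d0 dC dT nbhsE]].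
exists (fun x y => d (subgroup_val x) (subgroup_val y)); split.
- by move=> x; exact: dxx.
- by move=> x y /d0; exact: subgroup_val_inj.
- by move=> x y; exact: dC.
- by move=> y x z; exact: dT.
- move=> x A; split.
    move=> [_ [[U oU <-] /= Ux UA]].
    have /nbhsE[e e0 eU] : nbhs (subgroup_val x) U by exact: open_nbhs_nbhs.
    by exists e => // y /= dxy; apply: UA; exact: eU.
  move=> [e e0 eA].
  have /(@subgroup_val_continuous G L) : nbhs (subgroup_val x) [set y | d (subgroup_val x) y < e].
    by apply/nbhsE; exists e.
  by move=> H; apply: (@filterS _ _ (nbhs_filter x) _ _ _ H) => y; exact: eA.
Qed.

End Metrizable.

Lemma compact_subgroup (G : topGroupType) (L : subgroup G) :
  compact [set: G] -> closed (subgroup_set L) -> compact [set: subgroup_type L].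
Proof.
move=> cG clL F FF _.
have cL : compact (subgroup_set L) by exact: subclosed_compact cG _.
have FL : (@subgroup_val G L @ F) (subgroup_set L).
  by apply: (@filterS _ F _ setT _ _ filterT) => x _; exact: subgroup_valP.
have [y [Ly clFy]] := cL (@subgroup_val G L @ F) _ FL.
exists (subgroup_elt Ly); split=> // A B FA [_ [[U oU <-] /= Uy UB]].
have [] := clFy (@subgroup_val G L @` A) U.
- by apply: (@filterS _ F _ A _ _ FA) => x Ax; exists x.
- exact: open_nbhs_nbhs.
by move=> _ [[x Ax <-] Ux]; exists x; split=> //; exact: UB.
Qed.

(** * Uniqueness and outer regularity of Haar measure *)

Section HaarUnique.
Variables (R : realType) (G : topGroupType).
Hypothesis cG : compact [set: G].
Hypothesis metrizableG : metrizable R G.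

Lemma open_borel (U : set G) : open U -> measurable (U : set (borel G)).
Proof. by move=> oU; exact: sub_sigma_algebra. Qed.

Lemma continuous_borel (f : G -> G) : continuous f ->
  measurable_fun setT (f : borel G -> borel G).
Proof.
move=> cf; apply: (@measurability _ _ (borel G) (borel G) setT f
  (@open G : set (set (pointed_group G)))) => //.
move=> _ [U oU <-]; rewrite setTI; apply: open_borel.
by apply: (@open_comp _ _ f U) => // x _; exact: cf.
Qed.

Lemma continuous_borelR (f : G -> R) : continuous f ->
  measurable_fun setT (f : borel G -> R).
Proof.
move=> cf; apply: (measurability _ (RGenOpens.measurableE R)).
move=> _ [_ [a [b ->] <-]]; rewrite setTI; apply: open_borel.
apply: (@open_comp _ _ f `]a, b[%classic); last exact: interval_open.
by move=> x _; exact: cf.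
Qed.

Lemma continuous_borelE (f : G -> R) : continuous f ->
  @measurable_fun _ _ (borel G) _ setT (fun x => (f x)%:E).
Proof. by move=> cf; apply/measurable_EFinP; exact: continuous_borelR. Qed.

Lemma image_lmul (g : G) (A : set G) :
  [set (g * x)%g | x in A] = [set x | A (g^-1 * x)%g].
Proof.
apply/seteqP; split=> [_ [x Ax <-]|x Ax]; first by rewrite /= mulKg.
by exists (g^-1 * x)%g => //; rewrite mulVKg.
Qed.

Lemma borel_lmul (g : G) (A : set G) : measurable (A : set (borel G)) ->
  measurable ([set (g * x)%g | x in A] : set (borel G)).
Proof.
move=> mA; rewrite image_lmul -[X in measurable X]setTI.
exact: (continuous_borel (@continuous_lmul G g^-1%g)).
Qed.

Section Integral.
Variable nu : probability (borel G) R.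
Hypothesis haar_nu : normalized_haar nu.

Lemma haar_integral_lmul (f : G -> R) (g : G) : continuous f -> (forall x, 0 <= f x) ->
  (\int[nu]_(x in setT) (f (g * x)%g)%:E = \int[nu]_(x in setT) (f x)%:E)%E.
Proof.
move=> cf f0.
have mg := continuous_borel (@continuous_lmul G g).
have mf := continuous_borelE cf.
have := @ge0_integral_pushforward _ _ (borel G) (borel G) R _ mg nu setT
  (fun x => (f x)%:E) measurableT mf (fun x _ => f0 x).
rewrite preimage_setT => <-.
apply: eq_measure_integral => A mA _; rewrite /pushforward.
have := haar_nu g^-1%g mA; rewrite image_lmul invgK => <-.
by congr (nu _).
Qed.

(** The integral against nu does not distinguish f from averages of its left translates, and these
    approach the constant [haar_mean f] uniformly. *)
Lemma haar_integral (f : G -> R) : continuous f -> (forall x, 0 <= f x) ->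
  (\int[nu]_(x in setT) (f x)%:E = (haar_mean f)%:E)%E.
Proof.
move=> cf f0.
have cl g : continuous (fun x => f (g * x)%g).
  exact: continuous_compose (@continuous_lmul G g) cf.
have mE := continuous_borelE.
have Iavg s : size s != 0%N ->
    (\int[nu]_(x in setT) (avg s (fun g => f (g * x)%g))%:E =
     \int[nu]_(x in setT) (f x)%:E)%E.
  move=> s0; under eq_integral do rewrite /avg mulrC EFinM -sumEFin.
  rewrite ge0_integralZl_EFin ?invr_ge0//; last 2 first.
  - by move=> x _; apply: sume_ge0 => g _; rewrite lee_fin.
  - by apply: emeasurable_sum => g; exact: mE.
  rewrite ge0_integral_sum//; last 2 first.
  - by move=> g; exact: mE.
  - by move=> g x _; rewrite lee_fin.
  rewrite (eq_bigr (fun=> \int[nu]_(x in setT) (f x)%:E)%E); last first.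
    by move=> g _; exact: haar_integral_lmul.
  rewrite big_const_seq count_predT.
  set J := (\int[nu]_x _)%E.
  have -> : iter (size s) (adde J) 0%E = ((size s)%:R%:E * J)%E.
    elim: (size s) => [|n IHn]; first by rewrite mul0e.
    by rewrite iterS IHn -natr1 EFinD ge0_muleDl ?lee_fin// mul1e addeC.
  by rewrite muleA -EFinM mulVf ?mul1e// pnatr_eq0.
have Icst (c : R) : (\int[nu]_(x in setT) c%:E = c%:E)%E.
  by rewrite integral_cst// (probability_setT nu) mule1.
have m0 := haar_mean_ge0 cG cf f0.
apply/eqP; rewrite eq_le; apply/andP; split; apply/lee_addgt0Pr => e e0;
  have [s s0 sP] := haar_left_mean cG cf e0.
- rewrite -(Iavg s s0) -EFinD -(Icst (haar_mean f + e)).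
  apply: ge0_le_integral => //.
  + by move=> x _; rewrite lee_fin avg_ge.
  + by apply: mE; exact: continuous_avg.
  + by move=> x _; rewrite lee_fin; have := sP x; rewrite ler_distl => /andP[].
- rewrite -(Iavg s s0) -[in leRHS](Icst e) -ge0_integralD//; last 3 first.
  + by move=> x _; rewrite lee_fin avg_ge.
  + by apply: mE; exact: continuous_avg.
  + by move=> x _; rewrite lee_fin ltW.
  rewrite -(Icst (haar_mean f)); apply: ge0_le_integral => //.
  + by apply: emeasurable_funD => //; apply: mE; exact: continuous_avg.
  + by move=> x _; rewrite -EFinD lee_fin; have := sP x; rewrite ler_distl lerBlDr => /andP[].
Qed.

(** Upper bound: U is the increasing union of the sets where n delta > 1, whose indicators lie below
    min 1 (n delta), a function subordinate to U. Lower bound: a subordinate function lies below the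
    indicator of U. *)
Lemma haar_open_measure (U : set G) : open U -> nu U = (haar_open R U)%:E.
Proof.
move=> oU; have mU := open_borel oU.
have [delta [cd d0 dU]] := metrizable_zero_set metrizableG (open_closedC oU).
apply/eqP; rewrite eq_le; apply/andP; split.
- pose F n : set (borel G) := [set x | 1 < n%:R * delta x].
  have mF n : measurable (F n).
    by apply: open_borel; apply: open_superlevel; exact: continuous_scale.
  have UF : \bigcup_n F n = U.
    apply/seteqP; split=> [x [n _]|x Ux].
      rewrite /F/= => dx; apply: contrapT => /dU dx0.
      by move: dx; rewrite dx0 mulr0 ltr10.
    have dx : 0 < delta x by rewrite lt_neqAle d0 andbT eq_sym; apply/eqP => /dU.
    exists (Num.truncn (delta x)^-1).+1 => //; rewrite /F/= -ltr_pdivrMr//.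
    by rewrite div1r truncnS_gt.
  have ndF : nondecreasing_seq F.
    move=> m n mn; apply/subsetPset => x; rewrite /F/= => /lt_le_trans; apply.
    by rewrite ler_wpM2r// ler_nat.
  have := @nondecreasing_cvg_mu _ _ _ nu _ mF _ ndF; rewrite UF => /(_ mU) cvgF.
  apply: (cvge_to_le cvgF); apply: nearW => n /=.
  pose h x := Num.min 1 (n%:R * delta x).
  have ch : continuous h by apply: continuous_min1; exact: continuous_scale.
  have h0 x : 0 <= h x by rewrite le_min ler01 mulr_ge0.
  apply: (@le_trans _ _ (haar_mean h)%:E); last first.
    rewrite lee_fin; apply: (haar_open_ub cG); split=> //.
    + by move=> x; rewrite ge_min lexx.
    + by move=> x /dU dx; rewrite /h dx mulr0 min_r.
  rewrite -haar_integral// -[X in (nu X <= _)%E]setIT -integral_indic//.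
  apply: ge0_le_integral => //.
  + by apply/measurable_EFinP; exact: measurable_indic.
  + exact: continuous_borelE.
  + move=> x _; rewrite lee_fin indicE; have [|_] := boolP (x \in F n); last exact: h0.
    by rewrite inE /F/= => /ltW lt1; rewrite /h min_l.
- have H f : subordinate U f -> ((haar_mean f)%:E <= nu U)%E.
    move=> [cf f0 f1 fU]; rewrite -haar_integral//.
    rewrite -[X in (_ <= nu X)%E]setIT -integral_indic//.
    apply: ge0_le_integral => //.
    + by move=> x _; rewrite lee_fin.
    + exact: continuous_borelE.
    + by apply/measurable_EFinP; exact: measurable_indic.
    + move=> x _; rewrite lee_fin indicE; have [//|] := boolP (x \in U).
      by move=> /negP; rewrite inE => /fU ->.
  have fin : nu U \is a fin_num by exact: fin_num_measure.
  rewrite -(fineK fin) lee_fin; apply: (haar_open_le cG) => f /H.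
  by rewrite -lee_fin fineK.
Qed.

End Integral.

Theorem haar_measure_unique (mu nu : probability (borel G) R) :
  normalized_haar mu -> normalized_haar nu ->
  forall A : set (borel G), measurable A -> mu A = nu A.
Proof.
move=> hmu hnu A mA.
apply: (@g_sigma_algebra_measure_unique _ R (borel G)
  (@open G : set (set (pointed_group G))) _ (fun=> setT)) => //.
- by move=> U; exact: open_borel.
- by move=> _; exact: openT.
- by rewrite bigcup_const.
- exact: openI.
- by move=> U oU; rewrite (haar_open_measure hmu oU) (haar_open_measure hnu oU).
- by move=> _; rewrite (probability_setT mu) ltry.
Qed.

(** Uniqueness identifies [mu] with the measure built from [haar_inf], which is outer regular by
    construction. *)
Lemma haar_outer_regular (mu : probability (borel G) R) (A : set (borel G)) (e : R) :
  normalized_haar mu -> measurable A -> 0 < e ->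
  exists U : set G, [/\ open U, A `<=` U & (mu U < mu A + e%:E)%E].
Proof.
move=> hmu mA e0.
have [nu [hnu nuE]] := haar_measure_ex cG (fun C => @metrizable_zero_set R G C metrizableG).
have [U [oU AU lt]] := haar_inf_adherent cG A e0.
exists U; split=> //.
rewrite (haar_measure_unique hmu hnu mA) (haar_measure_unique hmu hnu (open_borel oU)).
by rewrite !nuE -EFinD lte_fin haar_inf_open.
Qed.

End HaarUnique.

Lemma continuous_dist (R : realType) (T : topologicalType) (d : T -> T -> R) (z : T) :
  (forall x y, d x y = d y x) -> (forall y x z, d x z <= d x y + d y z) ->
  (forall x (A : set T), nbhs x A <-> exists2 e : R, 0 < e & [set y | d x y < e] `<=` A) ->
  continuous (fun x => d x z).
Proof.
move=> dC dT nbhsE x; apply/cvgrPdist_lt => e e0.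
apply/nbhsE; exists e => // y /= dxy; rewrite ltr_norml.
have := dT y x z; have := dT x y z; rewrite (dC y x) => ? ?.
by apply/andP; split; lra.
Qed.

Lemma haar_measure_open_gt0 (R : realType) (G : topGroupType)
  (mu : probability (borel G) R) (U : set G) (x : G) :
  compact [set: G] -> metrizable R G -> normalized_haar mu -> open U -> U x ->
  (0 < mu U)%E.
Proof.
move=> cG mG hmu oU Ux; rewrite (haar_open_measure cG mG hmu oU) lte_fin.
have [delta [cd d0 dU]] := metrizable_zero_set mG (open_closedC oU).
pose h y := Num.min 1 (delta y).
have ch : continuous h by exact: continuous_min1.
have h0 y : 0 <= h y by rewrite le_min ler01 d0.
apply: (@lt_le_trans _ _ (haar_mean h)).
  apply: (haar_mean_gt0 cG ch h0 (x0 := x)); rewrite lt_min ltr01/= lt_neqAle d0 andbT eq_sym.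
  by apply/eqP => /dU.
apply: (haar_open_ub cG); split=> // y.
  by rewrite ge_min lexx.
by move=> /dU dy; rewrite /h dy min_r.
Qed.

(** * Distality excludes ergodicity *)

Section RestrAction.
Variables (K : topGroupType) (Gamma : subgroup (topAut K)) (L : subgroup K).

Lemma restr_actionM b b' : restr_action Gamma L b -> restr_action Gamma L b' ->
  restr_action Gamma L (b * b')%g.
Proof.
move=> [a Ga ba] [a' Ga' ba']; exists (a * a')%g; first exact: subgroupM.
by move=> x; rewrite /= -ba' -ba.
Qed.

Lemma restr_actionV b : restr_action Gamma L b -> restr_action Gamma L (b^-1)%g.
Proof.
move=> [a Ga ba]; exists (a^-1)%g; first exact: subgroupV.
move=> x; apply: (can_inj (aut_funK a)).
rewrite -ba (aut_invK b x).
by have /= -> := aut_invK a (subgroup_val x).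
Qed.

Lemma restr_action1 : restr_action Gamma L 1%g.
Proof. by exists 1%g; first exact: subgroup1. Qed.

End RestrAction.

Lemma distal_not_ergodic (R : realType) (K : topGroupType)
  (Gamma : subgroup (topAut K)) (L : subgroup K) :
  compact [set: K] -> metrizable R K -> distal Gamma ->
  closed (subgroup_set L) -> subgroup_set L <> [set 1%g] ->
  ~ ergodic R (restr_action Gamma L).
Proof.
move=> cK mK distalK clL L1 ergL.
pose G : topGroupType := subgroup_type L.
have cG : compact [set: G] := compact_subgroup cK clL.
have mG : metrizable R G := metrizable_subgroup L mK.
have [mu [hmu _]] := haar_measure_ex cG (fun C => @metrizable_zero_set R G C mG).
have [d [dxx d0 dC dT nbhsE]] := mG.
have cd : continuous (fun x : G => d x 1%g) by exact: continuous_dist nbhsE.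
pose B n := [set y : G | d y 1%g < n.+1%:R^-1].
pose E n := [set x : G | exists2 b, restr_action Gamma L b & B n (b x)].
have oE n : open (E n).
  rewrite (_ : E n = \bigcup_(b in restr_action Gamma L) [set x | B n (b x)]) //.
  apply: bigcup_open => b _.
  apply: (@open_comp _ _ b (B n)); last exact: open_sublevel.
  by move=> x _; exact: aut_fun_continuous.
have invE n : invariant_set (restr_action Gamma L) (E n).
  move=> a Ga; apply/seteqP; split=> [_ [x [b Gb Bx] <-]|x [b Gb Bx]].
    exists (b * a^-1)%g; first exact: restr_actionM (restr_actionV Ga).
    by rewrite /= (aut_funK a).
  exists ((a^-1)%g x); last exact: (aut_invK a).
  exists (b * a)%g; first exact: restr_actionM.
  by rewrite /= (aut_invK a).
have muE n : mu (E n) = 1%E.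
  have [E0|//] := ergL mu hmu (E n) (open_borel (oE n)) (invE n).
  have : (0 < mu (E n))%E.
    apply: (haar_measure_open_gt0 (x := 1%g) cG mG hmu (oE n)).
    by exists 1%g; [exact: restr_action1|rewrite /B/= dxx invr_gt0].
  by rewrite E0 ltxx.
have [x0 x01] : exists x : G, x != 1%g.
  apply: contrapT => /forallNP G1; apply: L1; apply/seteqP; split=> [x Lx|_ ->].
    have /negP := G1 (subgroup_elt Lx); rewrite negbK => /eqP/(congr1 (@subgroup_val K L)).
    by [].
  exact: subgroup1.
have [x x1 Ex] : exists2 x : G, x != 1%g & forall n, E n x.
  apply: contrapT => H.
  (* If only 1 could lie in every [E n], the non-empty open set of the other points would be covered
     by countably many null sets. *)
  pose W := [set x : G | 0 < d x 1%g].
  have oW : open W by exact: open_superlevel.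
  have muW : (0 < mu W)%E.
    apply: (haar_measure_open_gt0 (x := x0) cG mG hmu oW) => /=.
    rewrite /W/= lt_neqAle eq_sym; apply/andP; split.
      by apply: contra x01 => /eqP/d0 ->.
    by have := dT x0 1%g 1%g; rewrite dxx (dC _ x0); lra.
  have : (mu W <= \sum_(n <oo) mu (~` E n))%E.
    apply: measure_sigma_subadditive.
    - by move=> n; apply: measurableC; exact: open_borel.
    - exact: open_borel.
    - move=> x /= dx; apply: contrapT => nE; apply: H; exists x.
        apply/eqP => x1; have : 0 < d (x : G) 1%g := dx.
        by rewrite (x1 : (x : G) = 1%g) dxx ltxx.
      by move=> n; apply: contrapT => En; apply: nE; exists n.
  rewrite eseries0; first by rewrite leNgt muW.
  move=> n _ _; rewrite probability_setC ?muE ?subee//; exact: open_borel.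
apply: (distalK (subgroup_val x)).
  by apply: contra x1 => /eqP x1; apply/eqP/subgroup_val_inj.
move=> A nA.
have /nbhsE[e e0 eA] : nbhs (1%g : G) (@subgroup_val K L @^-1` A).
  exact: (@subgroup_val_continuous K L 1%g).
(* This index n satisfies 1 / (n + 1) < e. *)
have [b [a Ga ba] Bx] := Ex (Num.truncn e^-1).
exists (a (subgroup_val x)); split; first by exists a.
rewrite -ba; apply: (eA (b x)) => /=; rewrite dC; apply: (lt_trans Bx).
by rewrite -[ltRHS]invrK ltf_pV2 ?posrE ?invr_gt0// truncnS_gt.
Qed.

(** * Norm continuity of irreducible representations *)

Section UltraLimit.
Variables (R : realType) (X : topologicalType).
Hypothesis cX : compact [set: X].

Lemma nat_ultrafilter : exists2 Om : set_system nat, UltraFilter Om & \oo `<=` Om.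
Proof. by have [Om [UOm sOm]] := @ultraFilterLemma nat \oo _; exists Om. Qed.

Lemma ultra_real_limit (Om : set_system nat) (u : nat -> R) (C : R) : UltraFilter Om ->
  (forall n, `|u n| <= C) -> exists l, forall e : R, 0 < e -> Om [set n | `|u n - l| < e].
Proof.
move=> UOm uC.
have cC : compact `[- C, C]%classic by exact: segment_compact.
have FF : ProperFilter (u @ Om) by exact: fmap_proper_filter.
have [|l [_ ul]] := cC (u @ Om) FF.
  by apply: (@filterS _ Om _ setT _ _ filterT) => n _; rewrite /= in_itv/= -ler_norml.
exists l => e e0; have [//|nOm] := in_ultra_setVsetC [set n | `|u n - l| < e] UOm.
have [r [nr lr]] := ul [set r | ~ `|r - l| < e] (ball l e) nOm (nbhsx_ballx l e e0).
by exfalso; apply: nr; rewrite distrC.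
Qed.

(* The Arzela-Ascoli theorem along an ultrafilter: no subsequence is extracted. *)
Lemma ultra_uniform_limit (Om : set_system nat) (h : nat -> X -> R) (C : R) :
  UltraFilter Om -> (forall n x, `|h n x| <= C) ->
  (forall x (e : R), 0 < e -> \forall y \near x, forall n, `|h n y - h n x| <= e) ->
  exists w : X -> R, continuous w /\
    forall e : R, 0 < e -> Om [set n | forall x, `|h n x - w x| <= e].
Proof.
move=> UOm hC heq.
have /choice[w wP] x : exists l, forall e : R, 0 < e -> Om [set n | `|h n x - l| < e].
  by apply: ultra_real_limit => n; exact: hC.
have weq x y e : (forall n, `|h n y - h n x| <= e) -> `|w y - w x| <= e.
  move=> hxy; apply/ler_addgt0Pr => d d0; have d20 : 0 < d / 2 by rewrite divr_gt0.
  have [n [/= hx hy]] := filter_ex (filterI (wP x _ d20) (wP y _ d20)).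
  move: hx hy (hxy n); rewrite !ltr_distl !ler_distl => /andP[? ?] /andP[? ?] /andP[? ?].
  by apply/andP; split; lra.
exists w; split=> [x|e e0].
  apply/cvgrPdist_le => e e0; have := heq x e e0.
  by apply: (@filterS _ _ (nbhs_filter x)) => y H; rewrite distrC; exact: weq.
have e30 : 0 < e / 3 by rewrite divr_gt0.
have [s sP] := @compact_nbhs_cover X
  (fun x => [set y | forall n, `|h n y - h n x| <= e / 3]) cX (fun x => heq x _ e30).
have Os : Om [set n | forall x, x \in s -> `|h n x - w x| < e / 3].
  elim: s {sP} => [|x s IH]; first by apply: (@filterS _ Om _ setT _ _ filterT).
  apply: filterS (filterI (wP x _ e30) IH) => n [hx hs] y.
  by rewrite inE => /orP[/eqP ->|/hs].
apply: filterS Os => n nP y; have [x /nP hx xy] := sP y.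
have := weq x y _ xy; have := xy n; move: hx.
rewrite ltr_distl !ler_distl => /andP[? ?] /andP[? ?] /andP[? ?].
by apply/andP; split; lra.
Qed.

End UltraLimit.

(** * Real-valued norm and inner product of a complex Hilbert space *)

Section HilbertReal.
Variables (R : realType) (H : hilbertSpace R).
Implicit Types u v w : H.

(** The norm of H takes its values in R[i], which is only partially ordered; its real part lets all
    estimates take place in R. *)
Definition hnorm u : R := complex.Re `|u|.
Definition hre u v : R := complex.Re (hdot H u v).
Definition sqmod (z : R[i]) : R := complex.Re z ^+ 2 + complex.Im z ^+ 2.

Lemma normE u : `|u| = (hnorm u)%:C%C.
Proof.
by rewrite /hnorm RRe_real// ger0_real.
Qed.

Lemma hnorm_ge0 u : 0 <= hnorm u.
Proof. by rewrite -ler0c -normE. Qed.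

Lemma hnorm_eq0 u : hnorm u = 0 -> u = 0.
Proof. by move=> u0; apply/eqP; rewrite -normr_eq0 normE u0. Qed.

Lemma hnorm0 : hnorm 0 = 0.
Proof. by rewrite /hnorm normr0. Qed.

Lemma hnormD u v : hnorm (u + v) <= hnorm u + hnorm v.
Proof. by rewrite -lecR rmorphD/= -!normE ler_normD. Qed.

Lemma hnormN u : hnorm (- u) = hnorm u.
Proof. by rewrite /hnorm normrN. Qed.

Lemma hnormB u v : hnorm (u - v) = hnorm (v - u).
Proof. by rewrite -hnormN opprB. Qed.

Lemma hre_norm u : hre u u = hnorm u ^+ 2.
Proof. by rewrite /hre hdot_norm normE -rmorphXn. Qed.

Lemma hdotC u w : hdot H u w = conjc (hdot H w u).
Proof. by rewrite hermC/= expr0 mul1r. Qed.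

Lemma hdotBl u v w : hdot H (u - v) w = hdot H u w - hdot H v w.
Proof. exact: linearBl. Qed.

Lemma hdotBr u v w : hdot H w (u - v) = hdot H w u - hdot H w v.
Proof. exact: linearBr. Qed.

Lemma hreC u w : hre u w = hre w u.
Proof. by rewrite /hre hdotC; case: (hdot H w u). Qed.

Lemma hreDl u v w : hre (u + v) w = hre u w + hre v w.
Proof. by rewrite /hre linearDl raddfD. Qed.

Lemma hreDr u v w : hre w (u + v) = hre w u + hre w v.
Proof. by rewrite hreC hreDl !(hreC w). Qed.

Lemma hreNl u w : hre (- u) w = - hre u w.
Proof. by apply/eqP; rewrite -addr_eq0 -hreDl addNr /hre linear0l. Qed.

Lemma hreNr u w : hre w (- u) = - hre w u.
Proof. by rewrite hreC hreNl hreC. Qed.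

Lemma hreBl u v w : hre (u - v) w = hre u w - hre v w.
Proof. by rewrite hreDl hreNl. Qed.

Lemma hreBr u v w : hre w (u - v) = hre w u - hre w v.
Proof. by rewrite hreDr hreNr. Qed.

Lemma hnormD2 u v : hnorm (u + v) ^+ 2 = hnorm u ^+ 2 + hre u v *+ 2 + hnorm v ^+ 2.
Proof. by rewrite -!hre_norm hreDl !hreDr (hreC v u) mulr2n !addrA. Qed.

Lemma parallelogram u v :
  hnorm (u + v) ^+ 2 + hnorm (u - v) ^+ 2 = 2 * hnorm u ^+ 2 + 2 * hnorm v ^+ 2.
Proof. by rewrite !hnormD2 hnormN hreNr; ring. Qed.

(** The norm already satisfies the triangle inequality, whose square is the Cauchy-Schwarz
    inequality. *)
Lemma hre_le u v : `|hre u v| <= hnorm u * hnorm v.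
Proof.
have le w : hre u w <= hnorm u * hnorm w.
  have := hnormD u w; have := hnormD2 u w; have := hnorm_ge0 (u + w).
  by rewrite mulr2n; nra.
rewrite ler_norml le andbT lerNl -hreNr -(hnormN v); exact: le.
Qed.

Lemma hnormZ (c : R[i]) u : hnorm (c *: u) ^+ 2 = sqmod c * hnorm u ^+ 2.
Proof.
apply: complexI; rewrite [RHS]rmorphM !rmorphXn/= -!normE normrZ exprMn.
by rewrite /sqmod add_Re2_Im2.
Qed.

Lemma sqmodM (a b : R[i]) : sqmod (a * b) = sqmod a * sqmod b.
Proof. by case: a => a a'; case: b => b b'; rewrite /sqmod /=; ring. Qed.

Lemma sqmod_ge0 a : 0 <= sqmod a.
Proof. by rewrite addr_ge0 ?sqr_ge0. Qed.

(** Im <u, v> = Re <u, i v>, the form being conjugate linear in its second argument. This reduces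
    all work on coefficients to [hre]. *)
Lemma sqmod_hdot u v : sqmod (hdot H u v) = hre u v ^+ 2 + hre u ('i%C *: v) ^+ 2.
Proof.
rewrite /sqmod /hre linearZr_LR/=; congr (_ + _ ^+ 2).
by case: (hdot H u v) => a b; rewrite /= !(mul0r, mulN1r, opprK, oppr0, add0r).
Qed.

Lemma hnorm_i u : hnorm ('i%C *: u) = hnorm u.
Proof.
apply/eqP; rewrite -(@eqrXn2 _ 2)// ?hnorm_ge0// hnormZ /sqmod/=.
by rewrite expr0n/= expr1n add0r mul1r.
Qed.

Lemma hnorm_sub_norm u v : `|hnorm u - hnorm v| <= hnorm (u - v).
Proof.
rewrite ler_norml; apply/andP; split.
- have := hnormD (v - u) u; rewrite subrK (hnormB v u); lra.
- have := hnormD (u - v) v; rewrite subrK; lra.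
Qed.

Lemma hnorm_nbhs u (e : R) : 0 < e -> \forall v \near u, hnorm (u - v) < e.
Proof.
move=> e0; apply/nbhs_ballP; exists e%:C%C; first by rewrite /= ltcR.
by move=> v; rewrite -ball_normE /ball_/= normE ltcR.
Qed.

Lemma hnorm_continuous : continuous hnorm.
Proof.
move=> u; apply/cvgrPdist_lt => e e0; have := hnorm_nbhs u e0.
apply: (@filterS _ _ (nbhs_filter u)) => v; apply: le_lt_trans.
exact: hnorm_sub_norm.
Qed.

Lemma continuous_hnorm (T : topologicalType) (a : T -> H) :
  continuous a -> continuous (fun x => hnorm (a x)).
Proof. by move=> ca; exact: continuous_compose ca hnorm_continuous. Qed.

Lemma continuous_addH (T : topologicalType) (a b : T -> H) :
  continuous a -> continuous b -> continuous (fun x => a x + b x).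
Proof. by move=> ca cb x; apply: cvgD; [exact: ca|exact: cb]. Qed.

Lemma continuous_scaleH (T : topologicalType) (c : R[i]) (a : T -> H) :
  continuous a -> continuous (fun x => c *: a x).
Proof. by move=> ca x; apply: cvgZr; exact: ca. Qed.

Lemma continuous_hre (T : topologicalType) (a b : T -> H) :
  continuous a -> continuous b -> continuous (fun x => hre (a x) (b x)).
Proof.
move=> ca cb.
have -> : (fun x => hre (a x) (b x)) = (fun x => 2^-1 *
    (hnorm (a x + b x) * hnorm (a x + b x) - hnorm (a x) * hnorm (a x)
     - hnorm (b x) * hnorm (b x))).
  apply/funext => x; have := hnormD2 (a x) (b x); rewrite !expr2 => ->.
  by rewrite mulr2n; field.
apply: continuous_scale; apply: continuous_sub; first apply: continuous_sub.
- by apply: continuous_prod; apply: continuous_hnorm; exact: continuous_addH.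
- by apply: continuous_prod; exact: continuous_hnorm.
- by apply: continuous_prod; exact: continuous_hnorm.
Qed.

End HilbertReal.

(** * The mean square of matrix coefficients *)

Section IrreducibleNormContinuous.
Variables (R : realType) (G : topGroupType).
Hypothesis cG : compact [set: G].
Variable pi : unitaryRep R G.
Local Notation H := (rep_space pi).
Implicit Types u w : H.

Lemma rep_op_norm g u : hnorm (pi g u) = hnorm u.
Proof.
apply/eqP; rewrite -(@eqrXn2 _ 2)// ?hnorm_ge0// -!hre_norm.
by rewrite /hre rep_op_unitary.
Qed.

Lemma rep_opK g u : pi g^-1%g (pi g u) = u.
Proof. by rewrite -rep_opM mulVg rep_op1. Qed.

Lemma rep_opVK g u : pi g (pi g^-1%g u) = u.
Proof. by rewrite -rep_opM mulgV rep_op1. Qed.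

Lemma hdot_rep g u w : hdot H (pi g u) w = hdot H u (pi g^-1%g w).
Proof. by rewrite -[RHS](rep_op_unitary g) rep_opVK. Qed.

Variable v : H.

(** The quadratic form of the positive operator sending u to the integral of <u, pi(g) v> pi(g) v,
    which commutes with pi. Keeping only the form avoids vector-valued integrals. *)
Definition coef_energy u : R := haar_mean (fun g => sqmod (hdot H u (pi g v))).

Lemma continuous_coef (T : topologicalType) (a : T -> H) (b : T -> G) :
  continuous a -> continuous b -> continuous (fun x => sqmod (hdot H (a x) (pi (b x) v))).
Proof.
move=> ca cb; have cv : continuous (fun x => pi (b x) v).
  exact: continuous_compose cb (@rep_op_continuous R G pi v).
under eq_fun do rewrite sqmod_hdot !expr2.
apply: continuous_add; apply: continuous_prod; apply: continuous_hre => //;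
  exact: continuous_scaleH.
Qed.

Lemma continuous_coef1 u : continuous (fun g => sqmod (hdot H u (pi g v))).
Proof.
by apply: continuous_coef; [exact: continuous_const|exact: continuous_idfun].
Qed.

Lemma coef_energy_continuous : continuous coef_energy.
Proof.
apply: (haar_mean_param cG (F := fun z : H * G => sqmod (hdot H z.1 (pi z.2 v)))).
by apply: continuous_coef => z; [exact: cvg_fst|exact: cvg_snd].
Qed.

Lemma coef_energy_ge0 u : 0 <= coef_energy u.
Proof.
by rewrite /coef_energy; apply: (haar_mean_ge0 cG (@continuous_coef1 u)) => g; exact: sqmod_ge0.
Qed.

Lemma coef_energyZ c u : coef_energy (c *: u) = sqmod c * coef_energy u.
Proof.
rewrite /coef_energy -(haar_meanZ cG); last exact: continuous_coef1.
by congr haar_mean; apply/funext => g; rewrite linearZl_LR sqmodM.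
Qed.

Lemma coef_energy_parallelogram u w :
  coef_energy (u + w) + coef_energy (u - w) = 2 * coef_energy u + 2 * coef_energy w.
Proof.
have c1 := continuous_coef1.
rewrite /coef_energy -!(haar_meanZ cG)// -!(haar_meanD cG)//; last 2 first.
- by apply: continuous_scale.
- by apply: continuous_scale.
congr haar_mean; apply/funext => g.
by rewrite !sqmod_hdot !hreDl !hreNl; ring.
Qed.

Lemma coef_energy_rep g u : coef_energy (pi g u) = coef_energy u.
Proof.
rewrite /coef_energy -(haar_meanMl cG g^-1%g (@continuous_coef1 u)).
by congr haar_mean; apply/funext => h; rewrite hdot_rep rep_opM.
Qed.

Lemma coef_energy_le u (c : R) : (forall g, sqmod (hdot H u (pi g v)) <= c) ->
  coef_energy u <= c.
Proof. by move=> le_c; exact: (haar_mean_le cG (@continuous_coef1 u)). Qed.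

Lemma sqmod_le u w : sqmod (hdot H u w) <= 2 * (hnorm u * hnorm w) ^+ 2.
Proof.
have sq (a b : R) : `|a| <= b -> a ^+ 2 <= b ^+ 2.
  by move=> ab; rewrite -[a ^+ 2]real_normK ?num_real// lerXn2r ?nnegrE// (le_trans _ ab).
rewrite sqmod_hdot mulr2n mulrDl mul1r lerD// sq// ?hre_le//.
by have := hre_le u ('i%C *: w); rewrite hnorm_i.
Qed.

Hypothesis v0 : v != 0.

Lemma coef_energy_gt0 : 0 < coef_energy v.
Proof.
apply: (haar_mean_gt0 cG (@continuous_coef1 v) _ (x0 := 1%g)).
  by move=> g; exact: sqmod_ge0.
rewrite rep_op1 sqmod_hdot ltr_wpDr ?sqr_ge0// exprn_gt0// hre_norm exprn_gt0//.
by rewrite lt_neqAle hnorm_ge0 andbT eq_sym; apply: contra v0 => /eqP/hnorm_eq0 ->.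
Qed.

Definition coef_max : R := sup [set coef_energy u | u in [set u : H | hnorm u <= 1]].

Lemma coef_max_has_sup : has_sup [set coef_energy u | u in [set u : H | hnorm u <= 1]].
Proof.
split; first by exists (coef_energy 0), 0 => //=; rewrite hnorm0.
exists (2 * hnorm v ^+ 2) => _ [u /= u1 <-].
apply: coef_energy_le => g; apply: (le_trans (sqmod_le _ _)).
rewrite rep_op_norm ler_wpM2l// lerXn2r ?nnegrE ?mulr_ge0 ?hnorm_ge0//.
by rewrite ler_piMl ?hnorm_ge0.
Qed.

Lemma coef_energy_max u : coef_energy u <= coef_max * hnorm u ^+ 2.
Proof.
have [->|u0] := eqVneq u 0.
  rewrite -[X in coef_energy X](scale0r v) coef_energyZ /sqmod/= !expr0n/= addr0 mul0r.
  by rewrite hnorm0 expr0n/= mulr0.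
have nu0 : 0 < hnorm u.
  by rewrite lt_neqAle hnorm_ge0 andbT eq_sym; apply: contra u0 => /eqP/hnorm_eq0 ->.
have s1 : sqmod ((hnorm u)^-1)%:C%C = (hnorm u ^+ 2)^-1.
  by rewrite /sqmod/= expr0n/= addr0 exprVn.
rewrite -ler_pdivrMr ?exprn_gt0// mulrC -s1 -coef_energyZ.
apply: (ub_le_sup coef_max_has_sup.2); exists (((hnorm u)^-1)%:C%C *: u) => //=.
rewrite -(@ler_pXn2r _ 2) ?nnegrE ?hnorm_ge0// hnormZ s1 mulVf ?expr1n//.
by rewrite expf_neq0// gt_eqF.
Qed.

Lemma coef_max_gt0 : 0 < coef_max.
Proof.
have := lt_le_trans coef_energy_gt0 (coef_energy_max v).
by rewrite pmulr_lgt0// exprn_gt0// lt_neqAle hnorm_ge0 andbT eq_sym;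
  apply: contra v0 => /eqP/hnorm_eq0 ->.
Qed.

(* A maximizing sequence is Cauchy along an ultrafilter: the coefficients
   <u_n, pi(g) v> converge uniformly in g by equicontinuity, so that the energy of
   u_n - u_m is small, and the parallelogram laws for the energy and the norm then
   force u_n - u_m itself to be small. *)
Lemma coef_max_attained : exists2 u : H, u != 0 & coef_energy u = coef_max * hnorm u ^+ 2.
Proof.
have M0 := coef_max_gt0.
have /choice[u uP] n : exists u : H, hnorm u <= 1 /\ coef_max - n.+1%:R^-1 < coef_energy u.
  have n0 : 0 < n.+1%:R^-1 :> R by rewrite invr_gt0.
  by have [_ [u /= u1 <-] lt] := sup_adherent n0 coef_max_has_sup; exists u.
have [Om UOm sOm] := nat_ultrafilter.
(* Used with [J] the identity and with [J] the multiplication by i, for the real and imaginary parts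
   of the coefficients. *)
have limJ (J : H -> H) : (forall w, hnorm (J w) = hnorm w) ->
    (forall a b, J (a - b) = J a - J b) ->
    (forall a, continuous a -> continuous (fun x : G => J (a x))) ->
    exists w : G -> R, continuous w /\ forall e : R, 0 < e ->
      Om [set n | forall g, `|hre (u n) (J (pi g v)) - w g| <= e].
  move=> Jn JB cJ; apply: (@ultra_uniform_limit R G cG Om _ (hnorm v)) => // [n g|g e e0].
    apply: (le_trans (hre_le _ _)); rewrite Jn rep_op_norm.
    by rewrite ler_piMl ?hnorm_ge0//; have [] := uP n.
  have cF : continuous (fun y => hnorm (pi y v - pi g v)).
    apply: continuous_hnorm; apply: continuous_addH; last exact: continuous_const.
    exact: rep_op_continuous.
  have Fg : hnorm (pi g v - pi g v) < e by rewrite subrr hnorm0.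
  have := near_sublevel cF Fg; apply: (@filterS _ _ (nbhs_filter g)) => y ye n.
  rewrite -hreBr -JB; apply: (le_trans (hre_le _ _)); rewrite Jn.
  by apply: le_trans (ltW ye); rewrite ler_piMl ?hnorm_ge0//; have [] := uP n.
have [w1 [_ w1P]] : exists w : G -> R, continuous w /\ forall e : R, 0 < e ->
    Om [set n | forall g, `|hre (u n) (pi g v) - w g| <= e] by exact: (limJ id).
have [w2 [_ w2P]] := limJ (fun w => 'i%C *: w) (@hnorm_i R H) (fun a b => scalerBr _ a b)
  (fun a ca => continuous_scaleH (c := 'i%C) ca).
have near_max (e : R) : 0 < e -> Om [set n | forall m, (m >= n)%N -> m.+1%:R^-1 < e].
  move=> e0; apply: sOm; exists (Num.truncn e^-1) => // n /= en m nm.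
  rewrite -[ltRHS]invrK ltf_pV2 ?posrE ?invr_gt0// (lt_le_trans (truncnS_gt _))//.
  by rewrite ler_nat ltnS (leq_trans en nm).
pose S (e : R) := [set n | [/\ forall g, `|hre (u n) (pi g v) - w1 g| <= e,
  forall g, `|hre (u n) ('i%C *: pi g v) - w2 g| <= e & n.+1%:R^-1 < e]].
have SO (e : R) : 0 < e -> Om (S e).
  move=> e0; apply: filterS (filterI (filterI (w1P e e0) (w2P e e0)) (near_max e e0)).
  by move=> n [[? ?] /(_ n (leqnn n))].
(* Real and imaginary parts of the two coefficients differ by at most 2 e, so the energy of u_n -
   u_m is at most 8 e^2. The energies of u_n and u_m exceed M - e, so that of u_n + u_m exceeds 4 M
   - 4 e - 8 e^2; it is at most M |u_n + u_m|^2, and |u_n + u_m|^2 + |u_n - u_m|^2 <= 4. *)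
have SC (e : R) n m : 0 < e -> S e n -> S e m ->
    coef_max * hnorm (u n - u m) ^+ 2 <= 4 * e + 8 * e ^+ 2.
  move=> e0 [n1 n2 n3] [m1 m2 m3].
  have E1 : coef_energy (u n - u m) <= 8 * e ^+ 2.
    apply: coef_energy_le => g; rewrite sqmod_hdot !hreBl.
    have sq (a b c : R) : `|a - c| <= e -> `|b - c| <= e -> (a - b) ^+ 2 <= 4 * e ^+ 2.
      by rewrite !ler_distl => /andP[? ?] /andP[? ?]; nra.
    have := sq _ _ _ (n1 g) (m1 g); have := sq _ _ _ (n2 g) (m2 g).
    by lra.
  have E2 := coef_energy_parallelogram (u n) (u m).
  have E3 := coef_energy_max (u n + u m).
  have E4 := parallelogram (u n) (u m).
  have [un1 En] := uP n; have [um1 Em] := uP m.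
  have sq1 w : hnorm w <= 1 -> hnorm w ^+ 2 <= 1.
    by move=> wle1; rewrite exprn_ile1 ?hnorm_ge0.
  have := sq1 _ un1; have := sq1 _ um1.
  move: E2 E3 E4 E1; set a := hnorm (u n + u m) ^+ 2; set b := hnorm (u n - u m) ^+ 2.
  move=> E2 E3 E4 E1 h1 h2.
  have E5 : coef_max * (a + b) <= coef_max * 4.
    by apply: ler_wpM2l; [exact: ltW|lra].
  rewrite mulrDr in E5; move: E2 E3 E1 E5 En Em n3 m3.
  move: (coef_max * a) (coef_max * b) (coef_energy (u n + u m)) (coef_energy (u n - u m)).
  move: (coef_energy (u n)) (coef_energy (u m)) n.+1%:R^-1 m.+1%:R^-1 (e ^+ 2).
  by move=> *; lra.
have PF : ProperFilter (u @ Om) by exact: fmap_proper_filter.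
have cau : cauchy (u @ Om).
  apply/cauchy_ballP => E E0.
  have E0' : 0 < complex.Re E by move: E0; rewrite /= ltcE => /andP[].
  have EE : E = (complex.Re E)%:C%C by rewrite RRe_real// gtr0_real.
  set r := complex.Re E in E0' EE.
  have [e [e0 e1]] : exists e, 0 < e /\ 4 * e + 8 * e ^+ 2 < coef_max * r ^+ 2.
    pose c := coef_max * r ^+ 2; have c0 : 0 < c by rewrite mulr_gt0// exprn_gt0.
    (* For e <= 1 one has 4 e + 8 e^2 <= 12 e, which is below c when e <= c / 13. *)
    exists (Num.min 1 (c / 13)); rewrite lt_min ltr01/= divr_gt0//; split=> //.
    set e := Num.min _ _; have e1 : e <= 1 by rewrite ge_min lexx.
    have e2 : e <= c / 13 by rewrite ge_min lexx orbT.
    have e0 : 0 < e by rewrite lt_min ltr01/= divr_gt0.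
    by rewrite -/c; nra.
  exists (u @` S e, u @` S e) => /=.
    by split; apply: (@filterS _ Om _ (S e) _ _ (SO e e0)) => n Sn; exists n.
  move=> [_ _] /= [[n Sn <-] [m Sm <-]].
  rewrite -ball_normE /ball_/= normE EE ltcR.
  rewrite -(@ltr_pXn2r _ 2)// ?nnegrE ?hnorm_ge0 ?(ltW E0')//.
  rewrite -(ltr_pM2l M0); exact: le_lt_trans (SC (e : R) n m e0 Sn Sm) e1.
have := @cauchy_cvg _ (u @ Om) PF cau; move: (lim (u @ Om)) => l ul.
have l1 : hnorm l <= 1.
  apply/ler_addgt0Pr => e e0.
  have Oe : Om [set n | hnorm (l - u n) < e] := ul _ (hnorm_nbhs l e0).
  have [n /= ne] := filter_ex Oe.
  have [un1 _] := uP n; have := hnormD (u n) (l - u n); rewrite addrC subrK; lra.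
have lM : coef_max <= coef_energy l.
  apply/ler_addgt0Pr => e e0; have e20 : 0 < e / 2 by rewrite divr_gt0.
  have cl : coef_energy l < coef_energy l + e / 2 by lra.
  have Oe : Om [set n | coef_energy (u n) < coef_energy l + e / 2] :=
    ul _ (near_sublevel coef_energy_continuous cl).
  have [n [/= ne nm]] := filter_ex (filterI Oe (near_max _ e20)).
  have [_] := uP n; have := nm n (leqnn n); move: ne.
  by move: (n.+1%:R^-1) => t *; lra.
exists l.
  apply/eqP => l0; have := coef_energy_max l; rewrite l0 hnorm0 expr0n/= mulr0 -l0.
  by lra.
apply/eqP; rewrite eq_le coef_energy_max/=; apply: le_trans lM.
by rewrite ler_piMr ?(ltW M0)// exprn_ile1 ?hnorm_ge0.
Qed.

Hypothesis irr : irreducible_rep pi.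

(** The defect p is non-negative and obeys the parallelogram law, so p(a x + y) + p(a x - y)
    vanishes when p(x) and p(y) do, and then so does each term. The zeros of p thus form a closed
    invariant subspace, which contains a maximizer other than 0. *)
Lemma coef_energyE u : coef_energy u = coef_max * hnorm u ^+ 2.
Proof.
pose p w := coef_max * hnorm w ^+ 2 - coef_energy w.
have p0 w : 0 <= p w by rewrite subr_ge0 coef_energy_max.
have cp : continuous p.
  apply: continuous_sub; last exact: coef_energy_continuous.
  by apply: continuous_scale; under eq_fun do rewrite expr2;
    apply: continuous_prod; exact: hnorm_continuous.
pose E := [set w | p w = 0].
have Ep w : p w <= 0 -> E w by move=> pw; apply/eqP; rewrite eq_le pw p0.
have pZ c w : p (c *: w) = sqmod c * p w.
  by rewrite /p hnormZ coef_energyZ; ring.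
have [_ /(_ E)] := irr; case.
- rewrite (_ : E = ~` [set w | 0 < p w]).
    by apply: open_closedC; exact: open_superlevel.
  apply/seteqP; split=> w /=; first by move=> ->; rewrite ltxx.
  by move=> /negP; rewrite -leNgt; exact: Ep.
- split=> [|a x y]; rewrite ?inE.
    by apply: Ep; rewrite /p hnorm0 expr0n/= mulr0 sub0r oppr_le0 coef_energy_ge0.
  move=> Ex Ey; apply: Ep.
  have := parallelogram (a *: x) y; have := coef_energy_parallelogram (a *: x) y.
  have := p0 (a *: x - y); have := pZ a x; rewrite Ex mulr0.
  move: Ey; rewrite /E/= /p => Ey Ex' pxy E1 E2.
  have : coef_max * (hnorm (a *: x + y) ^+ 2 + hnorm (a *: x - y) ^+ 2) =
         coef_max * (2 * hnorm (a *: x) ^+ 2 + 2 * hnorm y ^+ 2) by rewrite E2.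
  by rewrite !mulrDr !mulrA (mulrC coef_max 2) -!mulrA; lra.
- by move=> g w; rewrite /E/= /p rep_op_norm coef_energy_rep.
- move=> E0; have [w w0 Ew] := coef_max_attained.
  have : E w by rewrite /E/= /p Ew subrr.
  by rewrite E0 => /= w00; move: w0; rewrite w00 eqxx.
- move=> ET; have : E u by rewrite ET.
  by rewrite /E/= /p => /eqP; rewrite subr_eq0 => /eqP.
Qed.

End IrreducibleNormContinuous.

(** By unitarity <pi(y) u - u, pi(g) v> = <u, pi(y^-1) pi(g) v - pi(g) v>, and the vector on the
    right is small uniformly in g by compactness of G. So the energy of pi(y) u - u is small
    relative to |u|^2, and [coef_energyE] turns energy into norm. *)
Lemma irreducible_norm_continuous (R : realType) (G : topGroupType)
  (pi : unitaryRep R G) (e : R) :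
  compact [set: G] -> irreducible_rep pi -> 0 < e ->
  \forall y \near (1%g : G), forall u : rep_space pi, hnorm (pi y u - u) <= e * hnorm u.
Proof.
move=> cG irr e0; have [[v v0] _] := irr.
have M0 := coef_max_gt0 cG v0.
have [d [d0 dE]] : exists d : R, 0 < d /\ 2 * d ^+ 2 = coef_max v * e ^+ 2.
  (* The target is 2 d^2 = M e^2: the 2 is the one of [sqmod_le], and the maximum M converts energy
     into squared norm. *)
  exists (Num.sqrt (coef_max v / 2) * e).
  rewrite mulr_gt0// ?sqrtr_gt0 ?divr_gt0//; split=> //.
  by rewrite exprMn sqr_sqrtr; [field|rewrite divr_ge0// ltW].
pose F (z : G * G) := hnorm (pi (z.1^-1 * z.2)%g v - pi z.2 v).
have cF : continuous F.
  have cpi := @rep_op_continuous R G pi v.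
  have c2 : continuous (fun z : G * G => z.2) by move=> z; exact: cvg_snd.
  have c1 : continuous (fun z : G * G => z.1) by move=> z; exact: cvg_fst.
  apply: continuous_hnorm; apply: continuous_addH.
    apply: continuous_compose cpi; apply: continuous_mul => //.
    exact: continuous_inv.
  under eq_fun do rewrite -scaleN1r; apply: continuous_scaleH.
  exact: continuous_compose c2 cpi.
have := compact_unif_fst 1%g cG cF d0.
apply: (@filterS _ _ (nbhs_filter _)) => y yd u.
have yd' g : hnorm (pi y^-1%g (pi g v) - pi g v) <= d.
  have := yd g; rewrite /F/= invg1 mul1g subrr hnorm0 subr0 rep_opM => /ltW.
  by rewrite ger0_norm ?hnorm_ge0.
have := coef_energyE cG v0 irr (pi y u - u).
have : coef_energy v (pi y u - u) <= 2 * (hnorm u * d) ^+ 2.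
  apply: (coef_energy_le cG) => g.
  have -> : hdot (rep_space pi) (pi y u - u) (pi g v) =
            hdot (rep_space pi) u (pi y^-1%g (pi g v) - pi g v).
    by rewrite hdotBl hdot_rep hdotBr.
  apply: (le_trans (sqmod_le _ _)); rewrite ler_wpM2l// lerXn2r ?nnegrE ?mulr_ge0 ?hnorm_ge0 ?(ltW d0)//.
  by rewrite ler_wpM2l ?hnorm_ge0.
move=> le1 E; rewrite E in le1.
rewrite -(@ler_pXn2r _ 2)// ?nnegrE ?mulr_ge0 ?hnorm_ge0 ?(ltW e0)//.
rewrite -(ler_pM2l M0); apply: (le_trans le1).
by rewrite !exprMn mulrCA dE [leLHS]mulrC -mulrA lexx.
Qed.

(** * Finite dual orbits imply distality *)

Section GeneratedSubgroup.
Variables (K : topGroupType) (Gamma : subgroup (topAut K)) (x : K).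

Let P (L : subgroup K) := [/\ closed (subgroup_set L), invariant_set Gamma L & subgroup_set L x].
Let S : set K := [set y | forall L : subgroup K, P L -> subgroup_set L y].

Definition orbit_subgroup : subgroup K.
Proof.
refine (@Subgroup K S _ _ _).
- by move=> L _; exact: subgroup1.
- by move=> y z Sy Sz L PL; apply: subgroupM; [exact: Sy|exact: Sz].
- by move=> y Sy L PL; apply: subgroupV; exact: Sy.
Defined.

Lemma orbit_subgroup_closed : closed (subgroup_set orbit_subgroup).
Proof.
move=> y cly L PL; have [clL _ _] := PL; apply: clL => A nA.
by have [z [Sz Az]] := cly A nA; exists z; split=> //; exact: Sz.
Qed.

Lemma orbit_subgroup_invariant : invariant_set Gamma orbit_subgroup.
Proof.
have sub a y : subgroup_set Gamma a -> S y -> S (a y).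
  move=> Ga Sy L PL; have [_ invL _] := PL.
  by rewrite -(invL a Ga); exists y => //; exact: Sy.
move=> a Ga; apply/seteqP; split=> [_ [y Sy <-]|y Sy]; first exact: sub.
exists ((a^-1)%g y); last exact: (aut_invK a).
by apply: sub => //; exact: subgroupV.
Qed.

Lemma orbit_subgroup_mem : subgroup_set orbit_subgroup x.
Proof. by move=> L []. Qed.

Lemma orbit_subgroup_min (L : subgroup K) : closed (subgroup_set L) ->
  invariant_set Gamma L -> subgroup_set L x -> subgroup_set orbit_subgroup `<=` L.
Proof. by move=> ? ? ? y; apply; split. Qed.

End GeneratedSubgroup.

Lemma aut_funV (G : topGroupType) (b : topAut G) x : b x^-1%g = (b x)^-1%g.
Proof. by apply: (mulgI (b x)); rewrite -aut_funM !mulgV aut1. Qed.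

Lemma rep_equiv_refl (R : realType) (G : topGroupType) (pi : unitaryRep R G) :
  rep_equiv pi pi.
Proof. by exists idfun; split=> // w; exists w. Qed.

Lemma rep_equiv_sym_norm (R : realType) (G : topGroupType) (pi rho : unitaryRep R G)
  (y : G) (e : R) : rep_equiv pi rho ->
  (forall u : rep_space rho, hnorm (rho y u - u) <= e * hnorm u) ->
  forall u : rep_space pi, hnorm (pi y u - u) <= e * hnorm u.
Proof.
move=> [U [surj iso inter]] rhoe u.
have Un v : hnorm (U v) = hnorm v.
  by apply/eqP; rewrite -(@eqrXn2 _ 2)// ?hnorm_ge0// -!hre_norm /hre iso.
have UB : U (pi y u - u) = rho y (U u) - U u by rewrite linearB/= inter.
by rewrite -(Un u) -Un UB.
Qed.

Lemma finite_dual_orbit_distal (R : realType) (K : topGroupType)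
  (Gamma : subgroup (topAut K)) : compact [set: K] ->
  (forall L : subgroup K,
     closed (subgroup_set L) -> invariant_set Gamma L ->
     subgroup_set L <> [set 1%g] ->
     exists pi : unitaryRep R (subgroup_type L),
       [/\ irreducible_rep pi, nontrivial_rep pi &
           finite_pred (dual_orbit (restr_action Gamma L) pi)]) ->
  distal Gamma.
Proof.
move=> cK H3 x x1 clx.
pose L := orbit_subgroup Gamma x.
have clL : closed (subgroup_set L) := @orbit_subgroup_closed K Gamma x.
have invL : invariant_set Gamma L := @orbit_subgroup_invariant K Gamma x.
have Lx : subgroup_set L x := @orbit_subgroup_mem K Gamma x.
have L1 : subgroup_set L <> [set 1%g].
  by move=> L1; move: Lx; rewrite L1 => xe; move: x1; rewrite xe eqxx.
have [pi [irr [g0 [v0 gv0]] [n [F orbF]]]] := H3 L clL invL L1.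
pose G : topGroupType := subgroup_type L.
have cG : compact [set: G] := compact_subgroup cK clL.
pose GL := restr_action Gamma L.
have restr a : subgroup_set Gamma a -> exists2 b : topAut G, GL b &
    forall y, subgroup_val (b y) = a (subgroup_val y).
  by move=> Ga; exact: restr_actionP (invL a Ga).
have near_e (e : R) : 0 < e -> \forall y \near (1%g : G), forall a, GL a ->
    forall u : rep_space pi, hnorm (pi ((a^-1)%g y) u - u) <= e * hnorm u.
  move=> e0.
  have piN := irreducible_norm_continuous cG irr e0.
  have key : \forall y \near (1%g : G), forall i : 'I_n, forall a, GL a ->
      F i = rep_class (rep_twist a pi) ->
      forall u : rep_space pi, hnorm (pi ((a^-1)%g y) u - u) <= e * hnorm u.
    apply: (filter_forall (nbhs_filter (1%g : G))) => i.
    (* One representative per listed class gives a neighbourhood valid for the whole class; entries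
       of the list that are not classes of twists impose nothing. *)
    have [[a [GLa Fa]]|nF] := pselect (exists a, GL a /\ F i = rep_class (rep_twist a pi)); last first.
      by apply: (@filterS _ _ (nbhs_filter _) setT _ _ filterT) => y _ a GLa Fa;
        case: nF; exists a.
    have piNa : \forall y \near (1%g : G),
        forall u : rep_space pi, hnorm (pi ((a^-1)%g y) u - u) <= e * hnorm u.
      have := @aut_fun_continuous _ (a^-1)%g (1%g : G); rewrite /continuous_at aut1.
      exact: (fun cva => cva _ piN).
    apply: (@filterS _ _ (nbhs_filter _) _ _ _ piNa) => y ye b GLb Fb.
    have eqv : rep_equiv (rep_twist b pi) (rep_twist a pi).
      have : rep_class (rep_twist a pi) (rep_twist a pi) by exact: rep_equiv_refl.
      by rewrite -Fa Fb.
    exact: (rep_equiv_sym_norm eqv ye).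
  apply: (@filterS _ _ (nbhs_filter _) _ _ _ key) => y ye a GLa.
  have [i Fi] := orbF _ (ex_intro2 _ _ a GLa erefl).
  exact: ye i a GLa Fi.
pose xL : G := subgroup_elt Lx.
have fixx a : GL a -> forall u : rep_space pi, pi ((a^-1)%g xL) u = u.
  move=> GLa u; apply/eqP; rewrite -subr_eq0; apply/eqP/hnorm_eq0/eqP.
  rewrite eq_le hnorm_ge0 andbT; apply/ler_addgt0Pr => e e0; rewrite add0r.
  (* The added 1 keeps the divisor positive when u = 0. *)
  have d0 : 0 < e / (hnorm u + 1) by rewrite divr_gt0// ltr_wpDl ?hnorm_ge0.
  have [_ [[U oU <-] /= U1 UP]] := near_e _ d0.
  have [_ [[c Gc <-] Ucx]] := clx U (open_nbhs_nbhs (conj oU U1)).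
  have [b GLb bE] := restr c Gc.
  have := UP (b xL); rewrite /= bE => /(_ Ucx (b * a)%g (restr_actionM GLb GLa) u).
  (* The twist by [b * a] at the orbit point [b xL] near 1 takes the value of the twist by [a] at
     [xL], so the estimate at a moving point becomes one at a fixed point. *)
  have -> : aut_inv (b * a)%g (b xL) = aut_inv a xL.
    exact: (congr1 (aut_inv a) (aut_funK b xL)).
  move=> H; apply: (le_trans H); rewrite mulrAC ler_pdivrMr ?ltr_wpDl ?hnorm_ge0//.
  by rewrite ler_wpM2l ?(ltW e0)// lerDl.
pose N : set K := [set y | exists Ly : subgroup_set L y, forall a, GL a ->
  forall u : rep_space pi, pi ((a^-1)%g (subgroup_elt Ly)) u = u].
have NE (y : G) : N (subgroup_val y) <-> forall a, GL a ->
    forall u : rep_space pi, pi ((a^-1)%g y) u = u.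
  split=> [[Ly yfix] a GLa u|yfix].
    have -> : y = subgroup_elt Ly by exact: subgroup_val_inj.
    exact: yfix.
  exists (subgroup_valP y) => a GLa u.
  have -> : subgroup_elt (subgroup_valP y) = y by exact: subgroup_val_inj.
  exact: yfix.
have NL y : N y -> exists z : G, y = subgroup_val z.
  by move=> [Ly _]; exists (subgroup_elt Ly).
have N1 : N 1%g by apply/(NE 1%g) => a GLa u; rewrite aut1 rep_op1.
have NM y z : N y -> N z -> N (y * z)%g.
  move=> Ny Nz; have [y' yE] := NL y Ny; have [z' zE] := NL z Nz.
  subst y z; apply/(NE (y' * z')%g) => a GLa u.
  by rewrite aut_funM rep_opM (NE z').1// (NE y').1.
have NV y : N y -> N (y^-1)%g.
  move=> Ny; have [y' yE] := NL y Ny; subst y.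
  apply/(NE (y'^-1)%g) => a GLa u.
  by rewrite aut_funV -[in LHS]((NE y').1 Ny a GLa u) rep_opK.
pose Ns := @Subgroup K N N1 NM NV.
have clN : closed (subgroup_set Ns).
  move=> y cly.
  have Ly : subgroup_set L y.
    by apply: clL => A nA; have [z [[Lz _] Az]] := cly A nA; exists z.
  exists Ly => a GLa u; apply/eqP; rewrite -subr_eq0; apply/eqP/hnorm_eq0/eqP.
  rewrite eq_le hnorm_ge0 andbT leNgt; apply/negP => lt0.
  have cf : continuous (fun z : G => hnorm (pi ((a^-1)%g z) u - u)).
    apply: continuous_hnorm; apply: continuous_addH; last exact: continuous_const.
    exact: continuous_compose (@aut_fun_continuous _ (a^-1)%g) (@rep_op_continuous _ _ pi u).
  have [_ [[U oU <-] /= Uy UP]] := near_superlevel cf lt0.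
  have [z [Nz Uz]] := cly U (open_nbhs_nbhs (conj oU Uy)).
  have [z' zE] := NL z Nz; subst z.
  have := UP z' Uz; rewrite /= (NE z').1//.
  by rewrite subrr hnorm0 ltxx.
have invN : invariant_set Gamma Ns.
  have sub c y : subgroup_set Gamma c -> N y -> N (c y).
    move=> Gc Ny; have [y' yE] := NL y Ny; subst y.
    have [b GLb bE] := restr c Gc; rewrite -bE; apply/(NE (b y')) => a GLa u.
    have -> : (a^-1)%g (b y') = ((b^-1 * a)^-1)%g y' by rewrite invgM invgK.
    by apply: (NE y').1 => //; exact: restr_actionM (restr_actionV GLb) GLa.
  move=> c Gc; apply/seteqP; split=> [_ [y Ny <-]|y Ny]; first exact: sub.
  exists ((c^-1)%g y); last exact: (aut_invK c).
  by apply: sub => //; exact: subgroupV.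
have Nx : N x by exists Lx.
have := @orbit_subgroup_min K Gamma x Ns clN invN Nx _ (subgroup_valP g0).
move=> /(NE g0) /(_ 1%g (@restr_action1 K Gamma L) v0).
by move: gv0; rewrite invg1 => /eqP gv0 /gv0.
Qed.

(** * Finite-dimensional unitary representations *)

Section ComplexSpace.
Variables (R : realType) (n : nat).
Local Notation C := R[i].

(** A separate type, so that its norm is the Hermitian one and not the maximum norm of matrices. *)
Definition cspace : Type := 'rV[C]_n.
HB.instance Definition _ := GRing.Lmodule.on cspace.

Definition cnorm (u : cspace) : C := sqrtC (dotmx u u).

Lemma cnormD (u v : cspace) : cnorm (u + v) <= cnorm u + cnorm v.
Proof. by rewrite /cnorm triangle_lerif. Qed.

Lemma cnormZ (l : C) (u : cspace) : cnorm (l *: u) = `|l| * cnorm u.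
Proof.
rewrite /cnorm linearZl_LR linearZr_LR/= mulrA -normCK.
by rewrite sqrtCM ?nnegrE ?exprn_ge0 ?dnorm_ge0// sqrCK.
Qed.

Lemma cnorm_eq0 (u : cspace) : cnorm u = 0 -> u = 0.
Proof. by move/eqP; rewrite sqrtC_eq0 dnorm_eq0 => /eqP. Qed.

HB.instance Definition _ := Lmodule_isNormed.Build C cspace cnormD cnormZ cnorm_eq0.

Definition nrm2 m (u : 'rV[C]_m) : R := \sum_j sqmod (u 0 j).

Lemma nrm2E m (u : 'rV[C]_m) : dotmx u u = (nrm2 u)%:C%C.
Proof.
rewrite dotmxE mxE /nrm2 rmorph_sum; apply: eq_bigr => j _.
by rewrite !mxE -normCK; exact: esym (add_Re2_Im2 _).
Qed.

Lemma cnorm2 (u : cspace) : `|u| ^+ 2 = (nrm2 u)%:C%C.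
Proof. by rewrite -nrm2E [`|u|]/(cnorm u) sqrtCK. Qed.

Lemma cnorm_lt (u : cspace) (r : R) : 0 < r -> (`|u| < r%:C%C) = (nrm2 u < r ^+ 2).
Proof.
move=> r0; rewrite -(@ltr_pXn2r _ 2)// ?nnegrE ?ler0c ?(ltW r0)//.
by rewrite cnorm2 -rmorphXn ltcR.
Qed.

Lemma cspace_complete (F : set_system cspace) : ProperFilter F -> cauchy F -> cvg F.
Proof.
move=> PF /cauchy_ballP cF.
have conv (f : cspace -> R) : (forall u v, (f u - f v) ^+ 2 <= nrm2 (u - v)) ->
    exists l, forall e : R, 0 < e -> F [set u | (f u - l) ^+ 2 < e].
  move=> fL; have PfF : ProperFilter (f @ F) by exact: fmap_proper_filter.
  have cfF : cauchy (f @ F).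
    apply/cauchy_ballP => e e0.
    have e0c : 0 < e%:C%C by rewrite ltcR.
    have [[A B]/= [FA FB] AB] := cF e%:C%C e0c.
    exists (f @` A, f @` B) => /=.
      by split; [apply: (@filterS _ F _ A _ _ FA)|apply: (@filterS _ F _ B _ _ FB)] => u; exists u.
    move=> [_ _] /= [[u Au <-] [v Bv <-]]; rewrite -ball_normE /ball_/=.
    have := AB (u, v) (conj Au Bv); rewrite /= -ball_normE /ball_/= cnorm_lt// => uv.
    rewrite -(@ltr_pXn2r _ 2)// ?nnegrE ?(ltW e0)// real_normK ?num_real//.
    exact: le_lt_trans (fL u v) uv.
  have := @R_complete R (f @ F) PfF cfF; move: (lim (f @ F)) => l fl; exists l => e e0.
  have se0 : 0 < Num.sqrt e by rewrite sqrtr_gt0.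
  have : F [set u | `|l - f u| < Num.sqrt e] := fl _ (nbhsx_ballx l _ se0).
  apply: filterS => u /=; rewrite -(@ltr_pXn2r _ 2)// ?nnegrE ?(ltW se0)//.
  by rewrite real_normK ?num_real// sqr_sqrtr ?(ltW e0)// -sqrrN opprB.
have coord j (u v : cspace) : sqmod (u 0 j - v 0 j) <= nrm2 (u - v).
  rewrite /nrm2 (bigD1 j)//= !mxE lerDl; apply: sumr_ge0 => k _; exact: sqmod_ge0.
have /choice[a aP] j : exists l, forall e : R, 0 < e ->
    F [set u : cspace | (complex.Re (u 0 j) - l) ^+ 2 < e].
  apply: conv => u v; apply: le_trans (coord j u v).
  by rewrite /sqmod !raddfB/= lerDl sqr_ge0.
have /choice[b bP] j : exists l, forall e : R, 0 < e ->
    F [set u : cspace | (complex.Im (u 0 j) - l) ^+ 2 < e].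
  apply: conv => u v; apply: le_trans (coord j u v).
  by rewrite /sqmod !raddfB/= lerDr sqr_ge0.
pose l : cspace := \row_j (a j +i* b j)%C.
apply/cvg_ex; exists l => A /nbhs_ballP[e e0 eA].
have e0' : 0 < complex.Re e by move: e0; rewrite /= ltcE => /andP[].
have eE : e = (complex.Re e)%:C%C by rewrite RRe_real// gtr0_real.
pose r := complex.Re e; rewrite -/r in e0' eE.
(* Each of the n coordinates contributes at most 2 d, in all r^2 n / (n + 1) < r^2; the successor
   also covers n = 0. *)
pose d : R := r ^+ 2 / (2 * n.+1%:R).
have d0 : 0 < d by rewrite divr_gt0 ?exprn_gt0// mulr_gt0// ltr0n.
have FF : F [set u : cspace | forall j, (complex.Re (u 0 j) - a j) ^+ 2 < d /\
    (complex.Im (u 0 j) - b j) ^+ 2 < d].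
  apply: (@filter_forall cspace 'I_n _ F _) => j.
  by apply: filterS (filterI (aP j d d0) (bP j d d0)).
apply: filterS FF => u ud; apply: eA; rewrite -ball_normE /ball_/= eE cnorm_lt//.
apply: (@le_lt_trans _ _ (\sum_(j < n) (2 * d))).
  apply: ler_sum => j _; rewrite !mxE.
  have [] := ud j; rewrite /sqmod; case: (u 0 j) => x y /= *; nra.
rewrite sumr_const card_ord -[_ *+ n]mulr_natr.
have n0 : n.+1%:R != 0 :> R by rewrite pnatr_eq0.
have -> : 2 * d * n%:R = r ^+ 2 * (n%:R / n.+1%:R) by rewrite /d; field.
by rewrite gtr_pMr ?exprn_gt0// ltr_pdivrMr ?ltr0n// mul1r ltr_nat.
Qed.

HB.instance Definition _ := Uniform_isComplete.Build cspace cspace_complete.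

Definition cdot : {dot cspace for @Num.Def.conjC C} :=
  ((@dotmx C n : 'rV[C]_n -> 'rV[C]_n -> C) : {dot 'rV[C]_n for @Num.Def.conjC C}).

Lemma cdot_norm (v : cspace) : cdot v v = `|v| ^+ 2.
Proof. by rewrite [`|v|]/(cnorm v) sqrtCK. Qed.

Definition cspace_hilbert : hilbertSpace R := HilbertSpace cdot_norm.

Lemma cspace_hdot (u v : cspace) : hdot cspace_hilbert u v = dotmx (u : 'rV[C]_n) v.
Proof. by []. Qed.

End ComplexSpace.

Section MatrixRep.
Variables (R : realType) (G : topGroupType) (n : nat).
Local Notation C := R[i].
Local Open Scope sesquilinear_scope.

(* Matrices act on row vectors from the right, so products are reversed. *)
Definition matrix_rep (s : G -> 'M[C]_n) : Prop :=
  [/\ s 1%g = 1%:M, forall g h, s (g * h)%g = s h *m s g,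
      forall g, s g *m (s g)^t* = 1%:M &
      forall (v : 'rV[C]_n) g (e : R), 0 < e ->
        \forall h \near g, nrm2 (v *m s g - v *m s h) < e].

Variables (s : G -> 'M[C]_n) (rs : matrix_rep s).

Definition matrix_op (g : G) (u : cspace R n) : cspace R n := (u : 'rV[C]_n) *m s g.

Lemma matrix_op_linear g : linear (matrix_op g).
Proof. by move=> a u v; rewrite /matrix_op mulmxDl scalemxAl. Qed.

HB.instance Definition _ g :=
  GRing.isLinear.Build C (cspace R n) (cspace R n) *:%R (matrix_op g) (matrix_op_linear g).

Definition unitary_of_matrix : unitaryRep R G.
Proof.
refine (@UnitaryRep R G (cspace_hilbert R n)
  (fun g => (matrix_op g : {linear cspace R n -> cspace R n})) _ _ _ _).
- by move=> v; rewrite /= /matrix_op; have [-> _ _ _] := rs; rewrite mulmx1.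
- by move=> g h v; rewrite /= /matrix_op; have [_ -> _ _] := rs; rewrite mulmxA.
- move=> g u v; rewrite !cspace_hdot /= /matrix_op !dotmxE.
  have [_ _ su _] := rs; rewrite trmx_mul map_mxM mulmxA -[_ *m s g *m _]mulmxA su.
  by rewrite mulmx1.
- move=> v g A nA; have [_ _ _ sc] := rs.
  have /nbhs_ballP[e e0 eA] := nA.
  have e0' : 0 < complex.Re e by move: e0; rewrite /= ltcE => /andP[].
  have eE : e = (complex.Re e)%:C%C by rewrite RRe_real// gtr0_real.
  have := sc v g _ (exprn_gt0 2 e0').
  apply: (@filterS _ _ (nbhs_filter g)) => h gh; apply: eA.
  by rewrite -ball_normE /ball_/= eE cnorm_lt.
Defined.

End MatrixRep.

(** * Schur's lemma and complete reducibility for matrix representations *)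

Section MatrixRepTheory.
Variables (R : realType) (G : topGroupType).
Local Notation C := R[i].
Local Open Scope sesquilinear_scope.

Lemma trmxC_mul m n p (A : 'M[C]_(m, n)) (B : 'M[C]_(n, p)) :
  (A *m B)^t* = B^t* *m A^t*.
Proof. by rewrite trmx_mul map_mxM. Qed.

Lemma nrm2_isometry m n (X : 'M[C]_(m, n)) (u : 'rV[C]_m) :
  X *m X^t* = 1%:M -> nrm2 (u *m X) = nrm2 u.
Proof.
move=> XX; apply: complexI; rewrite -!nrm2E !dotmxE trmxC_mul mulmxA.
by rewrite -[_ *m X *m _]mulmxA XX mulmx1.
Qed.

Lemma adjoint_eq0 m n (Z : 'M[C]_(m, n)) : Z *m Z^t* = 0 -> Z = 0.
Proof.
move=> Z0; apply/row_matrixP => i; apply/eqP; rewrite row0 -(dnorm_eq0 (@dotmx C n)).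
apply/eqP; transitivity ((Z *m Z^t*) i i); last by rewrite Z0 mxE.
apply: etrans (dotmxE _ _) _.
by rewrite !mxE; apply: eq_bigr => j _; rewrite !mxE.
Qed.

Section OneRep.
Variables (n : nat) (s : G -> 'M[C]_n).

Definition mx_stable m (W : 'M[C]_(m, n)) := forall g, (W *m s g <= W)%MS.

Definition mx_irreducible := (0 < n)%N /\
  forall W : 'M[C]_n, mx_stable W -> W = 0 \/ row_full W.

Hypothesis rs : matrix_rep s.

Lemma matrix_rep_adjoint g : (s g)^t* = s g^-1%g.
Proof.
have [s1 sM su _] := rs.
have sVg : s g^-1%g *m s g = 1%:M by rewrite -sM mulgV s1.
by rewrite -[LHS]mul1mx -sVg -mulmxA su mulmx1.
Qed.

(** A subspace given as a set W is the row space of a matrix of maximal rank among those whose row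
    space lies in W: a vector of W outside it would raise the rank. *)
Lemma unitary_of_matrix_irreducible : mx_irreducible -> irreducible_rep (unitary_of_matrix rs).
Proof.
move=> [n0 irr]; split.
  exists (delta_mx 0 (Ordinal n0) : 'rV[C]_n); apply/eqP => /matrixP/(_ 0 (Ordinal n0)).
  by rewrite !mxE !eqxx => /eqP; rewrite oner_eq0.
move=> W _ [W0 Wlin] Ws; rewrite inE in W0.
have WD (a : C) (u v : 'rV[C]_n) : W u -> W v -> W (a *: u + v).
  by move=> Wu Wv; have := Wlin a u v; rewrite !inE; apply.
have WZ (a : C) (u : 'rV[C]_n) : W u -> W (a *: u).
  by move=> Wu; have := WD a u 0 Wu W0; rewrite addr0.
pose inW (M : 'M[C]_n) := forall v : 'rV[C]_n, (v <= M)%MS -> W v.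
pose Q k := `[< exists2 M : 'M[C]_n, inW M & \rank M = k >].
have Q0 : exists k, Q k.
  exists 0%N; apply/asboolP; exists 0; last by rewrite mxrank0.
  by move=> v; rewrite submx0 => /eqP ->.
have Qn k : Q k -> (k <= n)%N by move=> /asboolP[M _ <-]; exact: rank_leq_row.
case: (ex_maxnP Q0 Qn) => k /asboolP[M MW Mk] kmax.
have WM (v : 'rV[C]_n) : W v -> (v <= M)%MS.
  move=> Wv; apply: contrapT => /negP vM.
  have : Q (\rank (M + v)%MS).
    apply/asboolP; exists (M + v)%MS => // w /sub_addsmxP[[a b] /= ->].
    rewrite addrC -[b *m v]scale1r; apply: WD; last by apply: MW; exact: submxMl.
    by rewrite (mx11_scalar b) mul_scalar_mx; exact: WZ.
  move=> /kmax; rewrite leqNgt -Mk => /negP; apply.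
  rewrite ltn_neqAle mxrankS ?addsmxSl// andbT; apply: contra vM => /eqP rk.
  apply: submx_trans (addsmxSr M v) _.
  by rewrite -(mxrank_leqif_sup (addsmxSl M v)).2 -rk.
have stM : mx_stable M.
  move=> g; apply/row_subP => i; rewrite row_mul; apply: WM.
  by apply: Ws; apply: MW; exact: row_sub.
have [M0|Mfull] := irr M stM; [left|right].
- apply/seteqP; split=> [v /WM|v ->//].
  by rewrite M0 submx0 => /eqP.
- by apply/seteqP; split=> // v _; apply: MW; exact: submx_full.
Qed.

Lemma unitary_of_matrix_nontrivial g : s g != 1%:M -> nontrivial_rep (unitary_of_matrix rs).
Proof.
move=> sg1; apply: contrapT => triv; move: sg1 => /eqP; apply.
apply/row_matrixP => i; rewrite rowE row1.
apply: contrapT => /eqP si; apply: triv; exists g, (delta_mx 0 i : 'rV[C]_n).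
exact: si.
Qed.

Lemma mx_schur (A : 'M[C]_n) : mx_irreducible -> (forall g, s g *m A = A *m s g) ->
  exists c, A = c%:M.
Proof.
move=> [n0 irr] sA; have [c ec] := eigenvalue_closed A n0.
exists c; have st : mx_stable (eigenspace A c).
  by move=> g; apply: comm_mx_stable_eigenspace; rewrite /comm_mx sA.
have [E0|Efull] := irr _ st; first by move: ec; rewrite /eigenvalue E0 eqxx.
have /eigenspaceP : (1%:M <= eigenspace A c)%MS by exact: submx_full.
by rewrite mul1mx scalemx1.
Qed.

End OneRep.

Lemma rep_equiv_trans (p q r : unitaryRep R G) :
  rep_equiv p q -> rep_equiv q r -> rep_equiv p r.
Proof.
move=> [U [Us Ui Ug]] [V [Vs Vi Vg]].
exists (V \o U : {linear rep_space p -> rep_space r}); split.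
- by move=> w; have [v <-] := Vs w; have [u <-] := Us v; exists u.
- by move=> u v /=; rewrite Vi Ui.
- by move=> g v /=; rewrite Ug Vg.
Qed.

Section Intertwiner.
Variables (m n : nat) (s : G -> 'M[C]_m) (t : G -> 'M[C]_n).
Hypotheses (rs : matrix_rep s) (rt : matrix_rep t).
Variable Z : 'M[C]_(m, n).

Definition mulmx_op (u : cspace R m) : cspace R n := (u : 'rV[C]_m) *m Z.

Lemma mulmx_op_linear : linear mulmx_op.
Proof. by move=> a u v; rewrite /mulmx_op mulmxDl scalemxAl. Qed.

HB.instance Definition _ :=
  GRing.isLinear.Build C (cspace R m) (cspace R n) *:%R mulmx_op mulmx_op_linear.

Hypotheses (ZZ : Z *m Z^t* = 1%:M) (ZZ' : Z^t* *m Z = 1%:M).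
Hypothesis sZ : forall g, s g *m Z = Z *m t g.

Lemma matrix_rep_equiv : rep_equiv (unitary_of_matrix rs) (unitary_of_matrix rt).
Proof.
exists (mulmx_op : {linear cspace R m -> cspace R n}); split.
- move=> w; exists ((w : 'rV[C]_n) *m Z^t* : 'rV[C]_m).
  by rewrite /= /mulmx_op -mulmxA ZZ' mulmx1.
- move=> u v; rewrite !cspace_hdot /= /mulmx_op !dotmxE trmxC_mul mulmxA.
  by rewrite -[_ *m Z *m _]mulmxA ZZ mulmx1.
- move=> g v; rewrite /= /mulmx_op; rewrite /= /matrix_op.
  by rewrite -!mulmxA sZ.
Qed.

End Intertwiner.

(** Both products of Z with its adjoint commute with an irreducible representation, hence are
    scalar. The scalars agree because Z is non-zero, and are positive as sums of squared moduli;
    dividing Z by the square root makes it unitary. *)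
Lemma matrix_rep_schur m n (s : G -> 'M[C]_m) (t : G -> 'M[C]_n)
  (rs : matrix_rep s) (rt : matrix_rep t) (Z : 'M[C]_(m, n)) :
  mx_irreducible s -> mx_irreducible t -> Z != 0 ->
  (forall g, s g *m Z = Z *m t g) ->
  rep_equiv (unitary_of_matrix rs) (unitary_of_matrix rt).
Proof.
move=> irs irt Z0 sZ.
have tZ g : t g *m Z^t* = Z^t* *m s g.
  have := congr1 (fun A => A^t*) (sZ g^-1%g); rewrite !trmxC_mul.
  by rewrite -!matrix_rep_adjoint// !trmxCK.
have [c cE] : exists c, Z *m Z^t* = c%:M.
  by apply: (mx_schur irs) => g; rewrite mulmxA sZ -mulmxA tZ mulmxA.
have [c' cE'] : exists c, Z^t* *m Z = c%:M.
  by apply: (mx_schur irt) => g; rewrite mulmxA tZ -mulmxA sZ mulmxA.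
have cc' : c = c'.
  have : c *: Z = c' *: Z by rewrite -mul_scalar_mx -cE -mulmxA cE' mul_mx_scalar.
  by move/eqP; rewrite -subr_eq0 -scalerBl scaler_eq0 (negPf Z0) orbF subr_eq0 => /eqP.
have c0 : c != 0.
  by apply: contra Z0 => /eqP c0; apply/eqP/adjoint_eq0; rewrite cE c0 raddf0.
have cge0 : 0 <= c.
  have [m0 _] := irs; pose i := Ordinal m0.
  have -> : c = (Z *m Z^t*) i i by rewrite cE mxE eqxx mulr1n.
  by rewrite mxE; apply: sumr_ge0 => j _; rewrite !mxE -normCK exprn_ge0.
pose r := (sqrtC c)^-1.
have rr : r * (Num.conj r) * c = 1.
  rewrite /r -normCK normfV exprVn ger0_norm ?sqrtC_ge0// sqrtCK mulVf//.
have rZ : (r *: Z)^t* = Num.conj r *: Z^t* by rewrite linearZ/= map_mxZ.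
apply: (@matrix_rep_equiv _ _ _ _ rs rt (r *: Z)).
- by rewrite rZ -scalemxAl -scalemxAr scalerA cE scale_scalar_mx rr.
- rewrite rZ -scalemxAl -scalemxAr scalerA cE' -cc' scale_scalar_mx.
  by rewrite [Num.conj r * r]mulrC rr.
- by move=> g; rewrite -scalemxAr sZ scalemxAl.
Qed.

Section SubRep.
Variables (n : nat) (P : G -> 'M[C]_n).
Hypothesis rP : matrix_rep P.

Definition sub_matrix m (X : 'M[C]_(m, n)) (g : G) : 'M[C]_m := X *m P g *m X^t*.

(** The rows of [X] are an orthonormal basis of an irreducible stable subspace, and [sub_matrix X]
    is P written in that basis. *)
Definition irreducible_frame m (X : 'M[C]_(m, n)) :=
  [/\ (0 < m)%N, X *m X^t* = 1%:M, mx_stable P X &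
   forall W : 'M[C]_n, mx_stable P W -> (W <= X)%MS -> W = 0 \/ (X <= W)%MS].

Lemma sub_matrixE m (X : 'M[C]_(m, n)) g : X *m X^t* = 1%:M -> mx_stable P X ->
  sub_matrix X g *m X = X *m P g.
Proof.
move=> XX stX; have /submxP[D DE] := stX g.
by rewrite /sub_matrix DE -[D *m X *m _]mulmxA XX mulmx1.
Qed.

Lemma sub_matrix_rep m (X : 'M[C]_(m, n)) : X *m X^t* = 1%:M -> mx_stable P X ->
  matrix_rep (sub_matrix X).
Proof.
move=> XX stX; have [P1 PM PU Pc] := rP; have E := sub_matrixE _ XX stX; split.
- by rewrite /sub_matrix P1 mulmx1.
- move=> g h; rewrite [LHS]/sub_matrix PM mulmxA -E.
  by rewrite [X in _ = _ *m X]/sub_matrix !mulmxA.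
- move=> g; rewrite {2}/sub_matrix !trmxC_mul trmxCK !mulmxA E.
  by rewrite -[X *m P g *m _]mulmxA PU mulmx1.
- move=> v g e e0; have := Pc (v *m X) g e e0.
  apply: (@filterS _ _ (nbhs_filter g)) => h.
  rewrite -(nrm2_isometry (v *m sub_matrix X g - _) XX) mulmxBl.
  rewrite -[v *m sub_matrix X g *m X]mulmxA -[v *m sub_matrix X h *m X]mulmxA.
  by rewrite !E !mulmxA.
Qed.

Lemma sub_matrix_irreducible m (X : 'M[C]_(m, n)) : irreducible_frame X ->
  mx_irreducible (sub_matrix X).
Proof.
move=> [m0 XX stX irr]; split=> // W stW.
have Xfree : row_free X.
  by apply/row_freeP; exists (X^t*).
have st : mx_stable P <<W *m X>>%MS.
  move=> g; rewrite (eqmxMr _ (genmxE _)) genmxE.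
  by rewrite -mulmxA -sub_matrixE// mulmxA submxMr.
have [|W0|XW] := irr _ st; first by rewrite genmxE submxMl.
- left; apply/eqP; rewrite -(mulmx_free_eq0 _ Xfree) -mxrank_eq0 -genmxE.
  by rewrite W0 mxrank0.
- right; rewrite genmxE in XW; rewrite /row_full eqn_leq rank_leq_row/=.
  have := mxrankS XW; rewrite (mxrankMfree _ Xfree).
  by move: Xfree; rewrite /row_free => /eqP ->.
Qed.

Lemma irreducible_frame_ex (S : 'M[C]_n) : mx_stable P S -> S != 0 ->
  exists m (X : 'M[C]_(m, n)), irreducible_frame X /\ (X <= S)%MS.
Proof.
move=> stS S0.
pose Q k := `[< exists W : 'M[C]_n, [/\ mx_stable P W, W != 0, (W <= S)%MS & \rank W = k] >].
have Q0 : exists k, Q k by exists (\rank S); apply/asboolP; exists S.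
case: (ex_minnP Q0) => k /asboolP[W [stW W0 WS Wk]] kmin.
have kn : (\rank W <= n)%N by exact: rank_leq_row.
pose X := schmidt (row_base W).
have XW : (X :=: W)%MS.
  apply: eqmx_trans (eq_row_base W).
  by apply: eqmx_schmidt_free; exact: row_base_free.
exists (\rank W), X; split; last by rewrite XW.
split.
- by rewrite lt0n mxrank_eq0.
- by apply/unitarymxP; exact: schmidt_unitarymx.
- by move=> g; rewrite (eqmxMr _ XW) XW.
- move=> V stV VX; have [->|V0] := eqVneq V 0; [by left|right].
  have VW : (V <= W)%MS by rewrite -XW.
  have : Q (\rank V).
    by apply/asboolP; exists V; split=> //; exact: submx_trans WS.
  move=> /kmin; rewrite -Wk => rk.
  by rewrite XW -(mxrank_leqif_sup VW).2 eqn_leq (mxrankS VW) rk.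
Qed.

Lemma orthocomplement_stable (S : 'M[C]_n) : mx_stable P S -> mx_stable P (kermx (S^t*)).
Proof.
move=> stS g; apply/sub_kermxP; rewrite -mulmxA.
have /submxP[D DE] := stS g^-1%g.
have -> : P g *m S^t* = S^t* *m D^t*.
  by rewrite -trmxC_mul -DE trmxC_mul matrix_rep_adjoint// invgK.
by rewrite mulmxA mulmx_ker mul0mx.
Qed.

(** Complete reducibility in the form used later: nothing but 0 is orthogonal to all frames of the
    list. For a stable S of maximal rank detected by such a list, a non-zero orthocomplement would
    contain an irreducible frame X, and S + X would be detected by the longer list. *)
Lemma irreducible_frame_family : exists l : seq {m : nat & 'M[C]_(m, n)},
  {in l, forall X, irreducible_frame (tagged X)} /\
  forall p (Y : 'M[C]_(p, n)), {in l, forall X, Y *m (tagged X)^t* = 0} -> Y = 0.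
Proof.
pose T (S : 'M[C]_n) := mx_stable P S /\ exists l : seq {m : nat & 'M[C]_(m, n)},
  {in l, forall X, irreducible_frame (tagged X)} /\
  forall p (Y : 'M[C]_(p, n)), {in l, forall X, Y *m (tagged X)^t* = 0} -> Y *m S^t* = 0.
pose Q k := `[< exists2 S, T S & \rank S = k >].
have Q0 : exists k, Q k.
  exists 0%N; apply/asboolP; exists 0; last by rewrite mxrank0.
  split; first by move=> g; rewrite mul0mx sub0mx.
  by exists [::]; split=> // p Y _; rewrite trmx0 map_mx0 mulmx0.
have Qn k : Q k -> (k <= n)%N by move=> /asboolP[M _ <-]; exact: rank_leq_row.
case: (ex_maxnP Q0 Qn) => k /asboolP[S [stS [l [lirr lS]]] Sk] kmax.
exists l; split=> // p Y /lS YS.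
have [K0|K0] := eqVneq (kermx (S^t*)) 0.
  have : (Y <= kermx (S^t*))%MS by apply/sub_kermxP.
  by rewrite K0 submx0 => /eqP.
have [m [X [irX XK]]] := irreducible_frame_ex (orthocomplement_stable stS) K0.
exfalso; have [m0 XX stX _] := irX.
have XS : X *m S^t* = 0 by apply/sub_kermxP.
have SX : Q (\rank (S + X)%MS).
  apply/asboolP; exists (S + X)%MS => //; split.
    by move=> g; rewrite (addsmxMr _ _ _) addsmxS.
  exists (Tagged (fun m => 'M[C]_(m, n)) X :: l); split.
    by move=> Z; rewrite inE => /orP[/eqP ->//|/lirr].
  move=> q Z Zl; have ZX : Z *m X^t* = 0 by apply: (Zl (Tagged (fun m => 'M[C]_(m, n)) X)); rewrite inE eqxx.
  have ZS : Z *m S^t* = 0 by apply: lS => V Vl; apply: Zl; rewrite inE Vl orbT.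
  have /sub_addsmxP[[a b] /= ab] := submx_refl (S + X)%MS.
  by rewrite ab linearD/= map_mxD !trmxC_mul mulmxDr !mulmxA ZS ZX !mul0mx addr0.
have := kmax _ SX; rewrite leqNgt -Sk => /negP; apply.
rewrite ltn_neqAle mxrankS ?addsmxSl// andbT; apply/negP => /eqP rk.
have : ((S + X)%MS <= S)%MS.
  by rewrite -(mxrank_leqif_sup (addsmxSl S X)).2 rk.
move=> /(submx_trans (addsmxSr S X)) /submxP[D DE].
have : X *m X^t* = 0 by rewrite {2}DE trmxC_mul mulmxA XS mul0mx.
rewrite XX => /matrixP/(_ (Ordinal m0) (Ordinal m0)).
by rewrite !mxE eqxx => /eqP; rewrite oner_eq0.
Qed.

(** When Q intertwines P twisted by b with P, the twist of the subrepresentation on [X] is itself a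
    subrepresentation of P, namely the one on [X *m Q]. *)
Lemma irreducible_frame_conj m (X : 'M[C]_(m, n)) (Q : 'M[C]_n) (b : topAut G) :
  Q *m Q^t* = 1%:M -> (forall g, P ((b^-1)%g g) *m Q = Q *m P g) ->
  irreducible_frame X ->
  irreducible_frame (X *m Q) /\ forall g, sub_matrix (X *m Q) g = sub_matrix X ((b^-1)%g g).
Proof.
move=> QQ bQ [m0 XX stX irr].
have QQ' : Q^t* *m Q = 1%:M by exact: mulmx1C.
split; last first.
  move=> g; rewrite /sub_matrix -[X *m Q *m _]mulmxA -bQ trmxC_mul !mulmxA.
  by rewrite -[_ *m Q *m _]mulmxA QQ mulmx1.
split=> //.
- by rewrite trmxC_mul !mulmxA -[X *m Q *m _]mulmxA QQ mulmx1.
- by move=> g; rewrite -mulmxA -bQ mulmxA submxMr.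
- move=> W stW WXQ.
  have bQ' g : P g *m Q^t* = Q^t* *m P ((b^-1)%g g).
    by rewrite -[P ((b^-1)%g g)]mulmx1 -QQ !mulmxA -[Q^t* *m _ *m Q]mulmxA bQ mulmxA QQ' mul1mx.
  have [g|||XW] := irr (W *m Q^t*).
  + have := bQ' (b g); have /= -> := aut_funK b g => E.
    by rewrite -mulmxA -E mulmxA submxMr.
  + apply: submx_trans (submxMr _ WXQ) _.
    by rewrite -mulmxA QQ mulmx1.
  + move=> W0; left; rewrite -[W]mulmx1 -QQ' mulmxA W0 mul0mx//.
  + right; apply: submx_trans (submxMr Q XW) _.
    by rewrite -mulmxA QQ' mulmx1.
Qed.

(** A twist of the subrepresentation on [X] lives on the frame [X *m Q], which is not orthogonal to
    every member of the finite family. Its overlap with such a member is a non-zero intertwiner,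
    hence yields an equivalence, so the members bound the number of classes. Were the
    subrepresentation trivial, the rows of [X] would be fixed vectors. *)
Lemma matrix_finite_dual_orbit (Gamma : set (topAut G)) : (0 < n)%N ->
  (forall v : 'rV[C]_n, (forall g, v *m P g = v) -> v = 0) ->
  (forall b, Gamma b -> exists2 Q : 'M[C]_n, Q *m Q^t* = 1%:M &
    forall g, P ((b^-1)%g g) *m Q = Q *m P g) ->
  exists pi : unitaryRep R G,
    [/\ irreducible_rep pi, nontrivial_rep pi & finite_pred (dual_orbit Gamma pi)].
Proof.
move=> n0 nofix GQ.
have st1 : mx_stable P (1%:M : 'M[C]_n) by move=> g; exact: submx1.
have one0 : (1%:M : 'M[C]_n) != 0.
  apply/eqP => /matrixP/(_ (Ordinal n0) (Ordinal n0)).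
  by rewrite !mxE eqxx => /eqP; rewrite oner_eq0.
have [m [X [irX _]]] := irreducible_frame_ex st1 one0.
have [m0 XX stX _] := irX.
have rX := sub_matrix_rep XX stX.
exists (unitary_of_matrix rX); split.
- exact/unitary_of_matrix_irreducible/sub_matrix_irreducible.
- have [g gX] : exists g, sub_matrix X g != 1%:M.
    apply: contrapT => /forallNP H; have X0 : X = 0.
      apply/row_matrixP => i; rewrite row0; apply: nofix => g.
      rewrite -row_mul -sub_matrixE//.
      by have /negP := H g; rewrite negbK => /eqP ->; rewrite mul1mx.
    move: XX => /matrixP/(_ (Ordinal m0) (Ordinal m0)).
    by rewrite X0 mul0mx !mxE eqxx => /eqP; rewrite eq_sym oner_eq0.
  exact: unitary_of_matrix_nontrivial gX.
have [l [lirr lall]] := irreducible_frame_family.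
(* The value [fun=> True] only makes [F] total: every listed frame does carry a representation. *)
pose F (i : 'I_(size l)) : unitaryRep R G -> Prop :=
  let X := tnth (in_tuple l) i in
  if pselect (matrix_rep (sub_matrix (tagged X))) is left r
  then rep_class (unitary_of_matrix r) else fun=> True.
exists (size l), F => _ [b Gb ->].
have [Q QQ bQ] := GQ b Gb.
have [irY YE] := irreducible_frame_conj QQ bQ irX.
set Y := X *m Q in irY YE; have [_ YY stY _] := irY.
have rY := sub_matrix_rep YY stY.
have [V Vl YV] : exists2 V, V \in l & Y *m (tagged V)^t* != 0.
  apply: contrapT => H; have Y0 : Y = 0.
    by apply: lall => V Vl; apply: contrapT => /eqP YV; apply: H; exists V.
  move: YY => /matrixP/(_ (Ordinal m0) (Ordinal m0)).
  by rewrite Y0 mul0mx !mxE eqxx => /eqP; rewrite eq_sym oner_eq0.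
have iV : (index V l < size (in_tuple l))%N by rewrite index_mem.
exists (Ordinal iV); rewrite /F/= (tnth_nth V)/= nth_index//.
have irV := lirr V Vl; have [_ VV stV _] := irV.
case: pselect => [rV|]; last by case; exact: sub_matrix_rep.
(* The product of A with the adjoint of B is the orthogonal projection from one subspace to the
   other; stability of both makes it an intertwiner. *)
have inter m1 m2 (A : 'M[C]_(m1, n)) (B : 'M[C]_(m2, n)) :
    A *m A^t* = 1%:M -> mx_stable P A -> B *m B^t* = 1%:M -> mx_stable P B ->
    forall g, sub_matrix A g *m (A *m B^t*) = A *m B^t* *m sub_matrix B g.
  move=> AA stA BB stB g; rewrite mulmxA sub_matrixE// -!mulmxA; congr (_ *m _).
  have := congr1 (fun M => M^t*) (sub_matrixE g^-1%g BB stB).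
  rewrite (trmxC_mul (sub_matrix B _) B) (trmxC_mul B (P _)).
  rewrite (matrix_rep_adjoint (sub_matrix_rep BB stB)).
  by rewrite (matrix_rep_adjoint rP) !invgK.
have eq1 : rep_equiv (unitary_of_matrix rY) (unitary_of_matrix rV).
  apply: (@matrix_rep_schur _ _ _ _ rY rV (Y *m (tagged V)^t*)) => //.
  - exact: sub_matrix_irreducible.
  - exact: sub_matrix_irreducible.
  - exact: inter.
(* Equality of classes as predicates needs equivalences in both directions; this one comes from the
   adjoint overlap. *)
have eq2 : rep_equiv (unitary_of_matrix rV) (unitary_of_matrix rY).
  apply: (@matrix_rep_schur _ _ _ _ rV rY (tagged V *m Y^t*)) => //.
  - exact: sub_matrix_irreducible.
  - exact: sub_matrix_irreducible.
  - apply: contra YV => /eqP VY; rewrite -[Y]trmxCK -trmxC_mul VY.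
    by rewrite trmx0 map_mx0.
  - exact: inter.
have eq3 : rep_equiv (rep_twist b (unitary_of_matrix rX)) (unitary_of_matrix rY).
  exists (idfun : {linear cspace R m -> cspace R m}); split=> //.
    by move=> w; exists w.
  by move=> g v; rewrite /= /matrix_op YE.
have eq4 : rep_equiv (unitary_of_matrix rY) (rep_twist b (unitary_of_matrix rX)).
  exists (idfun : {linear cspace R m -> cspace R m}); split=> //.
    by move=> w; exists w.
  by move=> g v; rewrite /= /matrix_op YE.
apply/funext => tau; apply/propext; split=> H.
- exact: rep_equiv_trans eq3 (rep_equiv_trans eq1 H).
- exact: rep_equiv_trans eq2 (rep_equiv_trans eq4 H).
Qed.

End SubRep.

End MatrixRepTheory.

(** * Spectral theory of convolution operators *)

Section Convolution.
Variables (R : realType) (G : topGroupType).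
Hypothesis cG : compact [set: G].
Local Notation I := (@haar_mean R G).
Implicit Types u w : G -> R.

Definition fdot u w : R := I (fun x => u x * w x).

Lemma fdotC u w : fdot u w = fdot w u.
Proof. by congr (I _); apply/funext => x; rewrite mulrC. Qed.

Lemma fdot_sumr u (J : Type) (r : seq J) (c : J -> R) (f : J -> G -> R) :
  continuous u -> (forall j, continuous (f j)) ->
  fdot u (fun x => \sum_(j <- r) c j * f j x) = \sum_(j <- r) c j * fdot u (f j).
Proof.
move=> cu cf; rewrite /fdot.
transitivity (I (fun x => \sum_(j <- r) c j * (u x * f j x))).
  by congr (I _); apply/funext => x; rewrite mulr_sumr; apply: eq_bigr => j _; rewrite mulrCA.
rewrite (haar_mean_sum cG) => [|j]; last by apply: continuous_scale; exact: continuous_prod.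
by apply: eq_bigr => j _; rewrite (haar_meanZ cG)//; exact: continuous_prod.
Qed.

Lemma fdotBr u w z : continuous u -> continuous w -> continuous z ->
  fdot u (fun x => w x - z x) = fdot u w - fdot u z.
Proof.
move=> cu cw cz; rewrite -(haar_meanB cG); [|exact: continuous_prod..].
by congr (I _); apply/funext => x; rewrite mulrBr.
Qed.

Lemma fdotZr (c : R) u w : continuous u -> continuous w ->
  fdot u (fun x => c * w x) = c * fdot u w.
Proof.
move=> cu cw; rewrite -(haar_meanZ cG); last exact: continuous_prod.
by congr (I _); apply/funext => x; rewrite mulrCA.
Qed.

Lemma fdot_ge0 u : continuous u -> 0 <= fdot u u.
Proof.
move=> cu; apply: (haar_mean_ge0 cG); first exact: continuous_prod.
by move=> x; rewrite -expr2 sqr_ge0.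
Qed.

Lemma fdot_eq0 u : continuous u -> fdot u u = 0 -> forall x, u x = 0.
Proof.
move=> cu u0 x; apply: contrapT => /eqP ux.
have : 0 < fdot u u.
  apply: (haar_mean_gt0 cG (x0 := x)); first exact: continuous_prod.
    by move=> y; rewrite -expr2 sqr_ge0.
  by rewrite -expr2 lt_neqAle sqr_ge0 andbT eq_sym sqrf_eq0.
by rewrite u0 ltxx.
Qed.

Lemma fdot_sub2 u w (c : R) : continuous u -> continuous w ->
  fdot (fun x => u x - c * w x) (fun x => u x - c * w x) =
  fdot u u - 2 * c * fdot u w + c ^+ 2 * fdot w w.
Proof.
move=> cu cw; have cs : continuous (fun x => u x - c * w x).
  by apply: continuous_sub => //; exact: continuous_scale.
have ccw : continuous (fun x => c * w x) by exact: continuous_scale.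
rewrite fdotBr// fdotZr// !(fdotC (fun x => u x - c * w x)) !fdotBr// !fdotZr//.
by rewrite (fdotC w u); ring.
Qed.

Lemma fdot_CS u w : continuous u -> continuous w ->
  fdot u w ^+ 2 <= fdot u u * fdot w w.
Proof.
move=> cu cw; have := fdot_ge0 cw; rewrite le0r => /orP[/eqP w0|w0].
  have -> : fdot u w = 0.
    rewrite /fdot (_ : (fun x => u x * w x) = fun=> 0) ?(haar_mean_cst cG)//.
    by apply/funext => x; rewrite (fdot_eq0 cw w0) mulr0.
  by rewrite w0 mulr0 expr0n.
have cs : continuous (fun x => u x - (fdot u w / fdot w w) * w x).
  by apply: continuous_sub => //; exact: continuous_scale.
have := fdot_ge0 cs; rewrite fdot_sub2//.
set a := fdot u w; set b := fdot w w; set c := fdot u u.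
have -> : c - 2 * (a / b) * a + (a / b) ^+ 2 * b = (c * b - a ^+ 2) / b.
  by field; rewrite gt_eqF.
by rewrite pmulr_lge0 ?invr_gt0// subr_ge0.
Qed.

Variable phi : G -> R.
Hypothesis cphi : continuous phi.
Hypothesis phiV : forall x, phi x^-1%g = phi x.

(** The kernel depends on x^-1 y alone, so the operator T commutes with left translations and with
    the automorphisms preserving phi; it is symmetric because phi is even. *)
Definition conv u : G -> R := fun x => I (fun y => phi (x^-1 * y)%g * u y).

Lemma continuous_kernel : continuous (fun z : G * G => phi (z.1^-1 * z.2)%g).
Proof.
apply: (continuous_compose _ cphi); apply: continuous_mul.
  by apply: continuous_inv => z; exact: cvg_fst.
by move=> z; exact: cvg_snd.
Qed.

Lemma continuous_kernel1 x : continuous (fun y => phi (x^-1 * y)%g).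
Proof. exact: continuous_compose (@continuous_lmul G _) cphi. Qed.

Lemma continuous_conv u : continuous u -> continuous (conv u).
Proof.
move=> cu; apply: (haar_mean_param cG (F := fun z => phi (z.1^-1 * z.2)%g * u z.2)).
apply: continuous_prod; first exact: continuous_kernel.
by apply: (continuous_compose _ cu) => z; exact: cvg_snd.
Qed.

Lemma convE u x : conv u x = fdot (fun y => phi (x^-1 * y)%g) u.
Proof. by []. Qed.

Lemma convB u w x : continuous u -> continuous w ->
  conv (fun y => u y - w y) x = conv u x - conv w x.
Proof. by move=> cu cw; rewrite !convE fdotBr//; exact: continuous_kernel1. Qed.

Lemma convZ (c : R) u x : continuous u -> conv (fun y => c * u y) x = c * conv u x.
Proof. by move=> cu; rewrite !convE fdotZr//; exact: continuous_kernel1. Qed.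

Lemma conv_sum (J : Type) (r : seq J) (c : J -> R) (f : J -> G -> R) x :
  (forall j, continuous (f j)) ->
  conv (fun y => \sum_(j <- r) c j * f j y) x = \sum_(j <- r) c j * conv (f j) x.
Proof. by move=> cf; rewrite convE fdot_sumr//; exact: continuous_kernel1. Qed.

Lemma conv_sym u w : continuous u -> continuous w -> fdot (conv u) w = fdot u (conv w).
Proof.
move=> cu cw; rewrite /fdot /conv.
have c1 z : continuous (fun y => phi (z^-1 * y)%g * u y).
  by apply: continuous_prod => //; exact: continuous_kernel1.
transitivity (I (fun x => I (fun y => phi (x^-1 * y)%g * u y * w x))).
  by congr (I _); apply/funext => x; rewrite mulrC -(haar_meanZ cG)//;
    congr (I _); apply/funext => y; rewrite mulrC.
rewrite (haar_mean_Fubini cG (F := fun z => phi (z.1^-1 * z.2)%g * u z.2 * w z.1)).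
  congr (I _); apply/funext => y /=; rewrite -(haar_meanZ cG); last first.
    by apply: continuous_prod => //; exact: continuous_kernel1.
  congr (I _); apply/funext => x.
  by rewrite -phiV invgM invgK; ring.
apply: continuous_prod; first apply: continuous_prod; first exact: continuous_kernel.
- by apply: (continuous_compose _ cu) => z; exact: cvg_snd.
- by apply: (continuous_compose _ cw) => z; exact: cvg_fst.
Qed.

Lemma fdot_kernel x : fdot (fun y => phi (x^-1 * y)%g) (fun y => phi (x^-1 * y)%g) = fdot phi phi.
Proof.
rewrite /fdot -[RHS](haar_meanMl cG x^-1%g)//; exact: continuous_prod.
Qed.

(** T sends L2-bounded families to uniformly bounded ones, which is what lets uniform limits of
    continuous functions replace an L2 completion. *)
Lemma conv_le u x : continuous u -> conv u x ^+ 2 <= fdot phi phi * fdot u u.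
Proof.
move=> cu; rewrite convE -(fdot_kernel x); apply: fdot_CS => //.
exact: continuous_kernel1.
Qed.

Lemma conv_sup u (B c : R) x : (forall y, `|phi y| <= B) -> continuous u ->
  (forall y, `|u y| <= c) -> `|conv u x| <= B * c.
Proof.
move=> phiB cu uc.
have cf : continuous (fun y => phi (x^-1 * y)%g * u y).
  by apply: continuous_prod => //; exact: continuous_kernel1.
have H y : `|phi (x^-1 * y)%g * u y - 0| <= B * c by rewrite subr0 normrM ler_pM.
by have := haar_mean_dist cG cf (@continuous_const _ _ 0) H; rewrite (haar_mean_cst cG) subr0.
Qed.

(** The squared operator norm of T for the L2 norm on continuous functions. *)
Definition conv_max : R :=
  sup [set fdot (conv u) (conv u) | u in [set u | continuous u /\ fdot u u <= 1]].

Lemma conv_max_has_sup :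
  has_sup [set fdot (conv u) (conv u) | u in [set u | continuous u /\ fdot u u <= 1]].
Proof.
split.
  exists (fdot (conv (fun=> 0)) (conv (fun=> 0))), (fun=> 0) => //; split.
    exact: continuous_const.
  by rewrite /fdot mulr0 (haar_mean_cst cG).
exists (fdot phi phi) => _ [u [cu u1] <-].
have cc := continuous_conv cu.
apply: (haar_mean_le cG); first exact: continuous_prod.
move=> x; rewrite -expr2; apply: le_trans (conv_le x cu) _.
by rewrite ler_piMr// fdot_ge0.
Qed.

Lemma fdotZZ (c : R) u : continuous u ->
  fdot (fun x => c * u x) (fun x => c * u x) = c ^+ 2 * fdot u u.
Proof.
move=> cu; rewrite fdotZr//; last exact: continuous_scale.
by rewrite fdotC fdotZr// mulrA expr2.
Qed.

Lemma conv_max_ge u : continuous u -> fdot (conv u) (conv u) <= conv_max * fdot u u.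
Proof.
move=> cu; have cc := continuous_conv cu.
have := fdot_ge0 cu; rewrite le0r => /orP[/eqP u0|u0].
  rewrite u0 mulr0; apply: (haar_mean_le cG); first exact: continuous_prod.
  by move=> x; rewrite -expr2; apply: le_trans (conv_le x cu) _; rewrite u0 mulr0.
rewrite -ler_pdivrMr//.
pose c := (Num.sqrt (fdot u u))^-1.
have c2 : c ^+ 2 = (fdot u u)^-1 by rewrite exprVn sqr_sqrtr// ltW.
have -> : fdot (conv u) (conv u) / fdot u u =
    fdot (conv (fun x => c * u x)) (conv (fun x => c * u x)).
  rewrite (_ : conv (fun x => c * u x) = fun x => c * conv u x).
    by rewrite fdotZZ// c2 mulrC.
  by apply/funext => x; rewrite convZ.
apply: (ub_le_sup conv_max_has_sup.2); exists (fun x => c * u x) => //; split.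
  exact: continuous_scale.
by rewrite fdotZZ// c2 mulVf ?gt_eqF.
Qed.

Lemma conv_max_gt0 u x : continuous u -> conv u x != 0 -> 0 < conv_max.
Proof.
move=> cu ux; have cc := continuous_conv cu.
have c0 : 0 < fdot (conv u) (conv u).
  have := fdot_ge0 cc; rewrite le0r => /orP[/eqP/(fdot_eq0 cc)/(_ x)/eqP|//].
  by rewrite (negPf ux).
have := lt_le_trans c0 (conv_max_ge cu).
by have := fdot_ge0 cu; have [//|] := ltP 0 conv_max; nra.
Qed.

Definition eigenfunction u := continuous u /\ forall x, conv (conv u) x = conv_max * u x.

(* The images T u_n of a maximizing sequence converge uniformly along an
   ultrafilter; the limit w satisfies T T w = M w because
   |T T u_n - M u_n|_2^2 <= M (M - |T u_n|_2^2). *)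
Lemma eigenfunction_ex : 0 < conv_max -> exists2 w, eigenfunction w & fdot w w != 0.
Proof.
move=> M0; set M := conv_max in M0 *.
have /choice[u uP] n : exists u, [/\ continuous u, fdot u u <= 1 &
    M - n.+1%:R^-1 < fdot (conv u) (conv u)].
  have n0 : 0 < n.+1%:R^-1 :> R by rewrite invr_gt0.
  by have [_ [u [cu u1] <-] lt] := sup_adherent n0 conv_max_has_sup; exists u.
have cu n : continuous (u n) by have [] := uP n.
have cTu n : continuous (conv (u n)) by exact: continuous_conv.
have [Om UOm sOm] := nat_ultrafilter.
have N0 : 0 <= fdot phi phi by exact: fdot_ge0.
have [w [cw wP]] : exists w : G -> R, continuous w /\ forall e : R, 0 < e ->
    Om [set n | forall x, `|conv (u n) x - w x| <= e].
  have sq1 (a b : R) : 0 <= b -> a ^+ 2 <= b ^+ 2 -> `|a| <= b.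
    by move=> b0 ab; rewrite -(ler_pXn2r (ltn0Sn 1)) ?nnegrE// real_normK ?num_real.
  apply: (@ultra_uniform_limit R G cG Om _ (Num.sqrt (fdot phi phi))) => // [n x|x e e0].
    apply: sq1; rewrite ?sqrtr_ge0// sqr_sqrtr//.
    apply: le_trans (conv_le x (cu n)) _; rewrite ler_piMr//.
    by have [] := uP n.
  have := compact_unif_fst x cG continuous_kernel e0.
  apply: (@filterS _ _ (nbhs_filter x)) => y /= ye n.
  apply: sq1; first exact: ltW.
  have k1 := continuous_kernel1.
  have -> : conv (u n) y - conv (u n) x =
      fdot (u n) (fun z => phi (y^-1 * z)%g - phi (x^-1 * z)%g).
    by rewrite fdotBr// !convE !(fdotC (u n)).
  apply: le_trans (fdot_CS _ _) _ => //; first exact: continuous_sub.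
  apply: (@le_trans _ _ (1 * e ^+ 2)); last by rewrite mul1r.
  apply: ler_pM; [exact: fdot_ge0|apply: fdot_ge0; exact: continuous_sub|by have [] := uP n|].
  apply: (haar_mean_le cG); first by apply: continuous_prod; exact: continuous_sub.
  move=> z; rewrite -expr2 -[X in X <= _]real_normK ?num_real//.
  by rewrite ler_pXn2r ?nnegrE ?(ltW e0)// ltW.
have near_max (e : R) : 0 < e -> Om [set n | n.+1%:R^-1 < e].
  move=> e0; apply: sOm; exists (Num.truncn e^-1) => // n /= en.
  rewrite -[ltRHS]invrK ltf_pV2 ?posrE ?invr_gt0// (lt_le_trans (truncnS_gt _))//.
  by rewrite ler_nat ltnS.
have cTw := continuous_conv cw; have cTTw := continuous_conv cTw.
have [B phiB] := compact_bounded cG cphi.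
have B0 : 0 <= B by apply: le_trans (phiB 1%g).
exists w.
  split=> // x; apply/eqP; rewrite -subr_eq0 -normr_le0.
  (* In the decomposition [E1], the terms T T z, T r and M z are bounded by eta times B^2, 1 and M
     respectively. *)
  pose D := B * B + 1 + M; have D0 : 0 < D by rewrite ltr_wpDl// addr_ge0 ?mulr_ge0.
  apply/ler_addgt0Pr => eps eps0; rewrite add0r.
  have [eta [eta0 etaE]] : exists eta : R, 0 < eta /\ D * eta = eps.
    by exists (eps / D); rewrite divr_gt0//; split=> //; rewrite mulrC divfK// gt_eqF.
  have [e [e0 eeta eN]] : exists e : R, [/\ 0 < e, e <= eta & fdot phi phi * (M * e) <= eta ^+ 2].
    (* With |r|_2^2 <= M e, the second bound makes |T r| <= eta by [conv_le]; the added 1 keeps the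
       divisor positive. *)
    exists (Num.min eta (eta ^+ 2 / (fdot phi phi * M + 1))).
    have c0 : 0 < fdot phi phi * M + 1 by rewrite ltr_wpDl// mulr_ge0// ltW.
    split; first by rewrite lt_min eta0 divr_gt0// exprn_gt0.
      by rewrite ge_min lexx.
    set e := Num.min _ _; have : e <= eta ^+ 2 / (fdot phi phi * M + 1).
      by rewrite ge_min lexx orbT.
    rewrite ler_pdivlMr// => le1; apply: le_trans le1.
    have e0 : 0 <= e by rewrite le_min (ltW eta0) divr_ge0 ?exprn_ge0 ?ltW.
    by rewrite mulrA mulrC ler_wpM2l// lerDl.
  have [n [/= nw nM]] := filter_ex (filterI (wP _ e0) (near_max _ e0)).
  have [_ un1 unM] := uP n.
  have cTTu := continuous_conv (cTu n).
  pose r y := conv (conv (u n)) y - M * u n y.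
  have cr : continuous r by apply: continuous_sub => //; exact: continuous_scale.
  have rr : fdot r r <= M * e.
    rewrite fdot_sub2// (conv_sym (cTu n) (cu n)).
    have := conv_max_ge (cTu n); rewrite -/M => H1.
    set a := fdot (conv (u n)) (conv (u n)) in H1 unM *.
    set b := fdot (u n) (u n) in un1 *.
    set c := fdot (conv (conv (u n))) _ in H1 *.
    have aM : M - a <= e by move: nM unM; move: (n.+1%:R^-1) => t; lra.
    have M2 : M ^+ 2 * b <= M ^+ 2 by rewrite ler_piMr// exprn_ge0// ltW.
    have : M * (M - a) <= M * e by rewrite ler_wpM2l// ltW.
    by rewrite mulrBr; rewrite expr2 in M2 *; lra.
  have Tr : `|conv r x| <= eta.
    rewrite -(ler_pXn2r (ltn0Sn 1)) ?nnegrE ?(ltW eta0)// real_normK ?num_real//.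
    apply: le_trans (conv_le x cr) _; apply: le_trans eN.
    by rewrite ler_wpM2l.
  pose z y := w y - conv (u n) y.
  have cz : continuous z by exact: continuous_sub.
  have zle y : `|z y| <= eta by rewrite distrC; exact: le_trans (nw y) eeta.
  have TTz : `|conv (conv z) x| <= B * (B * eta).
    apply: conv_sup => //; first exact: continuous_conv.
    by move=> y; apply: conv_sup.
  (* Substitute w = z + T u_n and T T T u_n = T r + M T u_n. *)
  have E1 : conv (conv w) x - M * w x = conv (conv z) x + conv r x - M * z x.
    rewrite /r convB//; last exact: continuous_scale.
    rewrite convZ//.
    have -> : conv z = fun y => conv w y - conv (conv (u n)) y.
      by apply/funext => y; rewrite convB.
    by rewrite convB// /z; ring.
  rewrite E1 -etaE /D.
  apply: (le_trans (ler_normB _ _)); apply: (le_trans (lerD (ler_normD _ _) (lexx _))).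
  rewrite normrM (gtr0_norm M0).
  have Mz : M * `|z x| <= M * eta by rewrite ler_wpM2l ?zle// ltW.
  by move: TTz Tr Mz; lra.
apply/eqP => w0; have wz := fdot_eq0 cw w0.
(* If w = 0, then |T u_n|_2^2 <= e^2 <= e <= M / 2, whereas it exceeds M - e >= M / 2. *)
pose e : R := Num.min 1 (M / 2).
have e0 : 0 < e by rewrite lt_min ltr01 divr_gt0.
have e1 : e <= 1 by rewrite ge_min lexx.
have eM : e <= M / 2 by rewrite ge_min lexx orbT.
have [n [/= nw nM]] := filter_ex (filterI (wP _ e0) (near_max _ e0)).
have [_ _] := uP n.
have : fdot (conv (u n)) (conv (u n)) <= e.
  apply: (haar_mean_le cG); first exact: continuous_prod.
  move=> x; have := nw x; rewrite wz subr0 => le1.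
  rewrite -expr2 -[leLHS]real_normK ?num_real//.
  apply: (@le_trans _ _ (e ^+ 2)); first by rewrite ler_pXn2r ?nnegrE ?(ltW e0).
  by rewrite expr2 ler_piMr// ltW.
by move: nM; move: (n.+1%:R^-1) => t; lra.
Qed.

Definition orthonormal_eigen n (e : 'I_n -> G -> R) :=
  (forall i, eigenfunction (e i)) /\ forall i j, fdot (e i) (e j) = (i == j)%:R.

Lemma fdot_suml n (e : 'I_n -> G -> R) (c : 'I_n -> R) u :
  continuous u -> (forall i, continuous (e i)) ->
  fdot (fun x => \sum_i c i * e i x) u = \sum_i c i * fdot (e i) u.
Proof.
by move=> cu ce; rewrite fdotC fdot_sumr//; apply: eq_bigr => i _; rewrite fdotC.
Qed.

Lemma continuous_comb n (e : 'I_n -> G -> R) (c : 'I_n -> R) :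
  (forall i, continuous (e i)) -> continuous (fun x => \sum_i c i * e i x).
Proof. by move=> ce; apply: continuous_sum => i; exact: continuous_scale. Qed.

Lemma orthonormal_coef n (e : 'I_n -> G -> R) (c : 'I_n -> R) j :
  orthonormal_eigen e -> fdot (fun x => \sum_i c i * e i x) (e j) = c j.
Proof.
move=> [ev eo]; rewrite fdot_suml//; [|by have [] := ev j|by move=> i; have [] := ev i].
rewrite (bigD1 j)//= eo eqxx mulr1 big1 ?addr0// => i ij.
by rewrite eo (negPf ij) mulr0.
Qed.

Lemma bessel n (e : 'I_n -> G -> R) f : orthonormal_eigen e -> continuous f ->
  \sum_i fdot f (e i) ^+ 2 <= fdot f f.
Proof.
move=> oe cf; have [ev eo] := oe.
have ce i : continuous (e i) by have [] := ev i.
pose c i := fdot f (e i); pose s x := \sum_i c i * e i x.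
have cs : continuous s by exact: continuous_comb.
have cfs : continuous (fun x => f x - 1 * s x).
  by apply: continuous_sub => //; exact: continuous_scale.
have := fdot_ge0 cfs; rewrite fdot_sub2//.
have -> : fdot f s = \sum_i c i ^+ 2.
  by rewrite fdot_sumr//; apply: eq_bigr => i _; rewrite expr2.
have -> : fdot s s = \sum_i c i ^+ 2.
  rewrite {1}/s fdot_suml//; apply: eq_bigr => i _.
  by rewrite fdotC orthonormal_coef// expr2.
by rewrite /c; lra.
Qed.

(** Bessel's inequality for T k_x, with k_x the kernel at x: its coefficient along e_i is (T T
    e_i)(x) = M e_i(x), so the sum of M^2 e_i(x)^2 is at most M |phi|_2^2. Taking the mean over x
    gives n M^2 <= M |phi|_2^2. *)
Lemma orthonormal_eigen_bound n (e : 'I_n -> G -> R) : 0 < conv_max ->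
  orthonormal_eigen e -> n%:R * conv_max <= fdot phi phi.
Proof.
move=> M0 oe; have [ev eo] := oe.
have ce i : continuous (e i) by have [] := ev i.
set M := conv_max in M0 *.
have H x : \sum_i M ^+ 2 * (e i x * e i x) <= M * fdot phi phi.
  have k1 := @continuous_kernel1 x.
  have ck := continuous_conv k1.
  apply: (@le_trans _ _ (\sum_i fdot (conv (fun y => phi (x^-1 * y)%g)) (e i) ^+ 2)).
    apply: ler_sum => i _; rewrite conv_sym// -convE.
    have cce : continuous (conv (e i)) by exact: continuous_conv.
    by have [_ ->] := ev i; rewrite -/M exprMn expr2.
  apply: le_trans (bessel oe ck) _.
  by apply: le_trans (conv_max_ge k1) _; rewrite fdot_kernel.
have : I (fun x => \sum_i M ^+ 2 * (e i x * e i x)) <= M * fdot phi phi.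
  apply: (haar_mean_le cG) => //; apply: continuous_sum => i.
  by apply: continuous_scale; exact: continuous_prod.
rewrite (haar_mean_sum cG) => [|i]; last by apply: continuous_scale; exact: continuous_prod.
rewrite (eq_bigr (fun=> M ^+ 2)) => [|i _]; last first.
  rewrite (haar_meanZ cG); last exact: continuous_prod.
  by have := eo i i; rewrite /fdot eqxx => ->; rewrite mulr1.
rewrite sumr_const card_ord -[_ *+ n]mulr_natr expr2 -mulrA ler_pM2l//.
by rewrite mulrC.
Qed.

Lemma eigenfunction_comb n (e : 'I_n -> G -> R) (c : 'I_n -> R) :
  (forall i, eigenfunction (e i)) -> eigenfunction (fun x => \sum_i c i * e i x).
Proof.
move=> ev; have ce i : continuous (e i) by have [] := ev i.
split; first exact: continuous_comb.
move=> x; rewrite (_ : conv (fun y => \sum_i c i * e i y) = fun y => \sum_i c i * conv (e i) y); last first.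
  by apply/funext => y; rewrite conv_sum.
rewrite conv_sum => [|i]; last exact: continuous_conv.
rewrite mulr_sumr; apply: eq_bigr => i _.
by have [_ ->] := ev i; rewrite mulrCA.
Qed.

Lemma eigenfunctionB u w : eigenfunction u -> eigenfunction w ->
  eigenfunction (fun x => u x - w x).
Proof.
move=> [cu uE] [cw wE]; split; first exact: continuous_sub.
move=> x; rewrite (_ : conv (fun y => u y - w y) = fun y => conv u y - conv w y); last first.
  by apply/funext => y; rewrite convB.
by rewrite convB ?uE ?wE ?mulrBr//; exact: continuous_conv.
Qed.

Lemma eigenfunctionZ (c : R) u : eigenfunction u -> eigenfunction (fun x => c * u x).
Proof.
move=> [cu uE]; split; first exact: continuous_scale.
move=> x; rewrite (_ : conv (fun y => c * u y) = fun y => c * conv u y); last first.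
  by apply/funext => y; rewrite convZ.
by rewrite convZ ?uE; [rewrite mulrCA|exact: continuous_conv].
Qed.

(** The bound on orthonormal families provides a largest one. An eigenfunction outside its span
    would, after removing its projection and normalizing, extend it. *)
Lemma eigenbasis_ex : 0 < conv_max -> exists n (e : 'I_n -> G -> R),
  [/\ (0 < n)%N, orthonormal_eigen e & forall u, eigenfunction u ->
    forall x, u x = \sum_i fdot u (e i) * e i x].
Proof.
move=> M0; pose Q k := `[< exists e : 'I_k -> G -> R, orthonormal_eigen e >].
have Q0 : exists k, Q k.
  by exists 0%N; apply/asboolP; exists (fun=> fun=> 0); split=> -[].
have Qn k : Q k -> (k <= Num.truncn (fdot phi phi / conv_max))%N.
  move=> /asboolP[e /(orthonormal_eigen_bound M0)]; rewrite -ler_pdivlMr//.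
  by rewrite truncn_ge_nat// divr_ge0 ?fdot_ge0 ?ltW.
case: (ex_maxnP Q0 Qn) => n /asboolP[e oe] nmax.
have [ev eo] := oe; have ce i : continuous (e i) by have [] := ev i.
have span u : eigenfunction u -> forall x, u x = \sum_i fdot u (e i) * e i x.
  move=> eu; have [cu _] := eu.
  pose r x := u x - \sum_i fdot u (e i) * e i x.
  have er : eigenfunction r by apply: eigenfunctionB => //; exact: eigenfunction_comb.
  have [cr _] := er; have ccomb := continuous_comb (c := fun i => fdot u (e i)) ce.
  have re i : fdot r (e i) = 0.
    by rewrite fdotC fdotBr// !(fdotC (e i)) orthonormal_coef// subrr.
  suff r0 : fdot r r = 0.
    by move=> x; apply/eqP; rewrite -subr_eq0; apply/eqP; exact: (fdot_eq0 cr r0).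
  apply: contrapT => /eqP r0; pose c := (Num.sqrt (fdot r r))^-1.
  have c2 : c ^+ 2 * fdot r r = 1 by rewrite exprVn sqr_sqrtr ?fdot_ge0// mulVf.
  pose r' x := c * r x; have er' : eigenfunction r' by exact: eigenfunctionZ.
  have [cr' _] := er'.
  have r'e i : fdot r' (e i) = 0 by rewrite fdotC fdotZr// fdotC re mulr0.
  pose e' (i : 'I_n.+1) := if unlift ord_max i is Some j then e j else r'.
  have : Q n.+1.
    apply/asboolP; exists e'; split=> [i|i j].
      by rewrite /e'; case: unliftP.
    rewrite /e'; case: unliftP => [i' ->|->]; case: unliftP => [j' ->|->].
    - by rewrite eo (inj_eq (@lift_inj _ ord_max)).
    - by rewrite fdotC r'e eq_sym (negPf (neq_lift _ _)).
    - by rewrite r'e (negPf (neq_lift _ _)).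
    - by rewrite eqxx /r' fdotZZ.
  by move=> /nmax; rewrite ltnn.
exists n, e; split=> //.
have [w ew w0] := eigenfunction_ex M0.
case: n e oe nmax ev eo ce span => // e oe nmax ev eo ce span.
exfalso; move/eqP: w0; apply; rewrite /fdot.
rewrite (_ : (fun x => w x * w x) = fun=> 0) ?(haar_mean_cst cG)//.
by apply/funext => x; rewrite (span w ew) big_ord0 mul0r.
Qed.

Lemma eigenfunction_translate u g : eigenfunction u -> eigenfunction (fun x => u (g^-1 * x)%g).
Proof.
have conv_tr f : continuous f -> conv (fun x => f (g^-1 * x)%g) = fun x => conv f (g^-1 * x)%g.
  move=> cf; apply/funext => x; rewrite /conv.
  have c1 : continuous (fun y => phi ((g^-1 * x)^-1 * y)%g * f y).
    by apply: continuous_prod => //; exact: continuous_kernel1.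
  rewrite -[RHS](haar_meanMl cG g^-1%g c1).
  by congr (I _); apply/funext => y; rewrite invgM invgK !mulgA mulgK.
move=> [cu uE]; split; first exact: continuous_compose (@continuous_lmul G _) cu.
by move=> x; rewrite conv_tr// conv_tr ?uE//; exact: continuous_conv.
Qed.

Lemma eigenfunction_aut u (b : topAut G) : (forall x, phi (b x) = phi x) ->
  eigenfunction u -> eigenfunction (fun x => u (b x)).
Proof.
move=> phib.
have conv_aut f : continuous f -> conv (fun x => f (b x)) = fun x => conv f (b x).
  move=> cf; apply/funext => x; rewrite /conv.
  have c1 : continuous (fun y => phi ((b x)^-1 * y)%g * f y).
    by apply: continuous_prod => //; exact: continuous_kernel1.
  rewrite -[RHS](haar_mean_aut cG b c1).
  by congr (I _); apply/funext => y; rewrite -phib aut_funM aut_funV.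
move=> [cu uE]; split; first exact: continuous_compose (@aut_fun_continuous _ b) cu.
by move=> x; rewrite conv_aut// conv_aut ?uE//; exact: continuous_conv.
Qed.

(** T kills constants because phi has mean zero, whereas the eigenvalue is positive. *)
Lemma eigenfunction_const (c : R) : I phi = 0 -> 0 < conv_max -> eigenfunction (fun=> c) -> c = 0.
Proof.
move=> I0 M0 [_ /(_ 1%g)].
have conv0 : conv (fun=> c) = fun=> 0.
  apply/funext => x; rewrite /conv.
  rewrite (_ : (fun y => _) = fun y => c * phi (x^-1 * y)%g); last first.
    by apply/funext => y; rewrite mulrC.
  rewrite (haar_meanZ cG); last exact: continuous_kernel1.
  by rewrite (haar_meanMl cG)// I0 mulr0.
have -> : conv (conv (fun=> c)) 1%g = 0.
  rewrite conv0 /conv (_ : (fun y => _) = fun=> 0) ?(haar_mean_cst cG)//.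
  by apply/funext => y; rewrite mulr0.
by move/esym/eqP; rewrite mulf_eq0 (gt_eqF M0)/= => /eqP.
Qed.

End Convolution.

Section RealMatrixComplexification.
Variables (R : realType) (n : nat).
Local Notation C := R[i].
Local Open Scope sesquilinear_scope.
Implicit Types (v : 'rV[C]_n) (M : 'M[R]_n).

Definition complex_mx M : 'M[C]_n := map_mx (real_complex R) M.

Lemma complex_mxM M N : complex_mx (M *m N) = complex_mx M *m complex_mx N.
Proof. exact: map_mxM. Qed.

Lemma complex_mx_orthogonal M : M *m M^T = 1%:M ->
  complex_mx M *m (complex_mx M)^t* = 1%:M.
Proof.
move=> MM; have -> : (complex_mx M)^t* = complex_mx M^T.
  by apply/matrixP => i j; rewrite !mxE; exact: conjc_real.
by rewrite -complex_mxM MM /complex_mx map_mx1.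
Qed.

Lemma Re_mul_complex_mx v M :
  map_mx (@complex.Re R) (v *m complex_mx M) = map_mx (@complex.Re R) v *m M.
Proof.
apply/rowP => j; rewrite !mxE (big_morph (@complex.Re R) (id1 := 0) (op1 := +%R))//.
  by apply: eq_bigr => i _; rewrite !mxE; case: (v 0 i) => a b /=; rewrite mulr0 subr0.
by move=> [a b] [c d].
Qed.

Lemma Im_mul_complex_mx v M :
  map_mx (@complex.Im R) (v *m complex_mx M) = map_mx (@complex.Im R) v *m M.
Proof.
apply/rowP => j; rewrite !mxE (big_morph (@complex.Im R) (id1 := 0) (op1 := +%R))//.
  by apply: eq_bigr => i _; rewrite !mxE; case: (v 0 i) => a b /=; rewrite mulr0 add0r mulrC.
by move=> [a b] [c d].
Qed.

Lemma nrm2_Re_Im v : nrm2 v =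
  \sum_j (map_mx (@complex.Re R) v 0 j ^+ 2 + map_mx (@complex.Im R) v 0 j ^+ 2).
Proof. by apply: eq_bigr => j _; rewrite !mxE. Qed.

End RealMatrixComplexification.

(** * The eigenspace as a matrix representation *)

Section EigenMatrix.
Variables (R : realType) (G : topGroupType).
Hypothesis cG : compact [set: G].
Variable phi : G -> R.
Hypothesis cphi : continuous phi.
Local Notation I := (@haar_mean R G).
Local Notation C := R[i].

(** Composition with such a map is an isometry of the eigenspace; translations and automorphisms
    preserving phi are treated together. *)
Definition eigen_map (t : G -> G) :=
  [/\ continuous t, forall f : G -> R, continuous f -> I (fun x => f (t x)) = I f &
      forall u, eigenfunction phi u -> eigenfunction phi (fun x => u (t x))].

Lemma eigen_map_lmul g : eigen_map (fun x => (g^-1 * x)%g).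
Proof.
split=> [|f cf|u]; first exact: continuous_lmul.
  exact: (haar_meanMl cG).
exact: eigenfunction_translate.
Qed.

Lemma eigen_map_aut (b : topAut G) : (forall x, phi (b x) = phi x) -> eigen_map b.
Proof.
move=> phib; split=> [|f cf|u]; first exact: aut_fun_continuous.
  exact: (haar_mean_aut cG).
exact: eigenfunction_aut.
Qed.

Variables (n : nat) (e : 'I_n -> G -> R).
Hypothesis oe : orthonormal_eigen phi e.
Hypothesis span : forall u, eigenfunction phi u ->
  forall x, u x = \sum_i fdot u (e i) * e i x.

Let ce i : continuous (e i). Proof. by have [/(_ i)[]] := oe. Qed.

Definition eigen_mx (t : G -> G) : 'M[R]_n :=
  \matrix_(i, j) fdot (fun x => e i (t x)) (e j).

Lemma eigen_mxE t i x : eigen_map t -> e i (t x) = \sum_j eigen_mx t i j * e j x.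
Proof.
move=> [_ _ et]; have [ev _] := oe.
by rewrite (span (et _ (ev i)))/=; apply: eq_bigr => j _; rewrite mxE.
Qed.

Lemma eigen_mxM s t : eigen_map s -> eigen_map t ->
  eigen_mx (fun x => s (t x)) = eigen_mx s *m eigen_mx t.
Proof.
move=> es [ct _ _]; apply/matrixP => i k; rewrite !mxE.
rewrite (_ : (fun x => e i (s (t x))) = fun x => \sum_j eigen_mx s i j * e j (t x)); last first.
  by apply/funext => x; rewrite eigen_mxE.
rewrite (fdot_suml cG)//; first by apply: eq_bigr => j _; rewrite !mxE.
by move=> j; exact: continuous_compose ct (@ce j).
Qed.

Lemma eigen_mx_orthogonal t : eigen_map t -> eigen_mx t *m (eigen_mx t)^T = 1%:M.
Proof.
move=> et; have [ct It _] := et; have [ev eo] := oe.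
apply/matrixP => i j; rewrite !mxE -eo /fdot -[RHS]It; last exact: continuous_prod.
transitivity (fdot (fun x => e i (t x)) (fun x => \sum_k eigen_mx t j k * e k x)).
  rewrite (fdot_sumr cG)//; last exact: continuous_compose ct (@ce i).
  by apply: eq_bigr => k _; rewrite !mxE mulrC.
by congr (I _); apply/funext => x; rewrite -eigen_mxE.
Qed.

Lemma eigen_mx1 : eigen_mx (fun x => x) = 1%:M.
Proof. by have [_ eo] := oe; apply/matrixP => i j; rewrite !mxE -eo. Qed.

Definition translate_mx (g : G) := eigen_mx (fun x => (g^-1 * x)%g).

Lemma continuous_translate_mx i j : continuous (fun g => translate_mx g i j).
Proof.
have E g : translate_mx g i j = I (fun x => e i (g^-1 * x)%g * e j x) by rewrite mxE.
under eq_fun do rewrite E.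
apply: (haar_mean_param cG (F := fun z => e i (z.1^-1 * z.2)%g * e j z.2)).
apply: continuous_prod; last first.
  by apply: (continuous_compose _ (@ce j)) => z; exact: cvg_snd.
exact: continuous_kernel.
Qed.

Lemma translate_mxM g h : translate_mx (g * h)%g = translate_mx h *m translate_mx g.
Proof.
rewrite -eigen_mxM; [|exact: eigen_map_lmul..].
by congr eigen_mx; apply/funext => x; rewrite invgM mulgA.
Qed.

Lemma translate_mx_rep : matrix_rep (fun g => complex_mx (translate_mx g)).
Proof.
split.
- rewrite /translate_mx (_ : (fun x => _) = fun x => x) ?eigen_mx1 /complex_mx ?map_mx1//.
  by apply/funext => x; rewrite invg1 mul1g.
- by move=> g h; rewrite translate_mxM complex_mxM.
- by move=> g; apply/complex_mx_orthogonal/eigen_mx_orthogonal/eigen_map_lmul.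
- move=> v g d d0.
  (* The squared distance is a polynomial in the entries of the translation matrix, which are
     continuous. *)
  pose D (a : 'rV[R]_n) h j := \sum_i a 0 i * (translate_mx g i j - translate_mx h i j).
  pose F h := \sum_j (D (map_mx (@complex.Re R) v) h j ^+ 2
    + D (map_mx (@complex.Im R) v) h j ^+ 2).
  have cD a j : continuous (fun h => D a h j).
    apply: continuous_sum => i; apply: continuous_scale; apply: continuous_sub.
      exact: continuous_const.
    exact: continuous_translate_mx.
  have cF : continuous F.
    apply: continuous_sum => j; apply: continuous_add; under eq_fun do rewrite expr2;
      exact: continuous_prod.
  have FE h : nrm2 (v *m complex_mx (translate_mx g) - v *m complex_mx (translate_mx h)) = F h.
    rewrite -mulmxBr -map_mxB nrm2_Re_Im; apply: eq_bigr => j _.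
    rewrite Re_mul_complex_mx Im_mul_complex_mx.
    by congr (_ ^+ 2 + _ ^+ 2); rewrite mxE; apply: eq_bigr => i _; rewrite !mxE.
  have Fg : F g < d.
    by rewrite -FE subrr /nrm2 big1// => j _; rewrite mxE /sqmod /= !expr0n/= addr0.
  apply: (@filterS _ _ (nbhs_filter g)) (near_sublevel cF Fg) => h /=.
  by rewrite FE.
Qed.

(* A row vector fixed by all translation matrices is the coordinate vector of a
   translation invariant, hence constant, eigenfunction. *)
Lemma translate_mx_fixed (a : 'rV[R]_n) : I phi = 0 -> 0 < conv_max phi ->
  (forall g, a *m translate_mx g = a) -> a = 0.
Proof.
move=> I0 M0 afix; have [ev eo] := oe.
pose u x := \sum_i a 0 i * e i x.
have ug g x : u (g^-1 * x)%g = u x.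
  rewrite /u -[in RHS](afix g).
  under eq_bigr do rewrite (eigen_mxE _ _ (eigen_map_lmul g)) mulr_sumr.
  rewrite exchange_big/=; apply: eq_bigr => j _; rewrite mxE mulr_suml.
  by apply: eq_bigr => i _; rewrite mulrA.
have uc : u = fun=> u 1%g.
  by apply/funext => x; rewrite -(ug x x) mulVg.
have eu : eigenfunction phi u by exact: eigenfunction_comb.
have u0 : u 1%g = 0.
  by apply: (eigenfunction_const cG cphi I0 M0); rewrite -uc.
apply/rowP => j; rewrite mxE -(orthonormal_coef cG (a 0) j oe) -/u uc u0.
by rewrite /fdot (_ : (fun x => _) = fun=> 0) ?(haar_mean_cst cG)//; apply/funext => x; rewrite mul0r.
Qed.

End EigenMatrix.

Lemma invariant_kernel_finite_dual_orbit (R : realType) (G : topGroupType)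
    (Gamma : set (topAut G)) (phi : G -> R) :
  compact [set: G] -> continuous phi -> (forall x, phi x^-1%g = phi x) ->
  haar_mean phi = 0 -> (exists x, phi x != 0) ->
  (forall b, Gamma b -> forall x, phi (b x) = phi x) ->
  exists pi : unitaryRep R G,
    [/\ irreducible_rep pi, nontrivial_rep pi & finite_pred (dual_orbit Gamma pi)].
Proof.
move=> cG cphi phiV I0 [x0 phix0] Gphi.
have M0 : 0 < conv_max phi.
  (* The value of T phi at 1 is the mean of phi^2, which is positive. *)
  apply: (@conv_max_gt0 R G cG phi cphi phi 1%g cphi).
  rewrite gt_eqF// /conv; apply: (@haar_mean_gt0 R G cG _ x0).
  - by under eq_fun do rewrite invg1 mul1g; exact: continuous_prod.
  - by move=> x; rewrite invg1 mul1g -expr2 sqr_ge0.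
  - by rewrite invg1 mul1g -expr2 exprn_even_gt0.
have [n [e [n0 oe span]]] := eigenbasis_ex cG cphi phiV M0.
apply: (matrix_finite_dual_orbit (translate_mx_rep cG cphi oe span) n0).
- move=> v vfix.
  (* The matrices are real, so they fix the real and imaginary parts of a fixed vector
     separately. *)
  have fix_part (p : R[i] -> R) : (forall M, map_mx p (v *m complex_mx M) = map_mx p v *m M) ->
      map_mx p v = 0.
    move=> pM; apply: (translate_mx_fixed cG cphi oe span I0 M0) => g.
    by rewrite -pM vfix.
  have v1 := fix_part _ (Re_mul_complex_mx v); have v2 := fix_part _ (Im_mul_complex_mx v).
  apply/rowP => j; move: v1 v2 => /rowP/(_ j) + /rowP/(_ j).
  by rewrite !mxE; case: (v 0 j) => a b /= -> ->.
- move=> b Gb.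
  have phib x : phi ((b^-1)%g x) = phi x.
    by rewrite -[LHS](Gphi b Gb); congr phi; exact: aut_invK.
  have eb := eigen_map_aut cG cphi phib.
  (* Q is composition with b^-1, and the relation is b^-1(g^-1 x) = (b^-1(g))^-1 b^-1(x). *)
  exists (complex_mx (eigen_mx e (b^-1)%g)).
    by apply/complex_mx_orthogonal/(eigen_mx_orthogonal cG oe span).
  move=> g; rewrite -!complex_mxM /translate_mx.
  rewrite -!(eigen_mxM cG oe span)//; try exact: eigen_map_lmul.
  congr (complex_mx (eigen_mx _ _)); apply/funext => x; rewrite aut_funM.
  by rewrite aut_funV.
Qed.

(** * Invariant sets of non-ergodic actions *)

Section InvariantSetKernel.
Variables (R : realType) (G : topGroupType).
Hypothesis cG : compact [set: G].
Hypothesis metrizableG : metrizable R G.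
Variable mu : probability (borel G) R.
Hypothesis hmu : normalized_haar mu.

(** The image of [mu] under b is left invariant, since the preimage of g C is the translate of the
    preimage of C by b^-1(g); uniqueness concludes. *)
Lemma normalized_haar_aut (b : topAut G) (B : set (borel G)) : measurable B ->
  mu (b @^-1` B) = mu B.
Proof.
move=> mB; have mb := continuous_borel (@aut_fun_continuous _ b).
pose X : {RV mu >-> borel G} := mfun_Sub (mem_set mb).
have hX : normalized_haar (distribution mu X).
  move=> g C mC.
  change (mu (b @^-1` [set (g * x)%g | x in C]) = mu (b @^-1` C)).
  have mXC : measurable (b @^-1` C : set (borel G)).
    rewrite -[X in measurable X]setTI.
    by apply: (continuous_borel (@aut_fun_continuous _ b)).
  rewrite -(hmu (aut_inv b g) mXC); congr (mu _).
  by rewrite !image_lmul; apply/seteqP; split=> x /=; rewrite aut_funM aut_funV aut_invK.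
exact: (haar_measure_unique cG metrizableG hX hmu mB).
Qed.

Variable A : set (borel G).
Hypothesis mA : measurable A.

Let lA (g : G) : set (borel G) := [set (g * x)%g | x in A].

Let mlA g : measurable (lA g). Proof. exact: borel_lmul. Qed.

Let fin (B : set (borel G)) : measurable B -> mu B \is a fin_num.
Proof. exact: fin_num_measure. Qed.

Definition self_overlap (g : G) : R := fine (mu ([set (g * x)%g | x in A] `&` A)).

Lemma self_overlap1 : self_overlap 1%g = fine (mu A).
Proof.
by congr (fine (mu _)); rewrite image_lmul invg1; under eq_fun do rewrite mul1g; rewrite setIid.
Qed.

Lemma self_overlapV g : self_overlap g^-1%g = self_overlap g.
Proof.
have m1 : measurable (lA g^-1%g `&` A) by exact: measurableI.
congr fine; rewrite -[LHS](hmu g m1); congr (mu _).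
rewrite /lA !image_lmul; apply/seteqP.
by split=> x /=; rewrite invgK mulVKg => -[].
Qed.

Lemma self_overlap_aut (b : topAut G) g : b @` A = A -> self_overlap (b g) = self_overlap g.
Proof.
move=> bA; have bAE x : A (b x) = A x.
  apply/propext; split=> [|Ax]; last by rewrite -bA; exists x.
  by rewrite -{1}bA => -[y Ay /(can_inj (aut_funK b)) <-].
have m1 : measurable (lA (b g) `&` A) by exact: measurableI.
congr fine; rewrite -(normalized_haar_aut b m1); congr (mu _).
rewrite /lA !image_lmul; apply/seteqP.
by split=> x /=; rewrite -aut_funV -aut_funM !bAE.
Qed.

(* With C a subset of A and U a superset of A, closed and open respectively and
   close to A in measure, A \ hA is contained in (A \ C) U h (U \ A) as soon as
   h^-1 C is contained in U. *)
Lemma near_self_overlap (e : R) : 0 < e ->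
  \forall h \near (1%g : G), (mu (A `\` lA h) < e%:E)%E.
Proof.
move=> e0; have e20 : 0 < e / 2 by rewrite divr_gt0.
have [U [oU AU muU]] := haar_outer_regular cG metrizableG hmu mA e20.
(* The complement of [V] serves as the closed set C inside A. *)
have [V [oV AV muV]] := haar_outer_regular cG metrizableG hmu (measurableC mA) e20.
have mU := open_borel oU; have mV := open_borel oV.
have diff (B B' : set (borel G)) : measurable B -> measurable B' -> B `<=` B' ->
    (mu B' < mu B + (e / 2)%:E)%E -> (mu (B' `\` B) < (e / 2)%:E)%E.
  move=> mB mB' BB' lt; rewrite measureD//; last by rewrite ltey_eq fin.
  by rewrite (setIidr BB') lteBlDl// fin.
have near_U : \forall h \near (1%g : G), forall y, ~ V y -> U (h^-1 * y)%g.
  apply: near_compact_all => // y.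
  have [Vy|/AU Uy] : V y \/ A y by have [?|/AV ?] := pselect (A y); [right|left].
    exists (V, setT) => /=; first by split; [exact: open_nbhs_nbhs|exact: filterT].
    by move=> [y' h] /= [].
  have c1 : continuous (fun z : G * G => (z.2^-1 * z.1)%g).
    apply: continuous_mul; last by move=> z; exact: cvg_fst.
    by apply: continuous_inv => z; exact: cvg_snd.
  have nU : nbhs ((1%g : G)^-1 * y)%g U.
    by rewrite invg1 mul1g; exact: open_nbhs_nbhs.
  have := c1 (y, 1%g) U nU.
  by apply: (@filterS _ _ (nbhs_filter (y, 1%g : G))) => -[y' h] /= + _.
apply: (@filterS _ _ (nbhs_filter _) _ _ _ near_U) => h hU.
have m1 : measurable (V `\` ~` A : set (borel G)) by apply: measurableD => //; exact: measurableC.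
have m2 : measurable (U `\` A : set (borel G)) by exact: measurableD.
have sub : A `\` lA h `<=` (V `\` ~` A) `|` [set (h * x)%g | x in U `\` A].
  rewrite /lA !image_lmul => x /= [Ax nAx].
  have [Vx|/hU Ux] := pselect (V x); first by left; split=> // /(_ Ax).
  by right.
apply: le_lt_trans (le_measure mu _ _ sub) _; rewrite ?inE.
- exact: measurableD.
- by apply: measurableU => //; exact: borel_lmul.
apply: (@le_lt_trans _ _ (mu (V `\` ~` A) + mu (U `\` A))%E).
  by rewrite -(hmu h m2); exact: (measureU2 mu m1 (borel_lmul h m2)).
by rewrite (splitr e) EFinD lteD//; [exact: diff (measurableC mA) _ _ _|exact: diff].
Qed.

(** A point of g A outside h A lies in the translate by g of A minus g^-1 h A. Used in both orders,
    this reduces continuity at g to [near_self_overlap] at 1. *)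
Lemma self_overlap_le g h :
  self_overlap g <= self_overlap h + fine (mu (A `\` lA (g^-1 * h)%g)).
Proof.
have m1 : measurable (A `\` lA (g^-1 * h)%g) by exact: measurableD.
have mgI k : measurable (lA k `&` A) by exact: measurableI.
have sub : lA g `&` A `<=` (lA h `&` A) `|` [set (g * x)%g | x in A `\` lA (g^-1 * h)%g].
  rewrite /lA !image_lmul => x /= [Agx Ax].
  have [Ahx|nAhx] := pselect (A (h^-1 * x)%g); first by left.
  by right; split=> //; rewrite invgM invgK -mulgA mulVKg.
have m2 : measurable ([set (g * x)%g | x in A `\` lA (g^-1 * h)%g] : set (borel G)).
  exact: borel_lmul.
have [f1 f2 f3] : [/\ mu (lA g `&` A) \is a fin_num, mu (lA h `&` A) \is a fin_num &
    mu [set (g * x)%g | x in A `\` lA (g^-1 * h)%g] \is a fin_num].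
  by split; exact: fin.
rewrite /self_overlap -(hmu g m1) -fineD; [|exact: f2|exact: f3].
apply: fine_le; [exact: f1|by rewrite fin_numD f2|].
apply: le_trans (le_measure mu _ _ sub) _; rewrite ?inE//.
  exact: measurableU.
exact: measureU2.
Qed.

Lemma continuous_self_overlap : continuous self_overlap.
Proof.
move=> g; apply/cvgrPdist_lt => e e0.
have c1 : continuous (fun h => (g^-1 * h)%g) by exact: continuous_lmul.
have c2 : continuous (fun h => (h^-1 * g)%g).
  apply: continuous_mul; last exact: continuous_const.
  by apply: continuous_inv; exact: continuous_idfun.
have lt_fine B : measurable (B : set (borel G)) -> (mu B < e%:E)%E -> fine (mu B) < e.
  by move=> mB; rewrite -lte_fin fineK ?fin.
have near1 (k : G -> G) : continuous k -> k g = 1%g ->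
    \forall h \near g, (mu (A `\` lA (k h)) < e%:E)%E.
  move=> ck kg; have := ck g [set h | (mu (A `\` lA h) < e%:E)%E].
  by rewrite kg => /(_ (near_self_overlap e0)).
have n1 := near1 _ c1 (mulVg g); have n2 := near1 _ c2 (mulVg g).
apply: (@filterS2 _ _ (nbhs_filter g) _ _ _ _ n1 n2) => h.
move=> /(lt_fine _ (measurableD mA (mlA _))) l1 /(lt_fine _ (measurableD mA (mlA _))) l2.
by rewrite ltr_norml; have := self_overlap_le g h; have := self_overlap_le h g; lra.
Qed.

(* Were the overlap constant, A would be invariant up to null sets and the
   restriction of mu to A, once normalized, would be another Haar measure. *)
Lemma self_overlap_nonconstant : mu A != 0%E -> mu A != 1%E ->
  exists g, self_overlap g != fine (mu A).
Proof.
move=> A0 A1; apply: contrapT => /forallNP H.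
have mu0 : 0 < fine (mu A).
  by rewrite fine_gt0// lt_neqAle eq_sym A0 measure_ge0/= ltey_eq fin.
have mI g : measurable (lA g `&` A) by exact: measurableI.
have muI g : mu (lA g `&` A) = mu A.
  by apply/eqP; rewrite -(fineK (fin (mI g))) -(fineK (fin mA)) eqe; have /negP := H g; rewrite negbK.
have muD g : mu (A `\` lA g) = 0%E.
  have -> : mu (A `\` lA g) = (mu A - mu (lA g `&` A))%E.
    by rewrite [_ `&` A]setIC; apply: measureD => //; rewrite ltey_eq fin.
  by rewrite muI subee ?fin.
have muD' g : mu (lA g `\` A) = 0%E.
  have -> : mu (lA g `\` A) = (mu (lA g) - mu (lA g `&` A))%E.
    by apply: measureD => //; rewrite ltey_eq fin.
  by rewrite muI /lA (hmu g mA) subee ?fin.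
have c0 : 0 <= (fine (mu A))^-1 by rewrite invr_ge0 ltW.
have cA : ((fine (mu A))^-1%:E * mu A = 1)%E.
  by rewrite -[X in (_ * X)%E](fineK (fin mA)) -EFinM mulVf ?gt_eqF.
have [|nu nuE] := @measure_probability R _ (borel G) (mscale (NngNum c0) (mrestr mu mA)).
  by change ((fine (mu A))^-1%:E * mu (setT `&` A) = 1)%E; rewrite setTI.
have nuI B : nu B = ((fine (mu A))^-1%:E * mu (B `&` A))%E by rewrite nuE.
have hnu : normalized_haar nu.
  move=> g B mB; have mgB := borel_lmul g mB.
  rewrite !nuI; congr (_ * _)%E.
  pose gB : set (borel G) := [set (g * x)%g | x in B].
  have mBA : measurable ((B : set (borel G)) `&` A) by exact: measurableI.
  have gI : mu (gB `&` lA g) = mu (B `&` A).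
    rewrite -(hmu g mBA); congr (mu _).
    by rewrite /gB /lA !image_lmul.
  have null (C D : set (borel G)) : measurable C -> measurable D -> C `<=` D ->
      mu D = 0%E -> mu C = 0%E.
    by move=> mC mD CD D0; exact: (subset_measure0 mC mD CD D0).
  (* Cutting further by D loses no mass inside C when C minus D is null; used for A and g A in both
     orders, it replaces A by g A. *)
  have split_mu (C D : set (borel G)) : measurable C -> measurable D ->
      mu (C `\` D) = 0%E -> mu (gB `&` C) = mu ((gB `&` C) `&` D).
    move=> mC mD CD; rewrite (measureDI mu (measurableI _ _ mgB mC) mD).
    rewrite [X in (X + _)%E](null _ (C `\` D)) ?add0e//.
    - by apply: measurableD => //; exact: measurableI.
    - exact: measurableD.
    - by move=> x [[_ Cx] Dx].
  by rewrite -gI (split_mu A (lA g))// (split_mu (lA g) A)// -!setIA [lA g `&` A]setIC.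
(* The normalized restriction gives A mass 1, hence so would [mu]. *)
have := haar_measure_unique cG metrizableG hnu hmu mA.
rewrite nuI setIid cA => /esym/eqP.
by rewrite (negPf A1).
Qed.

End InvariantSetKernel.

Lemma not_ergodic_finite_dual_orbit (R : realType) (G : topGroupType)
    (Gamma : set (topAut G)) :
  compact [set: G] -> metrizable R G -> ~ ergodic R Gamma ->
  exists pi : unitaryRep R G,
    [/\ irreducible_rep pi, nontrivial_rep pi & finite_pred (dual_orbit Gamma pi)].
Proof.
move=> cG mG /existsNP[mu /not_implyP[hmu /existsNP[A]]].
move=> /not_implyP[mA /not_implyP[GA /not_orP[A0 A1]]].
have cs := continuous_self_overlap cG mG hmu mA.
pose c := haar_mean (self_overlap mu A).
have cc : continuous (fun _ : G => c) by exact: continuous_const.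
apply: (@invariant_kernel_finite_dual_orbit R G Gamma (fun g => self_overlap mu A g - c)) => //.
- exact: continuous_sub.
- by move=> g; rewrite self_overlapV.
- by rewrite (haar_meanB cG)// (haar_mean_cst cG) subrr.
- apply: contrapT => /forallNP H.
  have sc g : self_overlap mu A g = c.
    by apply/eqP; rewrite -subr_eq0; have /negP := H g; rewrite negbK.
  (* A constant overlap would equal its value at 1, the measure of A. *)
  have [| |g] := self_overlap_nonconstant cG mG hmu mA; [exact/eqP..|].
  by rewrite -self_overlap1 !sc eqxx.
- by move=> b /GA bA g; rewrite self_overlap_aut.
Qed.

Theorem proposition2p1 (R : realType) (K : topGroupType)
  (Gamma : subgroup (topAut K)) :
  compact [set: K] -> metrizable R K -> (exists x : K, x <> 1%g) ->
  [<-> distal Gamma;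
       forall L : subgroup K,
         closed (subgroup_set L) -> invariant_set Gamma L ->
         subgroup_set L <> [set 1%g] ->
         ~ ergodic R (restr_action Gamma L);
       forall L : subgroup K,
         closed (subgroup_set L) -> invariant_set Gamma L ->
         subgroup_set L <> [set 1%g] ->
         exists pi : unitaryRep R (subgroup_type L),
           [/\ irreducible_rep pi, nontrivial_rep pi &
               finite_pred (dual_orbit (restr_action Gamma L) pi)]].
Proof.
move=> cK mK _; tfae.
- by move=> distalK L clL _ L1; exact: distal_not_ergodic.
- move=> H L clL GL L1; apply: not_ergodic_finite_dual_orbit (H L clL GL L1).
    exact: compact_subgroup.
  exact: metrizable_subgroup.
- exact: finite_dual_orbit_distal.
Qed.
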